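(* Let $\rho\in]0,+\infty[$ and $\lambda\in]0,n-1[$. Let $\Omega$ be a bounded open Lipschitz subset of $\mathbb{R}^n$ such that $\mathrm{cl}\,\Omega\subseteq Q$. Let $\Omega_2$ be an open subset of $\mathbb{R}^n$ such that $$\mathrm{cl}\,\Omega\subseteq\Omega_2\subseteq\mathrm{cl}\,\Omega_2\subseteq Q.$$ Let $G$ be an open relatively compact subset of $\mathbb{R}^n$ such that $(\mathrm{cl}\,G)\cap q\mathbb{Z}^n=\emptyset$. If $\Omega\neq\emptyset$, assume that $G$ is an open neighborhood of the set $$\{t-s:\ t\in(\mathrm{cl}\,Q)\setminus\Omega_2,\ s\in\partial\Omega\}.$$ If instead $\Omega=\emptyset$, assume that $G=\emptyset$. Then the following statements hold. (i) Let $\Omega\neq\emptyset$. For all pairs $(h,\varphi)\in H_q^{\lambda,\rho}(G)\times C^0_{\omega,\rho}(\mathrm{cl}\,\Omega)$ the restriction of $\mathcal{P}^+[h,\varphi]$ to $\mathrm{cl}\,\mathbb{S}[\Omega_2]^-$ belongs to $C^0_{q,\omega,\rho}(\mathrm{cl}\,\mathbb{S}[\Omega_2]^-)$, and the map from $H_q^{\lambda,\rho}(G)\times C^0_{\omega,\rho}(\mathrm{cl}\,\Omega)$ to $C^0_{q,\omega,\rho}(\mathrm{cl}\,\mathbb{S}[\Omega_2]^-)$ which takes $(h,\varphi)$ to $\mathcal{P}^+[h,\varphi]_{|\mathrm{cl}\,\mathbb{S}[\Omega_2]^-}$ is bilinear and continuous. (ii) For all pairs $(h,\varphi)\in H_q^{\lambda,\rho}(G)\times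 C^0_{q,\omega,\rho}(\mathrm{cl}\,\mathbb{S}[\Omega]^-)$ the restriction of $\mathcal{P}^-[h,\varphi_{|Q\setminus\mathrm{cl}\,\Omega}]$ to $\mathrm{cl}\,\mathbb{S}[\Omega_2]^-$ belongs to $C^0_{q,\omega,\rho}(\mathrm{cl}\,\mathbb{S}[\Omega_2]^-)$, and the map from $H_q^{\lambda,\rho}(G)\times C^0_{q,\omega,\rho}(\mathrm{cl}\,\mathbb{S}[\Omega]^-)$ to $C^0_{q,\omega,\rho}(\mathrm{cl}\,\mathbb{S}[\Omega_2]^-)$ which takes $(h,\varphi)$ to $\mathcal{P}^-[h,\varphi_{|Q\setminus\mathrm{cl}\,\Omega}]_{|\mathrm{cl}\,\mathbb{S}[\Omega_2]^-}$ is bilinear and continuous.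
   Context: Fix a natural number $n\ge 2$ and $(q_{11},\dots,q_{nn})\in]0,+\infty[^n$. Let $Q=\prod_{j=1}^n]0,q_{jj}[$, $\tilde Q=\prod_{j=1}^n]-q_{jj}/2,q_{jj}/2[$, let $q$ be the diagonal matrix with entries $q_{11},\dots,q_{nn}$, and $q\mathbb{Z}^n=\{qz: z\in\mathbb{Z}^n\}$. $\mathrm{cl}$ denotes closure and $\mathbb{N}$ includes $0$. Functions are complex-valued. A function is $q$-periodic if it is invariant under translations by elements of $q\mathbb{Z}^n$ (on a domain invariant under such translations). For $\Omega\subseteq\mathbb{R}^n$ open with $\mathrm{cl}\,\Omega\subseteq Q$, set $\mathbb{S}[\Omega]=\bigcup_{z\in\mathbb{Z}^n}(qz+\Omega)$ and $\mathbb{S}[\Omega]^-=\mathbb{R}^n\setminus\mathrm{cl}\,\mathbb{S}[\Omega]$ (so $\mathbb{S}[\emptyset]^-=\mathbb{R}^n$); $\mathrm{cl}\,\mathbb{S}[\Omega]^-$ is the closure of $\mathbb{S}[\Omega]^-$. For an open set $U$, $C^m(\mathrm{cl}\,U)$ is the set of $m$ times continuously differentiable functions on $U$ whose derivatives of order $\le m$ extend continuously to $\mathrm{cl}\,U$ ($m\in\mathbb{N}\cup\{\infty\}$). $C^\infty_q(\mathrm{cl}\,\mathbb{S}[\Omega]^-)$ is the set of $q$-periodic functions in $C^\infty(\mathrm{cl}\,\mathbb{S}[\Omega]^-)$ all of whose derivatives are bounded. $C^k_q(\mathbb{R}^n\setminus q\mathbb{Z}^n)$ is the set of $q$-periodic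 functions of class $C^k$ on $\mathbb{R}^n\setminus q\mathbb{Z}^n$. Roumieu classes ($\rho>0$). For $\Omega$ bounded open, $C^0_{\omega,\rho}(\mathrm{cl}\,\Omega)$ is the Banach space of $u\in C^\infty(\mathrm{cl}\,\Omega)$ with finite norm $$\|u\|=\sup_{\beta\in\mathbb{N}^n}\frac{\rho^{|\beta|}}{|\beta|!}\sup_{\mathrm{cl}\,\Omega}|D^\beta u|.$$ If $\mathrm{cl}\,\Omega\subseteq Q$, $C^0_{q,\omega,\rho}(\mathrm{cl}\,\mathbb{S}[\Omega]^-)$ is the Banach space of $u\in C^\infty_q(\mathrm{cl}\,\mathbb{S}[\Omega]^-)$ with finite norm $$\|u\|=\sup_{\beta\in\mathbb{N}^n}\frac{\rho^{|\beta|}}{|\beta|!}\sup_{(\mathrm{cl}\,Q)\setminus\Omega}|D^\beta u|,$$ where the inner supremum is understood over the points of $(\mathrm{cl}\,Q)\setminus\Omega$ that lie in $\mathrm{cl}\,\mathbb{S}[\Omega]^-$ (for Lipschitz $\Omega$ these are all the points of $(\mathrm{cl}\,Q)\setminus\Omega$). Kernels. For $\lambda>0$, $A^0_{q,\lambda}$ is the Banach space of $h\in C^0_q(\mathbb{R}^n\setminus q\mathbb{Z}^n)$ with finite norm $\|h\|_{A^0_{q,\lambda}}=\sup_{x\in\tilde Q\setminus\{0\}}|h(x)||x|^\lambda$. $A^1_{q,\lambda}$ is the Banach space of $h\in C^1_q(\mathbb{R}^n\setminus q\mathbb{Z}^n)$ such that $h\in A^0_{q,\lambda}$ and $\partial h/\partial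 x_j\in A^0_{q,\lambda+1}$ for all $j$, with norm $\|h\|_{A^1_{q,\lambda}}=\|h\|_{A^0_{q,\lambda}}+\sum_{j=1}^n\|\partial h/\partial x_j\|_{A^0_{q,\lambda+1}}$. For $G\subseteq\mathbb{R}^n$ open with $\mathrm{cl}\,G$ bounded and contained in $\mathbb{R}^n\setminus q\mathbb{Z}^n$, $H_q^{\lambda,\rho}(G)$ is the Banach space of $h\in A^1_{q,\lambda}$ with $h_{|\mathrm{cl}\,G}\in C^0_{\omega,\rho}(\mathrm{cl}\,G)$, with norm $\|h\|_{A^1_{q,\lambda}}+\|h\|_{C^0_{\omega,\rho}(\mathrm{cl}\,G)}$; if $G=\emptyset$, then $H_q^{\lambda,\rho}(G)=A^1_{q,\lambda}$ with the norm of $A^1_{q,\lambda}$. Potentials. For $h\in A^0_{q,\lambda}$ with $0<\lambda<n$ and bounded measurable $\varphi$ on the relevant set, and for $x\in\mathbb{R}^n$, $$\mathcal{P}^+[h,\varphi](x)=\int_\Omega h(x-y)\varphi(y)\,dy,\qquad \mathcal{P}^-[h,\varphi](x)=\int_{Q\setminus\mathrm{cl}\,\Omega}h(x-y)\varphi(y)\,dy.$$ A product of normed spaces carries the sum norm. *)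

(* Defs.v *)
(* MathComp-Analysis.  R^n is 'rV[R]_n: its library norm is the sup norm, used
   here only for topology and boundedness, and |x| is the Euclidean [enorm].
   The complex numbers are the type R[i] of mathcomp-real-closed. *)
From HB Require Import structures.
From mathcomp Require Import all_boot all_order all_algebra.
From mathcomp Require Import complex.
From mathcomp Require Import all_classical all_reals all_analysis.

Set Implicit Arguments.
Unset Strict Implicit.
Unset Printing Implicit Defensive.

Import Order.TTheory GRing.Theory Num.Theory.
Import numFieldNormedType.Exports.

Local Open Scope classical_set_scope.
Local Open Scope ring_scope.

(* Lebesgue measure on R^n, carried by n-tuples (which have the product Borel
   sigma-algebra in the library) and built as an iterated product measure;
   [lebesgue_tuple_box] gives its value on boxes. *)
Section lebesgue_measure_tuple.
Context {R : realType}.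
Local Open Scope ereal_scope.
Local Notation RT := (measurableTypeR R).

Section cons_measure.
Variables (n : nat) (mu : {sigma_finite_measure set (n.-tuple RT) -> \bar R}).

Definition cons_tuple_of_pair (p : RT * n.-tuple RT) : n.+1.-tuple RT :=
  [tuple of p.1 :: p.2].

Lemma measurable_cons_tuple_of_pair : measurable_fun setT cons_tuple_of_pair.
Proof. exact: measurable_cons. Qed.

Definition cons_measure : set (n.+1.-tuple RT) -> \bar R :=
  pushforward (lebesgue_measure \x mu) cons_tuple_of_pair.

Let cons_measure0 : cons_measure set0 = 0.
Proof. by rewrite /cons_measure /pushforward preimage_set0 measure0. Qed.

Let cons_measure_ge0 A : 0 <= cons_measure A.
Proof. by rewrite /cons_measure /pushforward; apply: measure_ge0. Qed.

Let cons_measure_sigma_additive : semi_sigma_additive cons_measure.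
Proof.
move=> F mF tF mUF; rewrite /cons_measure /pushforward preimage_bigcup.
have mc A : measurable A -> measurable (cons_tuple_of_pair @^-1` A).
  by move=> mA; rewrite -[X in measurable X]setTI;
    exact: measurable_cons_tuple_of_pair.
apply: measure_semi_sigma_additive.
- by move=> k; exact: mc.
- apply/trivIsetP => /= i j _ _ ij; rewrite -preimage_setI.
  by move/trivIsetP : tF => /(_ _ _ _ _ ij) ->//; rewrite preimage_set0.
- by rewrite -preimage_bigcup; exact: mc.
Qed.

HB.instance Definition _ := isMeasure.Build _ _ _ cons_measure
  cons_measure0 cons_measure_ge0 cons_measure_sigma_additive.

Let cons_measure_sigma_finite : sigma_finite setT cons_measure.
Proof.
pose d (t : n.+1.-tuple RT) : RT * n.-tuple RT := (thead t, [tuple of behead t]).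
have md : measurable_fun setT d.
  apply: measurable_fun_pair; first exact: (@measurable_tnth _ RT n.+1 ord0).
  exact: measurable_behead.
have cK : cancel cons_tuple_of_pair d.
  by move=> [x t]; congr pair; apply: val_inj.
have [F TF Foo] : sigma_finite setT (lebesgue_measure \x mu).
  have /sigma_finiteP[F [TF ndF Foo]] := sigma_finiteT (@lebesgue_measure R).
  have /sigma_finiteP[G [TG ndG Goo]] := sigma_finiteT mu.
  exists (fun k => F k `*` G k).
    rewrite -setXTT TF TG predeqE => -[x y]; split; last first.
      by move=> [k _ []/= ? ?]; split; exists k.
    move=> [/= [k _ Fkx] [l _ Gly]]; exists (maxn k l) => //; split.
    - by move: x Fkx; exact/subsetPset/ndF/leq_maxl.
    - by move: y Gly; exact/subsetPset/ndG/leq_maxr.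
  move=> k; have [? ?] := Foo k; have [? ?] := Goo k.
  split; first exact: measurableX.
  by rewrite product_measure1E// lte_mul_pinfty// ge0_fin_numE.
exists (fun k => d @^-1` F k).
  by rewrite -preimage_bigcup -TF preimage_setT.
move=> k; have [mFk Fk] := Foo k; split.
  by rewrite -[X in measurable X]setTI; exact: md.
rewrite /cons_measure /pushforward (_ : _ @^-1` _ = F k)//.
by apply/seteqP; split => x /=; rewrite cK.
Qed.

HB.instance Definition _ := Measure_isSigmaFinite.Build _ _ _ cons_measure
  cons_measure_sigma_finite.

End cons_measure.

Fixpoint lebesgue_tuple n : {sigma_finite_measure set (n.-tuple RT) -> \bar R} :=
  match n with
  | 0 => \d_ ([tuple] : 0.-tuple RT)
  | n'.+1 => cons_measure (lebesgue_tuple n')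
  end.

Lemma lebesgue_tuple_box n (A : 'I_n -> set RT) : (forall i, measurable (A i)) ->
  lebesgue_tuple n [set t : n.-tuple RT | forall i, A i (tnth t i)] =
  \prod_(i < n) lebesgue_measure (A i).
Proof.
have mS m (B : 'I_m -> set RT) : (forall i, measurable (B i)) ->
    measurable [set t : m.-tuple RT | forall i, B i (tnth t i)].
  move=> mB; rewrite (_ : mkset _ =
      \bigcap_(i in [set: 'I_m]) ((@tnth m RT ^~ i) @^-1` B i)).
    apply: fin_bigcap_measurable => [|i _]; first exact: finite_finset.
    by rewrite -[X in measurable X]setTI; exact: measurable_tnth.
  by apply/seteqP; split => t /= H i; [move=> _; exact: H|exact: (H i I)].
elim: n A => [|n IH] A mA.
  by rewrite big_ord0 /= diracE mem_set//; case.
rewrite big_ord_recl -(IH (fun i => A (lift ord0 i)))//.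
rewrite /= /cons_measure /pushforward -product_measure1E//; last first.
  exact: (mS n (fun i => A (lift ord0 i)) (fun i => mA (lift ord0 i))).
congr product_measure1; apply/seteqP; split => [[x t] /= H|[x t] /= [Hx Ht] i].
  split; first exact: (H ord0).
  by move=> i; have := H (lift ord0 i); rewrite tnthS.
by case: (unliftP ord0 i) => [j ->|->] //; rewrite tnthS; exact: Ht.
Qed.

End lebesgue_measure_tuple.

Section spaces.
Context {R : realType} {n : nat}.
Local Notation E := 'rV[R]_n.
Local Notation C := R[i].
Local Notation RT := (measurableTypeR R).
Implicit Types (A U : set E) (u h : E -> C).

Definition enorm m (x : 'rV[R]_m) : R := Num.sqrt (\sum_j x 0 j ^+ 2).

Definition boundary A : set E := closure A `\` interior A.

(* Every boundary point p has a cylindrical neighbourhood in which, after a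
   translation and an orthogonal change of coordinates, the set is the strict
   hypograph of a Lipschitz function vanishing at 0.  The graph direction is
   the k-th new coordinate, and [col' k y] is y without its k-th entry. *)
Definition lipschitz_open A : Prop :=
  open A /\
  forall p, boundary A p ->
  exists (M : 'M[R]_n) (k : 'I_n) (r delta L : R) (gamma : 'rV[R]_n.-1 -> R),
    [/\ M *m M^T = 1%:M, 0 < r, 0 < delta & gamma 0 = 0] /\
    [/\ forall eta, enorm eta < r -> `|gamma eta| < delta,
        forall eta xi, enorm eta < r -> enorm xi < r ->
          `|gamma eta - gamma xi| <= L * enorm (eta - xi) &
        forall x, let y := (x - p) *m M in
          enorm (col' k y) < r -> `|y 0 k| < delta ->
          (A x <-> y 0 k < gamma (col' k y))].

(* Real and imaginary parts are differentiated, and tested for continuity,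
   separately. *)
Definition ccontinuous A u : Prop :=
  {within A, continuous (fun x => complex.Re (u x))} /\
  {within A, continuous (fun x => complex.Im (u x))}.

Definition cderivable (j : 'I_n) u x : Prop :=
  derivable (fun y => complex.Re (u y)) x (delta_mx 0 j) /\
  derivable (fun y => complex.Im (u y)) x (delta_mx 0 j).

Definition cpartial (j : 'I_n) u : E -> C := fun x =>
  Complex ('D_(delta_mx 0 j) (fun y => complex.Re (u y)) x)
          ('D_(delta_mx 0 j) (fun y => complex.Im (u y)) x).

Definition cpartials (s : seq 'I_n) u : E -> C := foldr cpartial u s.

Definition mindex := {ffun 'I_n -> nat}.

Definition mdegree (b : mindex) : nat := (\sum_j b j)%N.

Definition Dpartial (b : mindex) : (E -> C) -> E -> C :=
  cpartials (flatten [seq nseq (b j) j | j <- enum 'I_n]).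

Definition Cm (m : nat) U : set (E -> C) := [set u |
  (forall s j x, (size s < m)%N -> U x -> cderivable j (cpartials s u) x) /\
  (forall s, (size s <= m)%N -> ccontinuous U (cpartials s u))].

(* The elements are identified with their continuous extensions to [closure U];
   values outside [closure U] are irrelevant. *)
Definition Cm_cl (m : nat) U : set (E -> C) := [set u |
  [/\ Cm m U u, ccontinuous (closure U) u &
      forall s, (size s <= m)%N ->
        exists2 g, ccontinuous (closure U) g &
                   forall x, U x -> g x = cpartials s u x]].

Definition Cinf_cl U : set (E -> C) := [set u | forall m, Cm_cl m U u].

(* The value at a point of [closure U] of the continuous extension of u. *)
Definition cl_ext U u : E -> C := fun x =>
  Complex (lim ((fun y => complex.Re (u y)) @ within U (nbhs x)))
          (lim ((fun y => complex.Im (u y)) @ within U (nbhs x))).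

(* Supremum of a nonnegative function, with sup over the empty set equal to 0. *)
Definition supe A (f : E -> R) : \bar R :=
  maxe 0%E (ereal_sup [set (f x)%:E | x in A]).

(* A normed space of functions on [fsp_dom], whose elements are represented by
   total functions: membership and norm only depend on the values on
   [fsp_dom], and membership includes finiteness of the norm. *)
Record fspace := FSpace {
  fsp_dom : set E;
  fsp_mem : set (E -> C);
  fsp_norm : (E -> C) -> \bar R }.

Definition maps_into (X Y Z : fspace) (F : (E -> C) -> (E -> C) -> E -> C) :=
  forall h phi, fsp_mem X h -> fsp_mem Y phi -> fsp_mem Z (F h phi).

Definition bilinear_map (X Y Z : fspace) (F : (E -> C) -> (E -> C) -> E -> C) :=
  (forall (a : C) h1 h2 phi x,
     fsp_mem X h1 -> fsp_mem X h2 -> fsp_mem Y phi -> fsp_dom Z x ->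
     F (fun y => a * h1 y + h2 y) phi x = a * F h1 phi x + F h2 phi x) /\
  (forall (a : C) h phi1 phi2 x,
     fsp_mem X h -> fsp_mem Y phi1 -> fsp_mem Y phi2 -> fsp_dom Z x ->
     F h (fun y => a * phi1 y + phi2 y) x = a * F h phi1 x + F h phi2 x).

(* The product X * Y carries the sum norm. *)
Definition continuous_map2 (X Y Z : fspace)
    (F : (E -> C) -> (E -> C) -> E -> C) :=
  forall h0 phi0, fsp_mem X h0 -> fsp_mem Y phi0 ->
  forall e : R, 0 < e -> exists2 d : R, 0 < d &
  forall h phi, fsp_mem X h -> fsp_mem Y phi ->
    (fsp_norm X (h - h0)%R + fsp_norm Y (phi - phi0)%R < d%:E)%E ->
    (fsp_norm Z (F h phi - F h0 phi0)%R < e%:E)%E.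

Definition roumieu_norm (rho : R) U A u : \bar R :=
  ereal_sup [set ((rho ^+ mdegree b / (mdegree b)`!%:R)%:E *
                  supe A (fun x => Normc.normc (cl_ext U (Dpartial b u) x)))%E
            | b in [set: mindex]].

Definition roumieu (rho : R) U : fspace := {|
  fsp_dom := closure U;
  fsp_mem := [set u | Cinf_cl U u /\
                      (roumieu_norm rho U (closure U) u < +oo)%E];
  fsp_norm := roumieu_norm rho U (closure U) |}.

Section periodic.
Variable q : 'I_n -> R.

Definition Qcell : set E := [set x | forall j, 0 < x 0 j < q j].

Definition Qtilde : set E := [set x | forall j, - (q j / 2) < x 0 j < q j / 2].

Definition qtrans (z : 'rV[int]_n) : E := \row_j (q j * (z 0 j)%:~R).

Definition qlattice : set E := range qtrans.

Definition qperiodic A u : Prop := forall x z, A x -> u (x + qtrans z) = u x.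

Definition Sper U : set E := [set x | exists z w, U w /\ x = qtrans z + w].

Definition Sper_minus U : set E := ~` closure (Sper U).

Definition Cinf_q U : set (E -> C) := [set u |
  [/\ Cinf_cl (Sper_minus U) u,
      qperiodic (closure (Sper_minus U)) u &
      forall b, exists B : R, forall x, closure (Sper_minus U) x ->
        Normc.normc (cl_ext (Sper_minus U) (Dpartial b u) x) <= B]].

Definition roumieu_q_norm (rho : R) U : (E -> C) -> \bar R :=
  roumieu_norm rho (Sper_minus U)
    ((closure Qcell `\` U) `&` closure (Sper_minus U)).

Definition roumieu_q (rho : R) U : fspace := {|
  fsp_dom := closure (Sper_minus U);
  fsp_mem := [set u | Cinf_q U u /\ (roumieu_q_norm rho U u < +oo)%E];
  fsp_norm := roumieu_q_norm rho U |}.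

Definition Cm_q (m : nat) : set (E -> C) :=
  [set h | Cm m (~` qlattice) h /\ qperiodic (~` qlattice) h].

Definition A0_norm (lam : R) h : \bar R :=
  supe (Qtilde `\ 0) (fun x => Normc.normc (h x) * enorm x `^ lam).

Definition A0 (lam : R) : fspace := {|
  fsp_dom := ~` qlattice;
  fsp_mem := [set h | Cm_q 0 h /\ (A0_norm lam h < +oo)%E];
  fsp_norm := A0_norm lam |}.

Definition A1 (lam : R) : fspace := {|
  fsp_dom := ~` qlattice;
  fsp_mem := [set h | [/\ Cm_q 1 h, fsp_mem (A0 lam) h &
                          forall j, fsp_mem (A0 (lam + 1)) (cpartial j h)]];
  fsp_norm := fun h => (A0_norm lam h +
                        \sum_j A0_norm (lam + 1) (cpartial j h))%E |}.

(* For G empty the condition on G holds trivially and its norm is 0, so that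
   this is [A1 lam]. *)
Definition Hq (lam rho : R) (G : set E) : fspace := {|
  fsp_dom := ~` qlattice;
  fsp_mem := [set h | fsp_mem (A1 lam) h /\ fsp_mem (roumieu rho G) h];
  fsp_norm := fun h => (fsp_norm (A1 lam) h + fsp_norm (roumieu rho G) h)%E |}.

End periodic.

Definition row_of_tuple (t : n.-tuple RT) : E := \row_j tnth t j.

Definition cintegral A (f : E -> C) : C :=
  Complex
    (\int[lebesgue_tuple n]_(t in row_of_tuple @^-1` A) complex.Re (f (row_of_tuple t)))
    (\int[lebesgue_tuple n]_(t in row_of_tuple @^-1` A) complex.Im (f (row_of_tuple t))).

Definition Pplus (Omega : set E) h (phi : E -> C) : E -> C := fun x =>
  cintegral Omega (fun y => h (x - y) * phi y).

Definition Pminus (q : 'I_n -> R) (Omega : set E) h (phi : E -> C) : E -> C :=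
  fun x => cintegral (Qcell q `\` closure Omega) (fun y => h (x - y) * phi y).

End spaces.

(* Main.v *)
Require Import Defs.
From mathcomp Require Import all_boot all_order all_algebra.
From mathcomp Require Import complex.
From mathcomp Require Import all_classical all_reals all_analysis.
From mathcomp Require Import measurable_realfun.
From mathcomp Require Import ring lra.

Import Order.TTheory GRing.Theory Num.Theory.
Import numFieldNormedType.Exports.

Local Open Scope classical_set_scope.
Local Open Scope ring_scope.

Set Implicit Arguments.
Unset Strict Implicit.
Unset Printing Implicit Defensive.

(** Write P for the potential with kernel h and density u, the integral being
    taken over the part of a period cell that lies in a periodic open set W.
    Two choices of W give the two potentials: W = S[Omega], the density being
    extended by periodicity, and W = S[Omega]^-.  In both cases P is the
    periodic convolution of h with u restricted to W, and the boundary of W is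
    contained in the boundary of S[Omega].  Fix a periodic cut-off function chi
    with bounded first derivatives that is 0 near the boundary of S[Omega] and 1
    outside a set N, and an open neighbourhood V of the complement of S[Omega2],
    such that V - N is contained in the union of the translates of G
    ([potential_geometry]).
    For a list s of k indices, the derivatives of P on V are
      D^s P = h * (chi D^s u) + sum_(s = s1 ++ j :: s2) (D^s1 h) * (d_j chi D^s2 u)
              + (D^s h) * ((1 - chi) u),
    where * is the periodic convolution.  The formula is proved by adding one
    derivative at a time.  On the first term the derivative is moved to the
    density by translation invariance ([conv_derive_right]); this is possible
    because chi D^s u, extended by 0 outside W, is differentiable on the whole
    space.  The factors d_j chi and 1 - chi vanish outside N, so that the other
    terms only see h on the translates of G, where it is smooth, and there the
    derivative falls on the kernel ([conv_derive_left]).  Thus no integral on the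
    boundary of Omega appears.

    The kernel is integrable on a cell because lam < n
    ([singular_kernel_integral]), with norm at most C |h|.  If the derivatives
    of order k of h on G and of u on W are at most Mh k! / rho ^ k and
    Mu k! / rho ^ k, the k terms of the sum are each at most a constant times
    Mh Mu i! (k - 1 - i)! / rho ^ (k - 1) for some i, and
    i! (k - 1 - i)! <= (k - 1)!, so that D^s P is at most a constant, which does
    not depend on s, times |h| |u| k! / rho ^ k ([potential_le]).  All
    derivatives being bounded, they are continuous
    ([bounded_partials_continuous]); as V is a neighbourhood of the closure of
    S[Omega2]^-, this gives the membership in the Roumieu class and the estimate
    |P| <= const |h| |u|.  Continuity of the bilinear map follows from the
    estimate ([potential_bilinear_continuous]).  Complex-valued kernels and
    densities are split into real and imaginary parts. *)

(** * Rows, Borel functions of a row and reflections *)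

Section row_norm.
Context {R : realType} {n : nat}.
Implicit Types x y : 'rV[R]_n.

Lemma coord_le_norm x j : `|x 0 j| <= `|x|.
Proof.
rewrite [leRHS]mx_normrE; apply: (le_bigmax _ (fun ij : 'I_1 * 'I_n => `|x ij.1 ij.2|) (0, j)).
Qed.

Lemma row_norm_ltP x (e : R) : 0 < e -> (`|x| < e <-> forall j, `|x 0 j| < e).
Proof.
move=> e0; split => [xe j|H]; first exact: le_lt_trans (coord_le_norm x j) xe.
rewrite [ltLHS]mx_normrE; apply: bigmax_lt => // -[i j] _ /=.
by rewrite (ord1 i).
Qed.

Lemma row_norm_leP x (e : R) : 0 <= e -> (`|x| <= e <-> forall j, `|x 0 j| <= e).
Proof.
move=> e0; split => [xe j|H]; first exact: le_trans (coord_le_norm x j) xe.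
rewrite [leLHS]mx_normrE; apply: bigmax_le => // -[i j] _ /=.
by rewrite (ord1 i).
Qed.

Lemma ball_rowP x (e : R) y : 0 < e ->
  (ball x e y <-> forall j, `|x 0 j - y 0 j| < e).
Proof.
move=> e0; rewrite -ball_normE /ball_/=.
by split=> [/row_norm_ltP H j|H]; [have := H e0 j|apply/row_norm_ltP => // j];
  rewrite ?mxE //; have := H j; rewrite ?mxE.
Qed.

(** The sup norm is at most the Euclidean norm. *)
Lemma enorm_ge_norm x : `|x| <= enorm x.
Proof.
apply/row_norm_leP; first exact: sqrtr_ge0.
move=> j; rewrite -sqrtr_sqr /enorm ler_sqrt; last first.
  by apply: sumr_ge0 => i _; exact: sqr_ge0.
by rewrite (bigD1 j)//= lerDl sumr_ge0// => i _; exact: sqr_ge0.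
Qed.

End row_norm.

Section row_measurability.
Context {R : realType} {n : nat}.
Local Notation RT := (measurableTypeR R).
Local Notation T := (n.-tuple RT).
Local Notation E := 'rV[R]_n.
Local Notation rot := (@row_of_tuple R n).

Lemma row_of_tupleE (t : T) j : rot t 0 j = tnth t j.
Proof. by rewrite mxE. Qed.

Lemma measurable_box (A : 'I_n -> set RT) : (forall i, measurable (A i)) ->
  measurable [set t : T | forall i, A i (tnth t i)].
Proof.
move=> mA; rewrite (_ : mkset _ =
    \bigcap_(i in [set: 'I_n]) ((@tnth n RT ^~ i) @^-1` A i)).
  apply: fin_bigcap_measurable => [|i _]; first exact: finite_finset.
  by rewrite -[X in measurable X]setTI; exact: measurable_tnth.
by apply/seteqP; split => t /= H i; [move=> _; exact: H|exact: (H i I)].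
Qed.

Lemma measurable_row_ball (x : E) (e : R) : 0 < e ->
  measurable (rot @^-1` ball x e).
Proof.
move=> e0.
rewrite (_ : _ @^-1` _ = [set t : T | forall i, ball (x 0 i) e (tnth t i)]).
  by apply: (@measurable_box (fun i => ball (x 0 i) e)) => i;
    by rewrite ball_itv; exact: measurable_itv.
apply/seteqP; split=> t /=.
  by move/ball_rowP => H i; have := H e0 i; rewrite row_of_tupleE /ball/=.
by move=> H; apply/ball_rowP => // j; rewrite row_of_tupleE; exact: H.
Qed.

(** Open sets of rows are countable unions of balls with rational centres, so
    that they pull back to measurable sets of tuples. *)
Lemma open_measurable_row (A : set E) : open A -> measurable (rot @^-1` A).
Proof.
move=> oA.
pose c (p : 'rV[rat]_n) : E := map_mx ratr p.
pose e (k : nat) : R := k.+1%:R^-1.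
pose F (k : nat) : set T :=
  if unpickle k is Some (p, m) then
    (if `[< ball (c p) (e m) `<=` A >] then rot @^-1` ball (c p) (e m) else set0)
  else set0.
have e0 m : 0 < e m by rewrite invr_gt0.
rewrite (_ : _ @^-1` _ = \bigcup_k F k).
  apply: bigcup_measurable => k _; rewrite /F.
  case: (@unpickle ('rV[rat]_n * nat)%type k) => [[p m]|] //.
  by case: ifPn => // _; exact: measurable_row_ball.
apply/seteqP; split=> [t /= At|t [k _]]; last first.
  rewrite /F; case: (@unpickle ('rV[rat]_n * nat)%type k) => [[p m]|] //.
  by case: ifPn => // /asboolP H /= /H.
have : nbhs (rot t) A by exact: open_nbhs_nbhs.
move=> /nbhs_ballP[d /= d0 dA].
have [m md] : exists m, e m < d / 2.
  have := near_infty_natSinv_lt (PosNum (divr_gt0 d0 (ltr0Sn R 1))) => -[m _ H].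
  by exists m; exact: (H m (leqnn _)).
have pe i : exists q : rat, (ratr q : R) \in `](rot t 0 i - e m), (rot t 0 i + e m)[.
  by apply: rat_in_itvoo; rewrite ltrBlDr -addrA ltrDl addr_gt0.
have [f fP] := choice pe.
pose p : 'rV[rat]_n := \row_i f i.
have cp : ball (c p) (e m) (rot t).
  apply/ball_rowP => // j; rewrite /c mxE [p _ _]mxE.
  by have := fP j; rewrite in_itv/= -ltr_distl.
exists (pickle (p, m)) => //; rewrite /F pickleK.
rewrite ifT//; apply/asboolP => y cy; apply: dA.
apply: (@le_ball _ _ _ (e m + e m)); first by apply: ltW; rewrite (splitr d) ltrD.
by apply: ball_triangle cy; exact: ball_sym.
Qed.

(** Borel functions of a row, rows being identified with tuples. *)
Definition row_measurable (f : E -> R) := measurable_fun [set: T] (f \o rot).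

Lemma row_measurable_cst (c : R) : row_measurable (fun=> c).
Proof. exact: measurable_cst. Qed.

Lemma row_measurableD f g : row_measurable f -> row_measurable g ->
  row_measurable (fun x => f x + g x).
Proof. by move=> mf mg; apply: measurable_funD. Qed.

Lemma row_measurableM f g : row_measurable f -> row_measurable g ->
  row_measurable (fun x => f x * g x).
Proof. by move=> mf mg; apply: measurable_funM. Qed.

(** A function continuous on an open set, extended by 0, is Borel. *)
Lemma row_measurable_restrict (A : set E) (f : E -> R) : open A ->
  (forall x, A x -> {for x, continuous f}) -> row_measurable (f \_ A).
Proof.
move=> oA cf; rewrite /row_measurable.
rewrite (_ : _ \o _ = (f \o rot) \_ (rot @^-1` A)); last first.
  by [].
apply/(measurable_restrict _ _ _).1 => //; first exact: open_measurable_row.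
rewrite setTI => mA; apply: (measurability _ (RGenOpens.measurableE R)) => //.
move=> _ [_ [a [b ->]] <-]; rewrite (_ : _ `&` _ = rot @^-1` (A `&` f @^-1` `]a, b[%classic))//; apply: open_measurable_row.
rewrite openE => x [Ax fx]; apply: filterI; first exact: open_nbhs_nbhs.
by apply: (cf x Ax); apply: open_nbhs_nbhs; split => //; exact: interval_open.
Qed.

Lemma continuous_row_measurable (f : E -> R) : continuous f -> row_measurable f.
Proof.
move=> cf; rewrite (_ : f = f \_ setT); last by rewrite patch_setT.
by apply: row_measurable_restrict => [|x _]; [exact: openT|exact: cf].
Qed.

(** The map [y |-> c - y] on tuples. *)
Definition tuple_reflect (c : E) (t : T) : T := [tuple c 0 i - tnth t i | i < n].

Lemma row_of_tuple_reflect c t : rot (tuple_reflect c t) = c - rot t.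
Proof. by apply/rowP => j; rewrite !mxE tnth_mktuple. Qed.

Lemma measurable_tuple_reflect c : measurable_fun setT (tuple_reflect c).
Proof.
apply/measurable_fun_tnthP => i.
rewrite (_ : _ \o _ = (fun t => c 0 i - tnth t i)).
  by apply: measurable_funB => //; exact: measurable_tnth.
by apply/funext => t /=; rewrite tnth_mktuple.
Qed.

Lemma row_measurable_reflect c f : row_measurable f ->
  row_measurable (fun y => f (c - y)).
Proof.
move=> mf; rewrite /row_measurable.
rewrite (_ : _ \o _ = (f \o rot) \o tuple_reflect c).
  by apply: measurableT_comp => //; exact: measurable_tuple_reflect.
by apply/funext => t /=; rewrite row_of_tuple_reflect.
Qed.

Lemma measurable_row_reflect c (A : set E) : measurable (rot @^-1` A) ->
  measurable (rot @^-1` [set y | A (c - y)]).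
Proof.
move=> mA; rewrite (_ : _ @^-1` _ = tuple_reflect c @^-1` (rot @^-1` A)).
  by rewrite -[X in measurable X]setTI; apply: measurable_tuple_reflect.
by apply/seteqP; split => t /=; rewrite row_of_tuple_reflect.
Qed.

End row_measurability.

Section reflection_invariance.
Context {R : realType}.
Local Notation RT := (measurableTypeR R).
Local Open Scope ereal_scope.

Lemma lebesgue_measure_reflect (c : R) (A : set RT) : measurable A ->
  lebesgue_measure [set x : RT | A (c - x)%R] = lebesgue_measure A.
Proof.
move=> mA; have mc : measurable_fun [set: RT] ((fun x => c - x)%R : RT -> RT).
  by apply: measurable_funB.
apply/esym; apply: (@lebesgue_measure_unique _
  (pushforward lebesgue_measure ((fun x => c - x)%R : RT -> RT))) => //=.
move=> _ [[a b]] _ <-; rewrite /pushforward.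
rewrite (_ : _ @^-1` _ = `[(c - b)%R, (c - a)%R[%classic).
  rewrite !lebesgue_measure_itv/= !lte_fin ltrD2l ltrN2.
  by case: ifP => // _; rewrite -!EFinD; congr EFin; ring.
apply/seteqP; split => x /=; rewrite !in_itv/= => /andP[? ?]; apply/andP; split; lra.
Qed.

Context {n : nat}.
Local Notation T := (n.-tuple RT).
Local Notation mu := (@lebesgue_tuple R n).

(** The measurable boxes, a pi-system that generates the sigma-algebra. *)
Definition measurable_boxes : set (set T) := [set B | exists2 A : 'I_n -> set RT,
  (forall i, measurable (A i)) & B = [set t | forall i, A i (tnth t i)]].

Lemma measurable_boxesE : (measurable : set (set T)) = <<s measurable_boxes >>.
Proof.
apply/seteqP; split.
  apply: smallest_sub; first exact: smallest_sigma_algebra.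
  rewrite -bigcup_seq; apply: bigcup_sub => i _ B [A mA <-].
  apply: sub_sigma_algebra; exists (fun j => if j == i then A else setT).
    by move=> j; case: ifP.
  rewrite setTI; apply/seteqP; split => t /=.
    by move=> At j; case: eqP => [->|].
  by move=> /(_ i); rewrite eqxx.
apply: smallest_sub; first exact: sigma_algebra_measurable.
by move=> _ [A mA ->]; exact: measurable_box.
Qed.

(** Reflections preserve the Lebesgue measure: the image measure agrees with it
    on boxes, which is enough by uniqueness of measures. *)
Lemma lebesgue_tuple_reflect c (A : set T) : measurable A ->
  mu (tuple_reflect c @^-1` A) = mu A.
Proof.
pose g (k : nat) : set T := [set t | forall i : 'I_n, `](- k%:R)%R, (k%:R : R)%R]%classic (tnth t i)].
move=> mA; have mc := measurable_tuple_reflect c.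
have [nu nuE] : exists nu : {measure set T -> \bar R},
    forall B, nu B = mu (tuple_reflect c @^-1` B).
  unshelve eexists (pushforward mu (tuple_reflect c)); first exact: mc.
  by [].
rewrite -nuE; apply/esym; apply: (measure_unique measurable_boxes g) => //.
- exact: measurable_boxesE.
- move=> _ _ [A1 mA1 ->] [A2 mA2 ->]; exists (fun i => A1 i `&` A2 i).
    by move=> i; exact: measurableI.
  by apply/seteqP; split => t /= => [[H1 H2] i|H]; [split|split => i; have [] := H i].
- by move=> k; exists (fun=> `](- k%:R)%R, (k%:R : R)%R]%classic).
- rewrite -subTset => t _; exists (\max_i (Num.truncn `|tnth t i|%R).+1)%N => //= i.
  have : (`|tnth t i| < (\max_i (Num.truncn `|tnth t i|%R).+1)%:R)%R.
    apply: (lt_le_trans (truncnS_gt _)).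
    by rewrite ler_nat; exact: (leq_bigmax i).
  by rewrite ltr_norml => /andP[? /ltW ?]; rewrite /= in_itv/=; apply/andP.
- move=> _ [B mB ->] /=; rewrite nuE.
  rewrite (_ : _ @^-1` _ = [set t | forall i, [set x : RT | B i (c ord0 i - x)%R] (tnth t i)]).
    have mB' i : measurable [set x : RT | B i (c ord0 i - x)%R].
      have mci : measurable_fun [set: RT] ((fun x => c ord0 i - x)%R : RT -> RT).
        by apply: measurable_funB.
      by rewrite -[X in measurable X]setTI; apply: mci.
    rewrite (lebesgue_tuple_box mB) (lebesgue_tuple_box mB').
    by apply: eq_bigr => i _; rewrite lebesgue_measure_reflect.
  by apply/seteqP; split => t /= H i; have := H i; rewrite tnth_mktuple.
- move=> k; rewrite [X in X < _](_ : _ =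
      \prod_(i < n) lebesgue_measure `](- k%:R)%R, (k%:R : R)%R]%classic); last first.
    exact: (@lebesgue_tuple_box _ n (fun=> `](- k%:R)%R, (k%:R : R)%R]%classic)).
  have H : lebesgue_measure `](- k%:R)%R, (k%:R : R)%R]%classic < +oo.
    by rewrite lebesgue_measure_itv/=; case: ifP => // _; rewrite -EFinD ltry.
  rewrite -ge0_fin_numE; last by apply: prode_ge0.
  by apply: prode_fin_num => i _; rewrite ge0_fin_numE.
Qed.

End reflection_invariance.

(** * Integrals of periodic functions *)

Section periodic_integral.
Context {R : realType} {n : nat} (q : 'I_n -> R).
Local Notation RT := (measurableTypeR R).
Local Notation T := (n.-tuple RT).
Local Notation E := 'rV[R]_n.
Local Notation rot := (@row_of_tuple R n).
Local Notation mu := (@lebesgue_tuple R n).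
Local Open Scope ereal_scope.

(** Borel sets of rows. *)
Definition row_measurable_set (A : set E) := measurable (rot @^-1` A).

Lemma row_measurable_setI A B : row_measurable_set A -> row_measurable_set B ->
  row_measurable_set (A `&` B).
Proof. exact: measurableI. Qed.

Lemma ge0_integral_row_reflect c (A : set E) (f : E -> \bar R) :
  row_measurable_set A -> measurable_fun setT (f \o rot) ->
  (forall x, 0 <= f x) ->
  \int[mu]_(t in rot @^-1` [set y | A (c - y)%R]) f (c - rot t)%R =
  \int[mu]_(t in rot @^-1` A) f (rot t).
Proof.
move=> mA mf f0.
transitivity (\int[pushforward mu (tuple_reflect c)]_(t in rot @^-1` A) f (rot t)).
  rewrite ge0_integral_pushforward//.
  - rewrite (_ : tuple_reflect c @^-1` _ = rot @^-1` [set y | A (c - y)%R]).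
      by apply: eq_integral => t _ /=; rewrite row_of_tuple_reflect.
    by apply/seteqP; split=> t /=; rewrite row_of_tuple_reflect.
  - exact: measurable_tuple_reflect.
  - exact: measurable_funS mf.
have mc := @measurable_tuple_reflect R n c.
have [nu nuE] : exists nu : {measure set T -> \bar R},
    nu = pushforward mu (tuple_reflect c) :> (set T -> \bar R).
  by unshelve eexists (pushforward mu (tuple_reflect c)); first exact: mc.
rewrite -nuE; apply: eq_measure_integral => B mB _.
by rewrite nuE; exact: lebesgue_tuple_reflect.
Qed.

(** A translation is the composition of two reflections. *)
Lemma ge0_integral_row_translate c (A : set E) (f : E -> \bar R) :
  row_measurable_set A -> measurable_fun setT (f \o rot) ->
  (forall x, 0 <= f x) ->
  \int[mu]_(t in rot @^-1` [set y | A (c + y)%R]) f (c + rot t)%R =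
  \int[mu]_(t in rot @^-1` A) f (rot t).
Proof.
move=> mA mf f0; rewrite -(ge0_integral_row_reflect c mA)//.
rewrite -(@ge0_integral_row_reflect 0%R [set y | A (c - y)%R] (fun y => f (c - y)%R)).
- rewrite (_ : [set y | A (c + y)%R] = [set y | [set z | A (c - z)%R] (0 - y)%R]).
    by apply: eq_integral => t _; rewrite sub0r opprK.
  by apply/seteqP; split => y /=; rewrite sub0r opprK.
- exact: measurable_row_reflect.
- rewrite (_ : _ \o _ = (f \o rot) \o tuple_reflect c).
    by apply: measurableT_comp => //; exact: measurable_tuple_reflect.
  by apply/funext => t /=; rewrite row_of_tuple_reflect.
- by move=> x; exact: f0.
Qed.

Lemma qtransD (z w : 'rV[int]_n) : (qtrans q (z + w) = qtrans q z + qtrans q w)%R.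
Proof. by apply/rowP => j; rewrite !mxE intrD mulrDr. Qed.

Lemma qtransN (z : 'rV[int]_n) : (qtrans q (- z) = - qtrans q z)%R.
Proof. by apply/rowP => j; rewrite !mxE intrN mulrN. Qed.

Lemma qtrans0 : (qtrans q 0 = 0)%R.
Proof. by apply/rowP => j; rewrite !mxE mulr0. Qed.

(** Invariance under the lattice at all points, as opposed to [qperiodic], which
    concerns the points of a set. *)
Definition lattice_periodic {V : Type} (f : E -> V) :=
  forall x z, f (x + qtrans q z)%R = f x.

Lemma periodicN {V : Type} (f : E -> V) x z : lattice_periodic f ->
  f (x - qtrans q z)%R = f x.
Proof. by move=> pf; rewrite -qtransN. Qed.

(** A Borel set that meets each orbit of the lattice in exactly one point. *)
Definition fundamental_domain (D : set E) :=
  [/\ row_measurable_set D, (forall x, exists z, D (x + qtrans q z)%R) &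
      forall x z w, D (x + qtrans q z)%R -> D (x + qtrans q w)%R -> z = w].

(** The integral of a periodic function does not depend on the fundamental
    domain. *)
Lemma ge0_integral_fundamental_domain (D1 D2 : set E) (f : E -> \bar R) :
  fundamental_domain D1 -> fundamental_domain D2 ->
  measurable_fun setT (f \o rot) -> (forall x, 0 <= f x) -> lattice_periodic f ->
  \int[mu]_(t in rot @^-1` D1) f (rot t) = \int[mu]_(t in rot @^-1` D2) f (rot t).
Proof.
move=> [mD1 eD1 uD1] [mD2 eD2 uD2] mf f0 pf.
(* Both sides are sums of the integrals of f over the pieces
   D2 `&` (D1 + q z), respectively over their translates by - q z. *)
pose S (A : 'rV[int]_n -> set E) (k : nat) : set T :=
  if @pickle_inv 'rV[int]_n k is Some z then rot @^-1` A z else set0.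
have mS A : (forall z, row_measurable_set (A z)) -> forall k, measurable (S A k).
  by move=> mA k; rewrite /S; case: pickle_inv.
have bS A B : (forall x, B x <-> exists z, A z x) -> rot @^-1` B = \bigcup_k S A k.
  move=> AB; apply/seteqP; split => [t /= /AB[z Azt]|t [k _]].
    by exists (pickle z) => //; rewrite /S pickleK_inv.
  by rewrite /S; case: pickle_inv => // z Azt /=; apply/AB; exists z.
have tS A : (forall x z w, A z x -> A w x -> z = w) -> trivIset setT (S A).
  move=> uA; apply/trivIsetP => i j _ _ ij; apply/seteqP; split => // t [].
  rewrite /S.
  have := @pickle_invK 'rV[int]_n i; case: pickle_inv => //= z zi Azt.
  have := @pickle_invK 'rV[int]_n j; case: pickle_inv => //= w wj Awt.
  by move: ij; rewrite -zi -wj (uA _ _ _ Azt Awt) eqxx.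
pose A1 z := D1 `&` [set x | D2 (qtrans q z + x)%R].
pose A2 z := D2 `&` [set x | D1 (- qtrans q z + x)%R].
have mtr D c : row_measurable_set D -> row_measurable_set [set x | D (c + x)%R].
  move=> mD; have := measurable_row_reflect 0%R (measurable_row_reflect c mD).
  rewrite /row_measurable_set; congr (measurable (_ @^-1` _)).
  by apply/seteqP; split => y /=; rewrite sub0r opprK.
have mA1 z : row_measurable_set (A1 z) by apply: row_measurable_setI => //; exact: mtr.
have mA2 z : row_measurable_set (A2 z) by apply: row_measurable_setI => //; exact: mtr.
rewrite (bS A1 D1); last first.
  move=> x; split => [D1x|[z []]//].
  by have [z D2z] := eD2 x; exists z; split => //=; rewrite addrC.
rewrite (bS A2 D2); last first.
  move=> x; split => [D2x|[z []]//].
  by have [z D1z] := eD1 x; exists (- z)%R; split => //=; rewrite qtransN opprK addrC.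
rewrite !ge0_integral_bigcup//.
- apply: eq_eseriesr => k _; rewrite /S; case: pickle_inv => [z|]; last by rewrite !integral_set0.
  rewrite -(ge0_integral_row_translate (qtrans q z) (mA2 z) mf f0).
  rewrite (_ : [set y | _] = A1 z).
    by apply: eq_integral => t _; rewrite addrC pf.
  by apply/seteqP; split => y /=; rewrite /A1 /A2/= addKr => -[].
- by apply: mS.
- exact: measurable_funS mf.
- apply: tS => x z w [D2x D1z] [_ D1w].
  have := uD1 x (- z)%R (- w)%R; rewrite !qtransN ![(x - _)%R]addrC => /(_ D1z D1w).
  exact: oppr_inj.
- by apply: mS.
- exact: measurable_funS mf.
- apply: tS => x z w [D1x D2z] [_ D2w].
  by have := uD2 x z w; rewrite ![(x + _)%R]addrC => /(_ D2z D2w).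
Qed.

End periodic_integral.

(** * Period cells and null sets *)

Section cells.
Context {R : realType} {n : nat} (q : 'I_n -> R).
Hypothesis q0 : forall j, 0 < q j.
Local Notation RT := (measurableTypeR R).
Local Notation T := (n.-tuple RT).
Local Notation E := 'rV[R]_n.
Local Notation rot := (@row_of_tuple R n).
Local Notation mu := (@lebesgue_tuple R n).

(** The half-open period cell with corner a. *)
Definition cell (a : E) : set E := [set x | forall j, a 0 j <= x 0 j < a 0 j + q j].

Lemma row_measurable_box (A : 'I_n -> set RT) : (forall i, measurable (A i)) ->
  row_measurable_set [set x : E | forall i, A i (x 0 i)].
Proof.
move=> mA; rewrite /row_measurable_set.
rewrite (_ : _ @^-1` _ = [set t : T | forall i, A i (tnth t i)]).
  exact: measurable_box.
by apply/seteqP; split=> t /= H i; have := H i; rewrite row_of_tupleE.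
Qed.

Lemma lebesgue_row_box (A : 'I_n -> set RT) : (forall i, measurable (A i)) ->
  mu (rot @^-1` [set x : E | forall i, A i (x 0 i)]) =
  (\prod_(i < n) lebesgue_measure (A i))%E.
Proof.
move=> mA; rewrite -(lebesgue_tuple_box mA); congr (lebesgue_tuple _ _).
by apply/seteqP; split=> t /= H i; have := H i; rewrite row_of_tupleE.
Qed.

Lemma cellE a : cell a = [set x | forall j, `[a 0 j, a 0 j + q j[%classic (x 0 j)].
Proof. by apply/seteqP; split=> x /= H j; have := H j; rewrite /= in_itv. Qed.

Lemma row_measurable_cell a : row_measurable_set (cell a).
Proof. by rewrite cellE; apply: (row_measurable_box (A := fun j => `[a 0 j, a 0 j + q j[%classic)). Qed.

Lemma cell_reduce a x : exists z, cell a (x + qtrans q z).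
Proof.
exists (\row_j - Num.floor ((x 0 j - a 0 j) / q j)) => j.
rewrite !mxE intrN mulrN.
have := floor_le_tmp ((x 0 j - a 0 j) / q j); have := floorD1_gt ((x 0 j - a 0 j) / q j).
rewrite intrD ltr_pdivrMr// ler_pdivlMr// => h1 h2.
by apply/andP; split; nra.
Qed.

Lemma cell_unique a x z w : cell a (x + qtrans q z) -> cell a (x + qtrans q w) -> z = w.
Proof.
move=> H1 H2; apply/rowP => j; have := H1 j; have := H2 j; rewrite !mxE.
move=> /andP[h1 h2] /andP[h3 h4]; have qj := q0 j.
have d : `|(z 0 j)%:~R - (w 0 j)%:~R : R| < 1.
  rewrite -(ltr_pM2l qj) mulr1 -{1}(gtr0_norm qj) -normrM mulrBr ltr_norml.
  by apply/andP; split; lra.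
move: d; rewrite -intrB -intr_norm -[1]/(1%:~R) ltr_int -[1]add0r ltzD1.
by rewrite normr_le0 subr_eq0 => /eqP.
Qed.

Lemma fundamental_domain_cell a : fundamental_domain q (cell a).
Proof.
split; [exact: row_measurable_cell|exact: cell_reduce|].
by move=> x z w; exact: cell_unique.
Qed.

Lemma fundamental_domain_reflect x (D : set E) : fundamental_domain q D ->
  fundamental_domain q [set y | D (x - y)].
Proof.
move=> [mD eD uD]; split => [|y|y z w /=].
- exact: measurable_row_reflect.
- have [z Dz] := eD (x - y); exists (- z) => /=.
  by rewrite qtransN opprB addrA addrAC.
- rewrite !opprD !addrA -!qtransN => /uD/[apply]; exact: oppr_inj.
Qed.

Local Open Scope ereal_scope.

Lemma ge0_periodic_integral_reflect a b x (f : E -> \bar R) :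
  measurable_fun setT (f \o rot) -> (forall x, 0 <= f x) -> lattice_periodic q f ->
  \int[mu]_(t in rot @^-1` cell a) f (x - rot t)%R =
  \int[mu]_(t in rot @^-1` cell b) f (rot t).
Proof.
move=> mf f0 pf; have fda := fundamental_domain_cell a.
rewrite (ge0_integral_fundamental_domain _ (fundamental_domain_reflect x fda))//;
  last exact: fundamental_domain_cell.
rewrite -(ge0_integral_row_reflect x _ mf f0); last first.
  by have [] := fundamental_domain_reflect x fda.
rewrite (_ : [set y | _] = cell a)//.
by apply/seteqP; split => y /=; rewrite subKr.
Qed.

(** The change of variables y -> x - y in the integral of a periodic function
    over a cell: the reflected cell is again a fundamental domain. *)
Lemma periodic_integral_reflect a b x (f : E -> R) :
  row_measurable f -> lattice_periodic q f ->
  (\int[mu]_(t in rot @^-1` cell a) f (x - rot t) =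
   \int[mu]_(t in rot @^-1` cell b) f (rot t))%R.
Proof.
move=> mf pf; rewrite /Rintegral; congr fine.
rewrite [LHS]integralE [RHS]integralE; congr (_ - _).
  pose fp := fun x => maxe (f x)%:E 0.
  transitivity (\int[mu]_(t in rot @^-1` cell a) fp (x - rot t)%R).
    by apply: eq_integral => t _; rewrite funeposE.
  rewrite (@ge0_periodic_integral_reflect a b) ?/fp//; first by apply: eq_integral => t _; rewrite funeposE.
  - by apply: measurable_maxe => //; apply/measurable_EFinP; exact: mf.
  - by move=> ?; rewrite le_max lexx orbT.
  - by move=> y z /=; rewrite pf.
pose fp := fun x => maxe (- (f x)%:E) 0.
transitivity (\int[mu]_(t in rot @^-1` cell a) fp (x - rot t)%R).
  by apply: eq_integral => t _; rewrite funenegE.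
rewrite (@ge0_periodic_integral_reflect a b) ?/fp//; first by apply: eq_integral => t _; rewrite funenegE.
- apply: measurable_maxe => //; apply: measurableT_comp => //.
  by apply/measurable_EFinP; exact: mf.
- by move=> ?; rewrite le_max lexx orbT.
- by move=> y z /=; rewrite pf.
Qed.

Lemma cell_measure_lty a : mu (rot @^-1` cell a) < +oo.
Proof.
rewrite cellE (lebesgue_row_box (A := fun j => `[a 0 j, a 0 j + q j[%classic)%R)//.
rewrite -ge0_fin_numE; last exact: prode_ge0.
apply: prode_fin_num => i _; rewrite ge0_fin_numE// lebesgue_measure_itv/=.
by case: ifP => // _; rewrite -EFinD ltry.
Qed.

(** Coordinate hyperplanes are null sets. *)
Lemma hyperplane_measure0 (j : 'I_n) (c : R) :
  row_measurable_set [set x : E | x 0 j = c]%R /\ mu (rot @^-1` [set x : E | x 0 j = c]%R) = 0.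
Proof.
pose A i : set RT := if i == j then [set c] else setT.
have mA i : measurable (A i) by rewrite /A; case: ifP.
rewrite (_ : [set x : E | x 0 j = c] = [set x : E | forall i, A i (x 0 i)])%R; last first.
  rewrite /A; apply/seteqP; split => x /=.
    by move=> xj i; case: eqP => [->|].
  by move=> /(_ j); rewrite eqxx.
split; first exact: row_measurable_box.
rewrite lebesgue_row_box// (bigD1 j)//= {1}/A eqxx lebesgue_measure_set1.
by rewrite mul0e.
Qed.

(** Countable unions of coordinate hyperplanes are null sets; suitable ones
    contain the boundaries of the cells and the lattice. *)
Lemma countable_hyperplanes_measure0 (c : 'I_n -> nat -> R) :
  let N := [set x : E | exists j k, x 0 j = c j k]%R in
  row_measurable_set N /\ mu (rot @^-1` N) = 0.
Proof.
move=> N.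
pose F m := if @unpickle ('I_n * nat)%type m is Some jk
  then rot @^-1` [set x : E | x 0 jk.1 = c jk.1 jk.2]%R else set0.
have mF m : measurable (F m) /\ mu (F m) = 0.
  rewrite /F; case: unpickle => [[j k]|]; last by rewrite measure0.
  exact: hyperplane_measure0.
have NE : rot @^-1` N = \bigcup_m F m.
  apply/seteqP; split => [t [j [k jk]]|t [m _]]; rewrite /F.
    by exists (pickle (j, k)) => //; rewrite pickleK.
  by case: unpickle => // -[j k] /= jk; exists j, k.
have mN : measurable (rot @^-1` N).
  by rewrite NE; apply: bigcup_measurable => m _; exact: (mF m).1.
split => //; apply/negligibleP => //; rewrite NE; apply: negligible_bigcup => m.
by apply/negligibleP; have [] := mF m.
Qed.

End cells.

(** * Integrability of singular kernels *)

Section kernel_integrability.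
Context {R : realType} {n : nat} (q : 'I_n -> R).
Hypothesis q0 : forall j, 0 < q j.
Local Notation RT := (measurableTypeR R).
Local Notation T := (n.-tuple RT).
Local Notation E := 'rV[R]_n.
Local Notation rot := (@row_of_tuple R n).
Local Notation mu := (@lebesgue_tuple R n).

(** The lattice being countable, all its subsets are Borel. *)
Lemma row_measurable_sub_lattice (A : set E) : A `<=` qlattice q ->
  row_measurable_set A.
Proof.
move=> Aq; rewrite /row_measurable_set.
pose F k := if @unpickle 'rV[int]_n k is Some z
  then rot @^-1` (A `&` [set x | x = qtrans q z]) else set0.
rewrite (_ : _ @^-1` _ = \bigcup_k F k).
  apply: bigcup_measurable => k _; rewrite /F; case: unpickle => // z.
  have [Az|nAz] := pselect (A (qtrans q z)); last first.
    rewrite (_ : A `&` [set x | x = qtrans q z] = set0); first by rewrite preimage_set0.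
    by rewrite -subset0 => x [Ax /= xz]; rewrite xz in Ax.
  rewrite (_ : A `&` [set x | x = qtrans q z] = [set x | forall j, [set qtrans q z 0 j] (x 0 j)]).
    exact: (row_measurable_box (A := fun j => [set qtrans q z 0 j])).
  apply/seteqP; split => [x [_ /= ->]//|x /= H].
  suff -> : x = qtrans q z by [].
  by apply/rowP => j; exact: H.
apply/seteqP; split => [t /= At|t [k _]].
  have [z _ zt] := Aq _ At.
  by exists (pickle z) => //; rewrite /F pickleK.
by rewrite /F; case: unpickle => // z [].
Qed.

(** A function that vanishes off the lattice is Borel, whatever its values on the
    lattice are. *)
Lemma row_measurable_lattice (f : E -> R) : (forall x, ~ qlattice q x -> f x = 0) ->
  row_measurable f.
Proof.
move=> f0 mT Y mY; rewrite setTI.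
have [Y0|nY0] := pselect (Y 0); last first.
  apply: (@row_measurable_sub_lattice [set x | Y (f x)]) => x Yx.
  by apply: contrapT => /f0 fx; rewrite /= fx in Yx.
rewrite -[X in measurable X]setCK; apply: measurableC.
apply: (@row_measurable_sub_lattice [set x | ~ Y (f x)]) => x Yx.
by apply: contrapT => /f0 fx; apply: Yx; rewrite fx.
Qed.

Lemma nneseries_geometric_le (c th : R) : 0 <= c -> 0 <= th < 1 ->
  (\sum_(0 <= k <oo) (c * th ^+ k)%:E <= (c / (1 - th))%:E)%E.
Proof.
move=> c0 /andP[th0 th1]; apply: lime_le.
  by apply: is_cvg_nneseries => k _ _; rewrite lee_fin mulr_ge0// exprn_ge0.
apply: nearW => N; rewrite sumEFin lee_fin.
have -> : \sum_(0 <= k < N) c * th ^+ k = c * (1 - th ^+ N) / (1 - th).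
  have := geometric_seriesE c (negbT (lt_eqF th1)).
  by move/(congr1 (fun u => u N)).
apply: ler_wpM2r; first by rewrite invr_ge0 subr_ge0 ltW.
by apply: ler_piMr => //; rewrite gerBl exprn_ge0.
Qed.

Local Open Scope ereal_scope.

(** A kernel with a singularity of order [lam < n] at the lattice points is
    integrable on a cell.  The integral is estimated on the dyadic shells
    [r / 2 ^ k.+1 <= |x| < r / 2 ^ k] of the sup norm, whose measure is at most
    [(2 * r / 2 ^ k) ^ n]. *)
Lemma singular_kernel_integral (lam : R) : (0 <= lam < n%:R)%R ->
  exists2 C : R, (0 <= C)%R & forall (f : E -> R) (a : R),
  row_measurable f -> (0 <= a)%R ->
  (forall x, Qtilde q x -> x != 0 -> `|f x| * enorm x `^ lam <= a)%R ->
  \int[mu]_(t in rot @^-1` cell q (\row_j (- (q j / 2))%R)) `|f (rot t)|%:E <= (C * a)%:E.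
Proof.
move=> /andP[lam0 lamn].
(* Any radius larger than half of each period would do. *)
pose r : R := (1 + \sum_j q j)%R.
have r0 : (0 < r)%R by rewrite ltr_pwDl// sumr_ge0// => j _; exact/ltW/q0.
pose e k : R := (r / 2 ^+ k)%R.
have e0 k : (0 < e k)%R by rewrite divr_gt0// exprn_gt0.
pose B k : set E := ball 0%R (e k).
have Be k x : B k x <-> (`|x| < e k)%R by rewrite /B -ball_normE /ball_/= sub0r normrN.
have ltB k l x : (k <= l)%N -> B l x -> B k x.
  move=> kl /Be xl; apply/Be; apply: lt_le_trans xl _.
  by rewrite /e ler_pM2l// lef_pV2 ?posrE ?exprn_gt0// ler_eXn2l// ltr1n.
pose c k : R := ((2 / r) `^ lam * (2 `^ lam) ^+ k)%R.
have c0 k : (0 <= c k)%R by rewrite mulr_ge0 ?powR_ge0// exprn_ge0 ?powR_ge0.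
have powX (b : R) k : (0 <= b -> (b `^ lam) ^+ k = (b ^+ k) `^ lam)%R.
  by move=> b0; rewrite -(powR_mulrn k (powR_ge0 b lam)) powRAC (powR_mulrn k b0).
have cE k : c k = ((e k.+1)^-1 `^ lam)%R.
  rewrite /c /e invfM invrK exprS.
  rewrite (_ : (r^-1 * (2 * 2 ^+ k) = (2 / r) * 2 ^+ k)%R); last by ring.
  rewrite [RHS]powRM ?divr_ge0 ?exprn_ge0 ?(ltW r0)//; congr (_ * _)%R.
  exact: powX.
pose th : R := (2 `^ lam / 2 ^+ n)%R.
have th01 : (0 <= th < 1)%R.
  rewrite divr_ge0 ?powR_ge0 ?exprn_ge0//= ltr_pdivrMr ?exprn_gt0// mul1r.
  rewrite -powR_mulrn// -(subrK lam n%:R) powRD; last by rewrite implybE orbC pnatr_eq0.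
  rewrite ltr_pMl ?powR_gt0//.
  have := @gt0_ltr_powR R (n%:R - lam)%R; rewrite subr_gt0 => /(_ lamn 1%R 2%R).
  by rewrite powR1; apply; rewrite ?nnegrE ?ltr1n.
pose K : R := ((2 / r) `^ lam * (2 * r) ^+ n)%R.
have K0 : (0 <= K)%R.
  by rewrite /K mulr_ge0 ?powR_ge0// exprn_ge0// mulr_ge0// ltW.
exists (K / (1 - th))%R.
  by case/andP: th01 => _ /ltW th1; apply: divr_ge0 => //; rewrite subr_ge0.
move=> f a mf a0 fa; set D := cell _ _.
pose S k := rot @^-1` B k `\` rot @^-1` B k.+1.
have mB k : measurable (rot @^-1` B k) by exact: measurable_row_ball.
have mS k : measurable (S k) by apply: measurableD.
have tS : trivIset setT S.
  apply/trivIsetP.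
  have H k l : (k < l)%N -> S k `&` S l = set0.
    by move=> kl; rewrite -subset0 => t [[_ nB] [Bl _]]; apply: nB; exact: ltB Bl.
  move=> k l _ _; rewrite neq_lt => /orP[|] kl; first exact: H.
  by rewrite setIC; exact: H.
(* N contains the faces of the cell and the origin: the bound on f is only
   available in the interior of the cell, away from the origin. *)
have [mN N0] := countable_hyperplanes_measure0
  (fun (j : 'I_n) k => if k == 0%N then - (q j / 2) else if k == 1%N then q j / 2 else 0)%R.
set N := (X in row_measurable_set X) in mN N0.
have mD : measurable (rot @^-1` D) by exact: row_measurable_cell.
have mabs : measurable_fun setT (fun t : T => `|f (rot t)|%:E).
  by apply/measurable_EFinP; apply: measurableT_comp => //; exact: mf.
rewrite (@ge0_negligible_integral _ _ _ _ _ (rot @^-1` N))//; last first.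
  exact: measurable_funS mabs.
pose g : T -> \bar R := (fun t => `|f (rot t)|%:E) \_ (rot @^-1` D `\` rot @^-1` N).
have mDN : measurable (rot @^-1` D `\` rot @^-1` N) by exact: measurableD.
have mg : measurable_fun setT g.
  by apply/(measurable_restrict _ mDN) => //; rewrite setTI; exact: measurable_funS mabs.
have g0 t : 0 <= g t by rewrite /g patchE; case: ifP.
have DNQ x : D x -> ~ N x -> Qtilde q x /\ x != 0%R.
  move=> Dx Nx; split.
    move=> j; have := Dx j; rewrite mxE => /andP[]; rewrite le_eqVlt => /orP[/eqP xj|-> xj].
      by exfalso; apply: Nx; exists j, 0%N.
    by apply: lt_le_trans xj _; rewrite [X in (_ <= X)%R]splitr; lra.
  apply/eqP => x0; apply: Nx.
  have j : 'I_n.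
    by apply: (@Ordinal n 0); rewrite -(ltr_nat R) (le_lt_trans lam0 lamn).
  by exists j, 2%N; rewrite /= x0 mxE.
have DNS : rot @^-1` D `\` rot @^-1` N `<=` \bigcup_k S k.
  move=> t [/= Dt Nt]; have [Qt t0] := DNQ _ Dt Nt.
  have t0' : (0 < `|rot t|)%R by rewrite normr_gt0.
  have exk : exists k, `[< ~ B k.+1 (rot t) >].
    have [k _ kt] := near_infty_natSinv_lt (PosNum (divr_gt0 t0' r0)).
    exists k; apply/asboolP => /Be; apply/negP; rewrite -leNgt /e.
    have := kt k (leqnn k); rewrite /= ltr_pdivlMr// => /ltW; apply: le_trans.
    rewrite [leRHS]mulrC ler_pM2l// lef_pV2 ?posrE ?exprn_gt0//.
    rewrite -natrX ler_nat; exact: ltnW (ltn_expl k.+1 (ltnSn 1)).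
  have := ex_minnP exk => -[m /asboolP Bm1 mmin].
  exists m => //; split => //=; apply/Be.
  case: m => [|m] in Bm1 mmin *.
    apply/row_norm_ltP; rewrite /e ?expr0 ?divr1// => j; have := Qt j.
    rewrite -ltr_norml => /lt_trans; apply; rewrite /r (bigD1 j)//=.
    have := q0 j; have : (0 <= \sum_(i < n | i != j) q i)%R.
      by apply: sumr_ge0 => i _; exact/ltW/q0.
    by move=> ? ?; lra.
  apply/Be; apply: contrapT => nBm.
  by have := mmin m (asboolT nBm); rewrite ltnn.
have mUS : measurable (\bigcup_k S k) by exact: bigcup_measurable.
have -> : \int[mu]_(t in rot @^-1` D `\` rot @^-1` N) `|f (rot t)|%:E =
    \int[mu]_(t in rot @^-1` D `\` rot @^-1` N) g t.
  by apply: eq_integral => t tD; rewrite /g patchE tD.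
apply: (@le_trans _ _ (\int[mu]_(t in \bigcup_k S k) g t)).
  by apply: ge0_subset_integral => //; exact: measurable_funS mg.
rewrite ge0_integral_bigcup//; last exact: measurable_funS mg.
apply: le_trans (_ : \sum_(0 <= k <oo) (a * K * th ^+ k)%:E <= _); last first.
  apply: le_trans (nneseries_geometric_le _ th01) _.
    exact: mulr_ge0.
  by rewrite lee_fin -mulrA mulrC.
apply: lee_nneseries => [k _ _|k _]; first exact: integral_ge0.
apply: (@le_trans _ _ (\int[mu]_(t in S k) (cst (a * c k)%:E) t)).
  apply: ge0_le_integral => //.
  - exact: measurable_funS mg.
  - move=> t [Bt nBt]; rewrite /g patchE; case: ifPn => [|_]; last first.
      by rewrite /cst lee_fin mulr_ge0.
    rewrite inE => -[Dt Nt]; rewrite /cst lee_fin.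
    have [Qx x0] := DNQ _ Dt Nt; apply: le_trans (ler_wpM2r (c0 k) (fa _ Qx x0)).
    rewrite -mulrA ler_peMr// cE -powRM ?sqrtr_ge0 ?invr_ge0 ?(ltW (e0 _))//.
    apply: (@le_trans _ _ (1 `^ lam)%R); first by rewrite powR1.
    apply: ge0_ler_powR => //; rewrite ?nnegrE ?mulr_ge0 ?sqrtr_ge0 ?invr_ge0 ?(ltW (e0 _))//.
    rewrite -ler_pdivrMr ?invr_gt0// mul1r invrK.
    apply: le_trans (enorm_ge_norm _); rewrite leNgt; apply/negP => /Be.
    exact: nBt.
rewrite integral_cst//.
apply: (@le_trans _ _ ((a * c k)%:E * mu (rot @^-1` B k))).
  apply: lee_wpmul2l; first by rewrite lee_fin mulr_ge0.
  by apply: le_measure; rewrite ?inE//; exact: subDsetl.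
rewrite (_ : B k = [set x | forall j, `](- e k)%R, (e k)[%classic (x 0%R j)]); last first.
  apply/seteqP; split => x /=.
    by move=> /Be/row_norm_ltP H j; have := H (e0 k) j; rewrite in_itv/= ltr_norml.
  by move=> H; apply/Be/row_norm_ltP => // j; have := H j; rewrite in_itv/= ltr_norml.
rewrite (lebesgue_row_box (A := fun=> `](- e k)%R, (e k)[%classic))//.
rewrite (eq_bigr (fun=> (2 * e k)%:E)); last first.
  move=> i _; rewrite lebesgue_measure_itv/= lte_fin gtrN// -EFinD; congr EFin; ring.
rewrite prodEFin -EFinM lee_fin prodr_const card_ord.
rewrite /c /K /th /e (mulrA 2%R r) !expr_div_n -!exprM (mulnC n k).
set iQ := ((2 ^+ (k * n))^-1)%R; rewrite le_eqVlt; apply/orP; left; apply/eqP.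
ring.
Qed.

End kernel_integrability.

(** * Iterated partial derivatives *)

Section partial_derivatives.
Context {R : realType} {n : nat}.
Local Notation E := 'rV[R]_n.
Implicit Types (f g : E -> R) (A : set E).

(** The j-th partial derivative, and its iterates along a list of indices, the
    head of the list being the outermost derivative. *)
Definition rpartial (j : 'I_n) f : E -> R := fun x => 'D_(delta_mx 0 j) f x.
Definition rpartials (s : seq 'I_n) f : E -> R := foldr rpartial f s.

(** All iterated partial derivatives exist at the points of A.  Continuity is not
    required; on an open set it follows when the derivatives are bounded, see
    [bounded_partials_continuous]. *)
Definition smooth_on A f :=
  forall s j x, A x -> derivable (rpartials s f) x (delta_mx 0 j).

(** A directional derivative is the derivative of the restriction to a line. *)
Lemma derive_line f (x v : E) (t : R) :
  (derivable (fun s : R => f (x + s *: v)) t 1 <-> derivable f (x + t *: v) v) /\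
  'D_1 (fun s : R => f (x + s *: v)) t = 'D_v f (x + t *: v).
Proof.
have fE : (fun h => h^-1 *: (((fun s : R => f (x + s *: v)) \o shift t) (h *: 1) - f (x + t *: v)))
    = (fun h => h^-1 *: ((f \o shift (x + t *: v)) (h *: v) - f (x + t *: v))).
  apply/funext => h /=; congr (_ *: (f _ - _)).
  by rewrite scaler1 scalerDl addrCA.
by rewrite /derivable /derive fE.
Qed.

Lemma derive_along_line f (x v : E) (F : R -> R) :
  (forall s, f (x + s *: v) = F s) -> derivable F 0 1 ->
  derivable f x v /\ 'D_v f x = derive1 F 0.
Proof.
move=> fF dF; have [l1 l2] := derive_line f x v 0.
rewrite scale0r addr0 in l1 l2.
have e : (fun s : R => f (x + s *: v)) = F by apply/funext.
by rewrite e in l1 l2; split; [exact/l1|rewrite -l2 derive1E].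
Qed.

Lemma derive_translate f (c x v : E) :
  (derivable (fun y => f (y + c)) x v <-> derivable f (x + c) v) /\
  'D_v (fun y => f (y + c)) x = 'D_v f (x + c).
Proof.
have fE : (fun h => h^-1 *: (((fun y => f (y + c)) \o shift x) (h *: v) - f (x + c)))
    = (fun h => h^-1 *: ((f \o shift (x + c)) (h *: v) - f (x + c))) :> (R -> R).
  by apply/funext => h /=; rewrite addrA.
by rewrite /derivable /derive fE.
Qed.

Lemma rpartials_translate s f c x :
  rpartials s (fun y => f (y + c)) x = rpartials s f (x + c).
Proof.
elim: s x => //= j s IH x.
rewrite /rpartial -(derive_translate (rpartials s f) c x _).2.
by congr ('D_(delta_mx 0 j) _ x); apply/funext.
Qed.

Lemma smooth_on_translate A f c : smooth_on A f ->
  smooth_on [set x | A (x + c)] (fun y => f (y + c)).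
Proof.
move=> sf s j x Ax; rewrite (_ : rpartials s _ = fun y => rpartials s f (y + c)).
  by apply/(derive_translate _ _ _ _).1; exact: sf.
by apply/funext => y; exact: rpartials_translate.
Qed.

Lemma open_near_eq A f g x : open A -> A x -> (forall y, A y -> f y = g y) ->
  \forall y \near x, f y = g y.
Proof.
by move=> oA Ax fg; apply: filterS (open_nbhs_nbhs (conj oA Ax)) => y; exact: fg.
Qed.

Lemma rpartials_eq_on A f g s x : open A -> (forall y, A y -> f y = g y) ->
  A x -> rpartials s f x = rpartials s g x.
Proof.
move=> oA fg; elim: s x => [|j s IH] x Ax /=; first exact: fg.
by apply: near_eq_derive; apply: open_near_eq IH.
Qed.

Lemma smooth_on_eq A f g : open A -> (forall y, A y -> f y = g y) ->
  smooth_on A f -> smooth_on A g.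
Proof.
move=> oA fg sf s j x Ax; apply: near_eq_derivable (sf s j x Ax).
by apply: (open_near_eq oA Ax) => y Ay; exact: rpartials_eq_on Ay.
Qed.

Lemma rpartials_lin A f g (a b : R) s x : open A -> smooth_on A f -> smooth_on A g ->
  A x -> rpartials s (fun y => a * f y + b * g y) x =
         a * rpartials s f x + b * rpartials s g x.
Proof.
move=> oA sf sg; elim: s x => [|j s IH] x Ax //=.
rewrite /rpartial.
rewrite (near_eq_derive (g := a *: rpartials s f + b *: rpartials s g)); last first.
  by apply: (open_near_eq oA Ax) => y Ay; rewrite IH.
rewrite deriveD; [|apply: derivableZ; exact: sf|apply: derivableZ; exact: sg].
by rewrite !deriveZ//; [exact: sg|exact: sf].
Qed.

Lemma smooth_on_lin A f g (a b : R) : open A -> smooth_on A f -> smooth_on A g ->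
  smooth_on A (fun y => a * f y + b * g y).
Proof.
move=> oA sf sg s j x Ax.
apply: (near_eq_derivable (f := a *: rpartials s f + b *: rpartials s g)).
  by apply: (open_near_eq oA Ax) => y Ay; rewrite (rpartials_lin _ _ _ oA).
apply: derivableD; apply: derivableZ; [exact: sf|exact: sg].
Qed.

Lemma line_in_ball (x y : E) (e : R) j (t : R) : 0 < e ->
  (forall i, `|y 0 i - x 0 i| < e) -> `|y 0 j + t - x 0 j| < e ->
  ball x e (y + t *: delta_mx 0 j).
Proof.
move=> e0 yx yt; apply/ball_rowP => // i; rewrite distrC !mxE eqxx/=.
have [->|ij] := eqVneq i j; first by rewrite mulr1.
by rewrite mulr0 addr0.
Qed.

(** The mean value inequality in a coordinate direction. *)
Lemma coord_lipschitz A f (B : R) j (y : E) (t : R) :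
  (forall s : R, `|s| <= `|t| -> A (y + s *: delta_mx 0 j)) ->
  (forall x, A x -> derivable f x (delta_mx 0 j)) ->
  (forall x, A x -> `|rpartial j f x| <= B) ->
  `|f (y + t *: delta_mx 0 j) - f y| <= B * `|t|.
Proof.
move=> At df fB; set v := delta_mx 0 j.
pose phi (s : R) := f (y + s *: v).
have dphi (s : R) : `|s| <= `|t| -> is_derive s 1 phi (rpartial j f (y + s *: v)).
  move=> st; have [d1 d2] := derive_line f y v s.
  by apply: DeriveDef; [apply/d1/df/At|exact: d2].
have main a b : a <= b -> `|a| <= `|t| -> `|b| <= `|t| ->
    `|phi b - phi a| <= B * `|b - a|.
  move=> ab at_ bt.
  have st s : s \in `[a, b] -> `|s| <= `|t|.
    rewrite in_itv/= => /andP[as_ sb]; rewrite ler_norml.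
    move: at_ bt; rewrite !ler_norml => /andP[? ?] /andP[? ?]; apply/andP; split; lra.
  have [||c cab ->] := @MVT_segment _ phi (fun s : R => rpartial j f (y + s *: v)) a b ab.
  - by move=> s sab; apply: dphi; apply: st; exact: subset_itv_oo_cc.
  - apply: derivable_within_continuous => s sab.
    by have [] := dphi s (st s sab).
  by rewrite normrM ler_wpM2r// fB//; apply: At; exact: st.
have -> : f y = phi 0 by rewrite /phi scale0r addr0.
have [t0|t0] := leP 0 t.
  by rewrite -[X in _ * `|X|]subr0; apply: main; rewrite ?normr0.
by rewrite distrC -[X in _ * X]normrN -[X in _ * `|X|]sub0r; apply: main;
  rewrite ?normr0// ltW.
Qed.

(** A function with bounded partial derivatives is continuous. *)
Lemma bounded_partials_continuous A f (B : R) : open A ->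
  (forall j x, A x -> derivable f x (delta_mx 0 j)) ->
  (forall j x, A x -> `|rpartial j f x| <= B) ->
  forall x, A x -> {for x, continuous f}.
Proof.
move=> oA df fB x Ax.
have /nbhs_ballP[e /= e0 eA] := open_nbhs_nbhs (conj oA Ax).
have B0 (j : 'I_n) : 0 <= B by apply: le_trans _ (fB j x Ax).
(* The points x and y are joined by changing one coordinate at a time. *)
pose w (y : E) k : E := \row_i if (i < k)%N then y 0 i else x 0 i.
have step y (j : 'I_n) : ball x e y -> `|f (w y j.+1) - f (w y j)| <= B * `|y - x|.
  move=> /ball_rowP yx; have {}yx i := yx e0 i.
  have -> : w y j.+1 = w y j + (y 0 j - x 0 j) *: delta_mx 0 j.
    apply/rowP => i; rewrite !mxE eqxx/= ltnS leq_eqVlt.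
    have [ij|ij] := eqVneq i j; first by rewrite ij eqxx/= ltnn; ring.
    by rewrite val_eqE (negbTE ij)/= mulr0 addr0.
  apply: le_trans (@coord_lipschitz (ball x e) f B j _ _ _ _ _) _.
  - move=> s sj; apply: line_in_ball => // [i|]; rewrite mxE ?ltnn.
      by case: ifPn => _; rewrite ?subrr ?normr0// distrC.
    by rewrite addrAC subrr add0r (le_lt_trans sj)// distrC.
  - by move=> z /eA; exact: df.
  - by move=> z /eA; exact: fB.
  - apply: ler_wpM2l; first exact: B0.
    by have := coord_le_norm (y - x) j; rewrite !mxE.
apply/(@cvgrPdist_lt _ R^o _ (nbhs x) _ f (f x)) => eps eps0.
pose d := Num.min e (eps / (n%:R * `|B| + 1)).
have K0 : 0 < n%:R * `|B| + 1 :> R by rewrite ltr_pwDr// mulr_ge0.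
have d0 : 0 < d by rewrite lt_min e0 divr_gt0.
apply/nbhs_ballP; exists d => //= y xy.
have xye : ball x e y by apply: le_ball xy; rewrite ge_min lexx.
have -> : f x = f (w y 0) by congr f; apply/rowP => i; rewrite mxE.
have {2}-> : y = w y n by apply/rowP => i; rewrite mxE ltn_ord.
rewrite distrC -(telescope_sumr (fun k => f (w y k)))// big_mkord.
apply: le_lt_trans (ler_norm_sum _ _ _) _.
apply: le_lt_trans (_ : \sum_(i < n) `|B| * `|y - x| < _).
  apply: ler_sum => i _; apply: le_trans (step y i xye) _.
  by rewrite ler_wpM2r// ler_norm.
rewrite sumr_const card_ord -mulr_natl mulrA.
have : `|y - x| < eps / (n%:R * `|B| + 1).
  move: xy; rewrite -ball_normE /ball_/= distrC => /lt_le_trans; apply.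
  by rewrite ge_min lexx orbT.
rewrite ltr_pdivlMr// mulrC => /(le_lt_trans _); apply.
by rewrite ler_wpM2r// lerDl.
Qed.

End partial_derivatives.

(** * Periodic convolutions *)

Section convolution.
Context {R : realType} {n : nat} (q : 'I_n -> R).
Hypothesis q0 : forall j, 0 < q j.
Local Notation RT := (measurableTypeR R).
Local Notation T := (n.-tuple RT).
Local Notation E := 'rV[R]_n.
Local Notation rot := (@row_of_tuple R n).
Local Notation mu := (@lebesgue_tuple R n).
Local Notation D0 := (rot @^-1` cell q 0).
Implicit Types (f g h : E -> R).

Lemma measurable_cell0 : measurable D0.
Proof. exact: row_measurable_cell. Qed.
Hint Resolve measurable_cell0 : core.

(** The convolution of f and g over a period cell. *)
Definition conv f g (x : E) : R := \int[mu]_(t in D0) (f (x - rot t) * g (rot t)).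

(** Periodic Borel functions whose modulus has integral at most A on a cell. *)
Definition periodic_kernel f (A : R) :=
  [/\ row_measurable f, lattice_periodic q f & (\int[mu]_(t in D0) `|f (rot t)|%:E <= A%:E)%E].

Lemma row_measurable_EFin f (D : set T) : row_measurable f ->
  measurable_fun D (fun t => (f (rot t))%:E).
Proof. by move=> mf; apply: measurable_funTS; apply/measurable_EFinP. Qed.

Lemma row_measurable_norm f : row_measurable f -> row_measurable (fun y => `|f y|).
Proof. by move=> mf; apply: measurableT_comp. Qed.

Lemma bounded_periodic_kernel f (B : R) : row_measurable f -> lattice_periodic q f ->
  (forall x, `|f x| <= B) -> periodic_kernel f (B * fine (mu D0)).
Proof.
move=> mf pf fB; split => //.
apply: (@le_trans _ _ (\int[mu]_(t in D0) (cst B%:E t))%E).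
  apply: (@ge0_le_integral _ _ _ mu D0 measurable_cell0) => //=.
  - by apply: (row_measurable_EFin (f := fun y => `|f y|)); exact: row_measurable_norm.
  - by move=> t _; rewrite lee_fin.
rewrite integral_cst// EFinM fineK//.
by rewrite ge0_fin_numE//; exact: cell_measure_lty.
Qed.

Lemma periodic_kernel_norm f (A : R) : periodic_kernel f A ->
  periodic_kernel (fun y => `|f y|) A.
Proof.
move=> [mf pf fA]; split; first exact: row_measurable_norm.
  by move=> x z; rewrite pf.
by under eq_integral do rewrite normr_id.
Qed.

Lemma periodic_kernel_opp f (A : R) : periodic_kernel f A ->
  periodic_kernel (fun y => f (- y)) A.
Proof.
move=> [mf pf fA]; split.
- have := row_measurable_reflect 0 mf.
  by congr row_measurable; apply/funext => y; rewrite sub0r.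
- by move=> x z; rewrite opprD periodicN.
- rewrite -(@ge0_periodic_integral_reflect _ _ _ q0 0 0 0 (fun y => `|f y|%:E)) in fA.
  + by under eq_integral do rewrite -sub0r.
  + by apply/measurable_EFinP; exact: row_measurable_norm.
  + by move=> x; rewrite lee_fin.
  + by move=> x z; rewrite pf.
Qed.

Lemma conv_integrable f (A : R) g (B : R) x : periodic_kernel f A ->
  row_measurable g -> (forall y, `|g y| <= B) ->
  mu.-integrable D0 (fun t => (f (x - rot t) * g (rot t))%:E) /\
  (\int[mu]_(t in D0) `|f (x - rot t) * g (rot t)|%:E <= (A * B)%:E)%E.
Proof.
move=> [mf pf fA] mg gB; have B0 : 0 <= B by apply: le_trans (gB 0).
have mfx : row_measurable (fun y => f (x - y)) by exact: row_measurable_reflect.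
have mfg : row_measurable (fun y => f (x - y) * g y) by exact: row_measurableM.
have mabs : row_measurable (fun y => `|f y|) by exact: row_measurable_norm.
have intle : (\int[mu]_(t in D0) `|f (x - rot t) * g (rot t)|%:E <= (A * B)%:E)%E.
  apply: (@le_trans _ _ (\int[mu]_(t in D0) (B%:E * `|f (x - rot t)|%:E))%E).
    apply: (@ge0_le_integral _ _ _ mu D0 measurable_cell0) => //=.
    - by apply: (row_measurable_EFin (f := fun y => `|f (x - y) * g y|)); exact: row_measurable_norm.
    - apply: measurable_funeM; apply: (row_measurable_EFin (f := fun y => `|f (x - y)|)).
      exact: row_measurable_norm.
    - by move=> t _; rewrite -EFinM lee_fin normrM mulrC ler_wpM2r.
  rewrite ge0_integralZl//; last first.
    apply: (row_measurable_EFin (f := fun y => `|f (x - y)|)).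
    exact: row_measurable_norm.
  rewrite (@ge0_periodic_integral_reflect _ _ _ q0 0 0 x (fun y => `|f y|%:E))//; last 2 first.
  - exact: (row_measurable_EFin (f := fun y => `|f y|)).
  - by move=> y z; rewrite pf.
  by rewrite mulrC EFinM lee_wpmul2l.
split => //; apply/integrableP; split.
  exact: (row_measurable_EFin (f := fun y => f (x - y) * g y)).
by apply: le_lt_trans intle _; rewrite ltry.
Qed.

Lemma conv_le f (A : R) g (B : R) x : periodic_kernel f A ->
  row_measurable g -> (forall y, `|g y| <= B) -> `|conv f g x| <= A * B.
Proof.
move=> kf mg gB; have [intfg fgAB] := conv_integrable x kf mg gB.
apply: le_trans (le_normr_Rintegral _ intfg) _ => //.
rewrite -lee_fin; apply: le_trans fgAB; rewrite /Rintegral fineK//.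
rewrite ge0_fin_numE; last exact: integral_ge0.
by have /integrableP[_] := intfg.
Qed.

Lemma convDr f (A : R) g1 g2 (B : R) x : periodic_kernel f A ->
  row_measurable g1 -> row_measurable g2 ->
  (forall y, `|g1 y| <= B) -> (forall y, `|g2 y| <= B) ->
  conv f (fun y => g1 y + g2 y) x = conv f g1 x + conv f g2 x.
Proof.
move=> kf m1 m2 b1 b2; rewrite /conv -RintegralD//.
- by apply: eq_Rintegral => t _; rewrite mulrDr.
- by have [] := conv_integrable x kf m1 b1.
- by have [] := conv_integrable x kf m2 b2.
Qed.

Lemma eq_conv f f' g g' x : (forall y, f (x - y) * g y = f' (x - y) * g' y) ->
  conv f g x = conv f' g' x.
Proof. by move=> e; apply: eq_Rintegral => t _; exact: e. Qed.

(** Commutativity of the convolution, which moves x from one factor to the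
    other. *)
Lemma conv_reflect f g x : row_measurable f -> row_measurable g ->
  lattice_periodic q f -> lattice_periodic q g ->
  conv f g x = \int[mu]_(t in D0) (f (rot t) * g (x - rot t)).
Proof.
move=> mf mg pf pg.
rewrite -(@periodic_integral_reflect _ _ _ q0 0 0 x (fun y => f y * g (x - y))).
- by apply: eq_Rintegral => t _; rewrite subKr.
- by apply: row_measurableM => //; exact: row_measurable_reflect.
- by move=> y z /=; rewrite pf opprD addrA periodicN.
Qed.

(** A partial derivative is a limit of difference quotients. *)
Lemma row_measurable_rpartial j f : row_measurable f ->
  (forall x, derivable f x (delta_mx 0 j)) -> row_measurable (rpartial j f).
Proof.
move=> mf df; pose e k : R := k.+1%:R^-1.
pose F k : T -> R := fun t => (e k)^-1 * (f (e k *: delta_mx 0 j + rot t) - f (rot t)).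
apply: (@measurable_fun_cvg _ _ _ _ F).
  move=> k; apply: measurable_funM => //; apply: measurable_funB => //.
  have := row_measurable_reflect 0 (row_measurable_reflect (e k *: delta_mx 0 j) mf).
  rewrite /row_measurable; congr (measurable_fun _ _).
  by apply/funext => t /=; rewrite sub0r opprK.
move=> t _; have /cvgr_dnbhsP := df (rot t); apply.
split => [k|]; first by rewrite invr_eq0.
exact: cvg_harmonic.
Qed.

Lemma periodic_rpartial j f : lattice_periodic q f -> lattice_periodic q (rpartial j f).
Proof.
move=> pf x z; rewrite /rpartial -(derive_translate f _ _ _).2.
by congr ('D_(delta_mx 0 j) _ x); apply/funext => y; exact: pf.
Qed.

(** Differentiation of the convolution, the derivative falling on the second
    factor: only local integrability of the kernel is needed. *)
Lemma conv_derive_right f (A : R) g (B B' : R) j x : periodic_kernel f A ->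
  row_measurable g -> lattice_periodic q g -> (forall y, `|g y| <= B) ->
  (forall y, derivable g y (delta_mx 0 j)) -> (forall y, `|rpartial j g y| <= B') ->
  derivable (conv f g) x (delta_mx 0 j) /\
  rpartial j (conv f g) x = conv f (rpartial j g) x.
Proof.
move=> kf mg pg gB dg gB'; have [mf pf fA] := kf.
have B'0 : 0 <= B' by apply: le_trans (gB' 0).
pose F (s : R) (t : T) := f (rot t) * g (x - rot t + s *: delta_mx 0 j).
have convE s : conv f g (x + s *: delta_mx 0 j) = \int[mu]_(t in D0) F s t.
  rewrite conv_reflect//; apply: eq_Rintegral => t _.
  by rewrite /F addrAC.
have dF (s : R) (t : T) : is_derive s 1 (F ^~ t)
    (f (rot t) * rpartial j g (x - rot t + s *: delta_mx 0 j)).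
  have [d1 d2] := derive_line g (x - rot t) (delta_mx 0 j) s.
  have dd : is_derive s 1 (fun s : R => g (x - rot t + s *: delta_mx 0 j))
    (rpartial j g (x - rot t + s *: delta_mx 0 j)).
    by apply: DeriveDef; [exact/d1/dg|exact: d2].
  exact: (is_deriveZ (f (rot t)) dd).
have mgs s : row_measurable (fun y => g (x - y + s *: delta_mx 0 j)).
  have := row_measurable_reflect (x + s *: delta_mx 0 j) mg.
  by congr row_measurable; apply/funext => y; rewrite addrAC.
have intF s : mu.-integrable D0 (EFin \o F s).
  have [+ _] := conv_integrable 0 (periodic_kernel_opp kf) (mgs s)
    (fun y => gB (x - y + s *: delta_mx 0 j)).
  by congr (mu.-integrable _ _); apply/funext => t; rewrite /F/= sub0r opprK.
have Ia : (0 : R) \in `]-1, 1[ by rewrite in_itv/= ltrN10 ltr01.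
pose G t := `|f (rot t)| * B'.
have der1 s t : `]-1, 1[%classic s -> D0 t -> derivable (F ^~ t) s 1.
  by move=> _ _; have [] := dF s t.
have G0 t : 0 <= G t by rewrite mulr_ge0.
have d1F s t : partial1of2 F s t = f (rot t) * rpartial j g (x - rot t + s *: delta_mx 0 j).
  by rewrite partial1of2E; exact: (@derive_val _ _ _ _ _ _ _ (dF s t)).
have intG : mu.-integrable D0 (EFin \o G).
  have [+ _] := conv_integrable 0 (periodic_kernel_norm (periodic_kernel_opp kf))
    (row_measurable_cst B') (fun _ => lexx _).
  by congr (mu.-integrable _ _); apply/funext => t; rewrite /G/= sub0r opprK.
have GF s t : `]-1, 1[%classic s -> D0 t -> `|partial1of2 F s t| <= G t.
  by move=> _ _; rewrite d1F normrM ler_wpM2l.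
have dI := derivable_under_integral measurable_cell0 Ia (fun s _ => intF s) der1 G0 intG GF.
have vI := differentiation_under_integral measurable_cell0 Ia (fun s _ => intF s) der1 G0 intG GF.
have [d1 d2] := derive_along_line convE dI.
split; first exact: d1.
rewrite /rpartial d2 vI.
rewrite conv_reflect//; [|exact: row_measurable_rpartial|exact: periodic_rpartial].
by apply: eq_Rintegral => t _; rewrite d1F scale0r addr0.
Qed.

(** Differentiation of the convolution, the derivative falling on the first
    factor, which is only differentiable on the open set G: the second factor
    has to vanish at the points y with x - y outside of G. *)
Lemma conv_derive_left f (A : R) f' g (B B' : R) (V G N : set E) j x : periodic_kernel f A ->
  row_measurable f' -> row_measurable g -> (forall y, `|g y| <= B) ->
  open V -> V x -> (forall y, ~ N y -> g y = 0) ->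
  (forall x y, V x -> N y -> G (x - y)) ->
  (forall w, G w -> derivable f w (delta_mx 0 j)) ->
  (forall w, G w -> rpartial j f w = f' w) ->
  (forall w, G w -> `|f' w| <= B') ->
  derivable (conv f g) x (delta_mx 0 j) /\ rpartial j (conv f g) x = conv f' g x.
Proof.
move=> kf mf' mg gB oV Vx g0 VNG df dfE fB'; have [mf pf fA] := kf.
have B0 : 0 <= B by apply: le_trans (gB 0).
pose F (s : R) (t : T) := f (x + s *: delta_mx 0 j - rot t) * g (rot t).
have [e e0 eV] : exists2 e : R, 0 < e & forall s, `|s| < e -> V (x + s *: delta_mx 0 j).
  have /nbhs_ballP[e /= e0 eV] := open_nbhs_nbhs (conj oV Vx).
  exists e => // s se; apply: eV; apply: line_in_ball => // [i|].
    by rewrite subrr normr0.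
  by rewrite addrAC subrr add0r.
have sI s : `]- e, e[%classic s -> V (x + s *: delta_mx 0 j).
  by rewrite /= in_itv/= -ltr_norml; exact: eV.
have dF (s : R) (t : T) : `]- e, e[%classic s -> is_derive s 1 (F ^~ t)
    (f' (x + s *: delta_mx 0 j - rot t) * g (rot t)).
  move=> es; have [Nt|nNt] := pselect (N (rot t)); last first.
    rewrite g0// mulr0 (_ : F ^~ t = cst 0); first exact: is_derive_cst.
    by apply/funext => r; rewrite /F g0// mulr0.
  have [d1 d2] := derive_line f (x - rot t) (delta_mx 0 j) s.
  have Gs : G (x - rot t + s *: delta_mx 0 j).
    by rewrite addrAC; apply: VNG => //; exact: sI.
  have dd : is_derive s 1 (fun s : R => f (x - rot t + s *: delta_mx 0 j))
    (f' (x - rot t + s *: delta_mx 0 j)).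
    by apply: DeriveDef; [exact/d1/df|rewrite d2 -/(rpartial j f _) dfE].
  rewrite mulrC (_ : F ^~ t = g (rot t) *: (fun s : R => f (x - rot t + s *: delta_mx 0 j))).
    by rewrite addrAC; exact: (is_deriveZ (g (rot t)) dd).
  by apply/funext => r; rewrite /F addrAC mulrC.
have intF s : mu.-integrable D0 (EFin \o F s).
  by have [] := conv_integrable (x + s *: delta_mx 0 j) kf mg gB.
have Ia : (0 : R) \in `]-e, e[ by rewrite in_itv/= oppr_lt0 e0.
pose G' (t : T) := `|B'| * B.
have der1 s t : `]-e, e[%classic s -> D0 t -> derivable (F ^~ t) s 1.
  by move=> es _; have [] := dF s t es.
have G0 t : 0 <= G' t by rewrite mulr_ge0.
have d1F s t : `]-e, e[%classic s -> partial1of2 F s t = f' (x + s *: delta_mx 0 j - rot t) * g (rot t).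
  by move=> es; rewrite partial1of2E; exact: (@derive_val _ _ _ _ _ _ _ (dF s t es)).
have intG : mu.-integrable D0 (EFin \o G').
  have kc := bounded_periodic_kernel (row_measurable_cst (`|B'| * B))
    (fun _ _ => erefl) (fun _ => lexx _).
  have [+ _] := conv_integrable 0 kc (row_measurable_cst 1) (fun _ => lexx _).
  by congr (mu.-integrable _ _); apply/funext => t; rewrite /G'/= mulr1.
have GF s t : `]-e, e[%classic s -> D0 t -> `|partial1of2 F s t| <= G' t.
  move=> es _; rewrite d1F// /G'; have [Nt|nNt] := pselect (N (rot t)); last first.
    by rewrite g0// mulr0 normr0 mulr_ge0.
  rewrite normrM ler_pM//; apply: le_trans (ler_norm _); apply: fB'.
  by apply: VNG => //; exact: sI.
have dI := derivable_under_integral measurable_cell0 Ia (fun s _ => intF s) der1 G0 intG GF.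
have vI := differentiation_under_integral measurable_cell0 Ia (fun s _ => intF s) der1 G0 intG GF.
have convE s : conv f g (x + s *: delta_mx 0 j) = \int[mu]_(t in D0) F s t.
  by [].
have [d1 d2] := derive_along_line convE dI.
split; first exact: d1.
rewrite /rpartial d2 vI.
by apply: eq_Rintegral => t _; rewrite d1F// scale0r addr0.
Qed.

End convolution.

(** * Derivatives of the potential *)

Section potential_derivatives.
Context {R : realType} {n : nat} (q : 'I_n -> R).
Hypothesis q0 : forall j, 0 < q j.
Local Notation E := 'rV[R]_n.
Local Notation rot := (@row_of_tuple R n).
Local Notation mu := (@lebesgue_tuple R n).
Local Notation cell_measure := (fine (mu (rot @^-1` cell q 0))).

(** Sets invariant under the lattice. *)
Definition periodic_set (A : set E) := forall x z, A x -> A (x + qtrans q z).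

Lemma periodic_setP A x z : periodic_set A -> A (x + qtrans q z) <-> A x.
Proof.
move=> pA; split; last exact: pA.
by move/(pA _ (- z)); rewrite qtransN addrK.
Qed.

Lemma rpartials_periodic_on A (f : E -> R) s x z : open A -> periodic_set A ->
  (forall y w, A y -> f (y + qtrans q w) = f y) -> A x ->
  rpartials s f (x + qtrans q z) = rpartials s f x.
Proof.
move=> oA pA pf Ax; rewrite -rpartials_translate.
by apply: (rpartials_eq_on s oA) Ax => y; exact: pf.
Qed.

(** Periodic functions on A that are smooth with bounded derivatives: the
    derivatives, extended by 0, are bounded periodic Borel functions. *)
Section restrict_partials.
Variables (A : set E) (f : E -> R).
Hypotheses (oA : open A) (pA : periodic_set A).
Hypotheses (pf : forall y w, A y -> f (y + qtrans q w) = f y).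
Hypothesis sf : smooth_on A f.
Hypothesis bf : forall s, exists B : R, forall x, A x -> `|rpartials s f x| <= B.

Lemma smooth_continuous s x : A x -> {for x, continuous (rpartials s f)}.
Proof.
have /choice[B HB] := bf.
apply: (@bounded_partials_continuous _ _ A _ (\sum_j `|B (j :: s)|)) => // [j y Ay|j y Ay].
  exact: sf.
apply: le_trans (HB (j :: s) y Ay) _; apply: le_trans (ler_norm _) _.
by rewrite (bigD1 j)//= lerDl sumr_ge0.
Qed.

Lemma row_measurable_restrict_rpartials s : row_measurable (rpartials s f \_ A).
Proof. by apply: row_measurable_restrict => // x; exact: smooth_continuous. Qed.

Lemma periodic_restrict_rpartials s : lattice_periodic q (rpartials s f \_ A).
Proof.
move=> x z; rewrite !patchE; case: ifPn; rewrite ?inE ?notin_setE.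
  move/(periodic_setP x z pA) => Ax; rewrite ifT ?inE//.
  exact: (rpartials_periodic_on s z oA pA pf Ax).
by move=> nA; rewrite ifF//; apply/negbTE; rewrite notin_setE => /(pA z).
Qed.

Lemma restrict_rpartials_le s (B : R) : 0 <= B ->
  (forall x, A x -> `|rpartials s f x| <= B) ->
  forall x, `|(rpartials s f \_ A) x| <= B.
Proof.
move=> B0 fB x; rewrite patchE; case: ifPn; rewrite ?inE => Ax; last by rewrite normr0.
exact: fB.
Qed.

Lemma restrict_rpartials_bounded s : exists2 B : R, 0 <= B &
  forall x, `|(rpartials s f \_ A) x| <= B.
Proof.
have [B fB] := bf s; exists `|B| => //; apply: restrict_rpartials_le => // x Ax.
by apply: le_trans (ler_norm _); exact: fB.
Qed.

End restrict_partials.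

Variables (W V N O G : set E).
Hypotheses (oW : open W) (oV : open V) (oG : open G) (oO : open O).
Hypotheses (pW : periodic_set W) (pG : periodic_set G).
Hypothesis VNG : forall x y, V x -> N y -> G (x - y).
(* W and its exterior cover the space up to O. *)
Hypothesis WO : forall x, [\/ W x, O x | exists2 B : set E, open B & B x /\ B `<=` ~` W].

Variables (chi : E -> R) (D : R).
Hypotheses (chi01 : forall x, 0 <= chi x <= 1) (pchi : lattice_periodic q chi).
Hypothesis dchi : forall j x, derivable chi x (delta_mx 0 j).
Hypothesis chiD : forall j x, `|rpartial j chi x| <= D.
Hypothesis chiO : forall x, O x -> chi x = 0.
Hypothesis chiN : forall x, ~ N x -> chi x = 1.
Hypothesis dchiN : forall j x, ~ N x -> rpartial j chi x = 0.

Variables (h u : E -> R) (A : R).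
Hypothesis kh : periodic_kernel q h A.
Hypothesis sh : smooth_on G h.
Hypothesis bh : forall s, exists B : R, forall x, G x -> `|rpartials s h x| <= B.
Hypothesis pu : forall y w, W y -> u (y + qtrans q w) = u y.
Hypothesis su : smooth_on W u.
Hypothesis bu : forall s, exists B : R, forall x, W x -> `|rpartials s u x| <= B.

Local Notation h_ s := (rpartials s h \_ G).
Local Notation u_ s := (rpartials s u \_ W).

Let ph y w : G y -> h (y + qtrans q w) = h y.
Proof. by have [_ ph _] := kh; rewrite ph. Qed.

Let mchi : row_measurable chi.
Proof.
apply: continuous_row_measurable => x.
apply: (@bounded_partials_continuous _ _ setT chi D) => //; exact: openT.
Qed.

Let mu_ s : row_measurable (u_ s). Proof. exact: row_measurable_restrict_rpartials. Qed.
Let pu_ s : lattice_periodic q (u_ s). Proof. exact: periodic_restrict_rpartials. Qed.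
Let mh_ s : row_measurable (h_ s). Proof. exact: row_measurable_restrict_rpartials. Qed.
Let ph_ s : lattice_periodic q (h_ s). Proof. exact: periodic_restrict_rpartials. Qed.

Let chi_norm x : `|chi x| <= 1.
Proof. by have /andP[c0 c1] := chi01 x; rewrite ger0_norm. Qed.

(* The three densities of the formula for the derivatives of the potential. *)
Let psi s x := chi x * u_ s x.
Let kappa j s x := rpartial j chi x * u_ s x.
Let eta x := (1 - chi x) * u_ [::] x.

Let mpsi s : row_measurable (psi s). Proof. exact: row_measurableM. Qed.

Let ppsi s : lattice_periodic q (psi s).
Proof. by move=> x z; rewrite /psi pchi pu_. Qed.

Let mkappa j s : row_measurable (kappa j s).
Proof. by apply: row_measurableM => //; exact: row_measurable_rpartial. Qed.

Let meta : row_measurable eta.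
Proof.
apply: row_measurableM => //; rewrite (_ : (fun x => 1 - chi x) = (fun x => 1 + (-1) * chi x)).
  apply: row_measurableD; first exact: row_measurable_cst.
  by apply: row_measurableM => //; exact: row_measurable_cst.
by apply/funext => x; rewrite mulN1r.
Qed.

Let psi_le s (B : R) : 0 <= B -> (forall x, W x -> `|rpartials s u x| <= B) ->
  forall x, `|psi s x| <= B.
Proof.
move=> B0 uB x; rewrite /psi normrM -[leRHS]mul1r ler_pM//.
exact: restrict_rpartials_le.
Qed.

Let kappa_le j s (B : R) : 0 <= B -> (forall x, W x -> `|rpartials s u x| <= B) ->
  forall x, `|kappa j s x| <= D * B.
Proof.
move=> B0 uB x; rewrite /kappa normrM ler_pM//.
exact: restrict_rpartials_le.
Qed.

Let eta_le (B : R) : 0 <= B -> (forall x, W x -> `|u x| <= B) ->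
  forall x, `|eta x| <= B.
Proof.
move=> B0 uB x; rewrite /eta normrM -[leRHS]mul1r ler_pM//.
  by have /andP[? ?] := chi01 x; rewrite ger0_norm ?subr_ge0// gerBl.
exact: (restrict_rpartials_le (s := [::])).
Qed.

Let u_bounded s : exists2 B : R, 0 <= B & forall x, W x -> `|rpartials s u x| <= B.
Proof.
have [B uB] := bu s; exists `|B| => // x Wx.
by apply: le_trans (ler_norm _); exact: uB.
Qed.

Let h_bounded s : exists2 B : R, 0 <= B & forall x, G x -> `|rpartials s h x| <= B.
Proof.
have [B hB] := bh s; exists `|B| => // x Gx.
by apply: le_trans (ler_norm _); exact: hB.
Qed.

(** The cut-off derivative of u is differentiable on the whole space, also
    across the boundary of W, since the cut-off function vanishes there. *)
Lemma cutoff_derive s j x : derivable (psi s) x (delta_mx 0 j) /\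
  rpartial j (psi s) x = kappa j s x + psi (j :: s) x.
Proof.
have zero_case (B : set E) : open B -> B x -> (forall y, B y -> psi s y = 0) ->
    derivable (psi s) x (delta_mx 0 j) /\ rpartial j (psi s) x = 0.
  move=> oB Bx B0; have e : \forall y \near x, (cst 0 : E -> R) y = psi s y.
    by apply: open_near_eq oB Bx _ => y By; rewrite B0.
  split; first exact: near_eq_derivable e (derivable_cst _ _ _).
  by rewrite /rpartial -(near_eq_derive _ e) derive_cst.
have [Wx|Ox|[B oB [Bx BW]]] := WO x.
- have e : \forall y \near x, (chi * rpartials s u) y = psi s y.
    apply: open_near_eq oW Wx _ => y Wy.
    by rewrite /psi patchE ifT ?inE.
  have dM := derivableM (@dchi j x) (@su s j x Wx).
  split; first exact: near_eq_derivable e dM.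
  have -> : rpartial j (psi s) x = 'D_(delta_mx 0 j) (chi * rpartials s u) x.
    by apply/esym; exact: near_eq_derive.
  rewrite (deriveM (@dchi j x) (@su s j x Wx)).
  rewrite /kappa /psi !patchE !ifT ?inE// addrC /GRing.scale/=; congr (_ + _).
  by rewrite mulrC.
- have chi0 y : O y -> psi s y = 0 by move=> Oy; rewrite /psi chiO// mul0r.
  have [d ->] := zero_case O oO Ox chi0; split => //.
  have e : \forall y \near x, (cst 0 : E -> R) y = chi y.
    by apply: open_near_eq oO Ox _ => y Oy; rewrite chiO.
  rewrite /kappa /rpartial -(near_eq_derive _ e) derive_cst mul0r.
  by rewrite /psi chiO// mul0r addr0.
- have u0 t y : B y -> u_ t y = 0.
    by move=> /BW nW; rewrite patchE ifF//; apply/negbTE; rewrite notin_setE.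
  have [|d ->] := zero_case B oB Bx; first by move=> y By; rewrite /psi u0// mulr0.
  by split => //; rewrite /kappa /psi !u0// !mulr0 addr0.
Qed.

Let conv_psi_derive s j x : derivable (conv q h (psi s)) x (delta_mx 0 j) /\
  rpartial j (conv q h (psi s)) x = conv q h (kappa j s) x + conv q h (psi (j :: s)) x.
Proof.
have [B B0 uB] := u_bounded s; have [B' B'0 uB'] := u_bounded (j :: s).
have pB' y : `|rpartial j (psi s) y| <= D * B + B'.
  rewrite (cutoff_derive s j y).2; apply: le_trans (ler_normD _ _) _.
  by apply: lerD; [exact: kappa_le|exact: psi_le].
have [d ->] := conv_derive_right q0 x kh (mpsi s) (ppsi s) (psi_le B0 uB)
  (fun y => (cutoff_derive s j y).1) pB'.
split => //; rewrite (_ : rpartial j (psi s) = fun y => kappa j s y + psi (j :: s) y).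
  apply: (convDr (B := D * B + B') q0 x kh) => // y.
    by apply: le_trans (kappa_le j B0 uB y) _; rewrite lerDl.
  apply: le_trans (psi_le B'0 uB' y) _; rewrite lerDr mulr_ge0//.
  exact: le_trans (chiD j y).
by apply/funext => y; exact: (cutoff_derive s j y).2.
Qed.

Let h_kernel s (B : R) : 0 <= B -> (forall x, G x -> `|rpartials s h x| <= B) ->
  periodic_kernel q (h_ s) (B * cell_measure).
Proof.
by move=> B0 hB; apply: bounded_periodic_kernel => //; exact: restrict_rpartials_le.
Qed.

Let conv_h_derive s g (B : R) j x : row_measurable g -> (forall y, `|g y| <= B) ->
  (forall y, ~ N y -> g y = 0) -> V x ->
  derivable (conv q (h_ s) g) x (delta_mx 0 j) /\
  rpartial j (conv q (h_ s) g) x = conv q (h_ (j :: s)) g x.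
Proof.
move=> mg gB g0 Vx; have [C C0 hC] := h_bounded s; have [C' C'0 hC'] := h_bounded (j :: s).
have hE w : G w -> \forall y \near w, rpartials s h y = h_ s y.
  by move=> Gw; apply: open_near_eq oG Gw _ => y Gy; rewrite patchE ifT ?inE.
apply: (conv_derive_left q0 (h_kernel C0 hC) (mh_ (j :: s)) mg gB oV Vx g0 VNG).
- by move=> w Gw; apply: near_eq_derivable (hE w Gw) _; exact: sh.
- move=> w Gw; rewrite /rpartial -(near_eq_derive _ (hE w Gw)).
  by rewrite patchE ifT ?inE.
- by move=> w _; exact: (restrict_rpartials_le C'0 hC').
Qed.

Let kappaN j s y : ~ N y -> kappa j s y = 0.
Proof. by move=> Ny; rewrite /kappa dchiN// mul0r. Qed.

Let etaN y : ~ N y -> eta y = 0.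
Proof. by move=> Ny; rewrite /eta chiN// subrr mul0r. Qed.

Let conv_hG g x : (forall y, ~ N y -> g y = 0) -> V x ->
  conv q h g x = conv q (h_ [::]) g x.
Proof.
move=> g0 Vx; apply: eq_conv => y; have [Ny|/g0 ->] := pselect (N y); last by rewrite !mulr0.
by rewrite patchE ifT// inE; exact: VNG.
Qed.

(** The terms in which some derivatives fall on the kernel: those created when
    the cut-off function is differentiated. *)
Fixpoint corr (p s : seq 'I_n) (x : E) : R := if s is j :: s' then
  conv q (h_ p) (kappa j s') x + corr (rcons p j) s' x else 0.

Lemma corr_derive p s j x : V x ->
  derivable (corr p s) x (delta_mx 0 j) /\ rpartial j (corr p s) x = corr (j :: p) s x.
Proof.
move=> Vx; elim: s p => [|i s IH] p /=.
  by split; [exact: derivable_cst|rewrite /rpartial derive_cst].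
have [B B0 uB] := u_bounded s.
have [d1 e1] := conv_h_derive p j (mkappa i s) (kappa_le i B0 uB) (@kappaN i s) Vx.
have [d2 e2] := IH (rcons p i).
split; first exact: (derivableD d1 d2).
by rewrite /rpartial (deriveD d1 d2) -/(rpartial j _ x) e1 -/(rpartial j _ x) e2.
Qed.

(** The formula for the derivative along s of the potential on V. *)
Definition potential_partial (s : seq 'I_n) (x : E) : R :=
  conv q h (psi s) x + corr [::] s x + conv q (h_ s) eta x.

Lemma potential_partial_derive s j x : V x ->
  derivable (potential_partial s) x (delta_mx 0 j) /\
  rpartial j (potential_partial s) x = potential_partial (j :: s) x.
Proof.
move=> Vx; have [B B0 uB] := u_bounded [::].
have [d1 e1] := conv_psi_derive s j x.
have [d2 e2] := corr_derive [::] s j Vx.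
have [d3 e3] := conv_h_derive s j meta (eta_le B0 uB) etaN Vx.
split; first exact: (derivableD (derivableD d1 d2) d3).
rewrite /rpartial (deriveD (derivableD d1 d2) d3) (deriveD d1 d2).
rewrite -!/(rpartial j _ x) e1 e2 e3 /potential_partial /= -(conv_hG (@kappaN j s) Vx).
by congr (_ + _); ring.
Qed.

(* The potential. *)
Let P := conv q h (u_ [::]).

Lemma potentialE x : V x -> P x = potential_partial [::] x.
Proof.
move=> Vx; have [B B0 uB] := u_bounded [::].
rewrite /potential_partial/= addr0 -(conv_hG etaN Vx).
rewrite -(convDr (B := B) q0 x kh (mpsi [::]) meta).
- by apply: eq_conv => y; rewrite /psi /eta; congr (_ * _); ring.
- exact: psi_le.
- exact: eta_le.
Qed.

Lemma rpartials_potential s x : V x -> rpartials s P x = potential_partial s x.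
Proof.
elim: s x => [|j s IH] x Vx /=; first exact: potentialE.
rewrite /rpartial (near_eq_derive (g := potential_partial s)).
  exact: (potential_partial_derive s j Vx).2.
exact: (open_near_eq oV Vx IH).
Qed.

Lemma potential_smooth : smooth_on V P.
Proof.
move=> s j x Vx; apply: near_eq_derivable (potential_partial_derive s j Vx).1.
by apply: (open_near_eq oV Vx) => y Vy; rewrite rpartials_potential.
Qed.

Lemma potential_bounded s : exists B : R, forall x, V x -> `|rpartials s P x| <= B.
Proof.
have corrB p : exists B : R, forall x, `|corr p s x| <= B.
  elim: s p => [|i t IH] p /=; first by exists 0 => x; rewrite normr0.
  have [B B0 uB] := u_bounded t; have [C C0 hC] := h_bounded p.
  have [B' cB'] := IH (rcons p i).
  exists (C * cell_measure * (D * B) + B') => x.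
  apply: le_trans (ler_normD _ _) _; apply: lerD => //.
  exact: (conv_le q0 x (h_kernel C0 hC) (mkappa i t) (kappa_le i B0 uB)).
have [B1 cB1] := corrB [::].
have [B B0 uB] := u_bounded s; have [B' B'0 uB'] := u_bounded [::].
have [C C0 hC] := h_bounded s.
exists (A * B + B1 + C * cell_measure * B') => x Vx.
rewrite rpartials_potential//; apply: le_trans (ler_normD _ _) _; apply: lerD.
  apply: le_trans (ler_normD _ _) _; apply: lerD => //.
  exact: (conv_le q0 x kh (mpsi s) (psi_le B0 uB)).
exact: (conv_le q0 x (h_kernel C0 hC) meta (eta_le B'0 uB')).
Qed.

Section roumieu_bound.
Variables (rho Mh Mu : R).
Hypotheses (rho0 : 0 < rho) (Mh0 : 0 <= Mh) (Mu0 : 0 <= Mu).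
Let rate k : R := k`!%:R / rho ^+ k.
(* Roumieu norms only involve one ordering of each mixed derivative, that of the
   sorted lists of indices, and a factor of a sorted list is sorted. *)
Let sorted_ord (s : seq 'I_n) := sorted (fun i j : 'I_n => (i <= j)%N) s.
Hypothesis hMh : forall s x, sorted_ord s -> G x ->
  `|rpartials s h x| <= Mh * (size s)`!%:R / rho ^+ size s.
Hypothesis uMu : forall s x, sorted_ord s -> W x ->
  `|rpartials s u x| <= Mu * (size s)`!%:R / rho ^+ size s.

Let rate_ge0 k : 0 <= rate k.
Proof. by rewrite divr_ge0// exprn_ge0// ltW. Qed.

Let rateS k : k.+1%:R * rate k = rho * rate k.+1.
Proof.
rewrite /rate factS natrM exprS; field.
by rewrite expf_neq0 gt_eqF.
Qed.

Let rateM k l : rate k * rate l <= rate (k + l).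
Proof.
rewrite /rate mulrACA -invfM -exprD ler_pM2r ?invr_gt0 ?exprn_gt0//.
rewrite -natrM ler_nat -(@leq_pmul2l 'C(k + l, k)) ?bin_gt0 ?leq_addr//.
have := bin_fact (leq_addr l k); rewrite addKn => ->.
by rewrite leq_pmull// bin_gt0 leq_addr.
Qed.

Let sorted_cat_l (s t : seq 'I_n) : sorted_ord (s ++ t) -> sorted_ord s.
Proof. by case: s => //= i s; rewrite cat_path => /andP[]. Qed.

Let sorted_cat_r (s t : seq 'I_n) : sorted_ord (s ++ t) -> sorted_ord t.
Proof.
elim: s => //= i s IH H; apply: IH.
exact: path_sorted H.
Qed.

Let m0 : 0 <= cell_measure.
Proof. by rewrite fine_ge0. Qed.

(** The sum has as many terms as s has indices, each bounded by means of
    i! j! <= (i + j)!. *)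
Lemma corr_le p s x : V x -> sorted_ord (p ++ s) ->
  `|corr p s x| <= cell_measure * Mh * D * Mu * ((size s)%:R * rate (size p + size s).-1).
Proof.
move=> Vx; have D0 (j : 'I_n) : 0 <= D by apply: le_trans (chiD j x).
elim: s p => [|j s IH] p sps /=; first by rewrite normr0 mul0r mulr0.
apply: le_trans (ler_normD _ _) _.
have sp : sorted_ord p := sorted_cat_l sps.
have ss : sorted_ord s.
  by apply: (@sorted_cat_r (rcons p j)); rewrite cat_rcons.
have Bu0 : 0 <= Mu * (size s)`!%:R / rho ^+ size s by rewrite -mulrA mulr_ge0 ?rate_ge0.
have Bh0 : 0 <= Mh * (size p)`!%:R / rho ^+ size p by rewrite -mulrA mulr_ge0 ?rate_ge0.
have c1 := conv_le q0 x (h_kernel Bh0 (fun y => hMh sp)) (mkappa j s)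
  (kappa_le j Bu0 (fun y => uMu ss)).
have c2 : `|corr (rcons p j) s x| <= cell_measure * Mh * D * Mu * ((size s)%:R * rate (size p + size s)).
  by have := IH (rcons p j); rewrite cat_rcons size_rcons addSn; apply.
have c1' : `|conv q (h_ p) (kappa j s) x| <=
    cell_measure * Mh * D * Mu * rate (size p + size s).
  apply: le_trans c1 _; rewrite (_ : _ * (D * _) =
    cell_measure * Mh * D * Mu * (rate (size p) * rate (size s))).
    by apply: ler_wpM2l => //; rewrite !mulr_ge0// (D0 j).
  by rewrite /rate; ring.
apply: le_trans (lerD c1' c2) _; rewrite addnS/=.
by rewrite -[(size s).+1]add1n natrD mulrDl mul1r mulrDr.
Qed.

(** The Roumieu bound on the derivatives of the potential. *)
Lemma potential_le s x : 0 <= D -> sorted_ord s -> V x ->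
  `|rpartials s P x| <=
    (A + cell_measure * Mh * (D * rho + 1)) * Mu * (size s)`!%:R / rho ^+ size s.
Proof.
move=> D0 ss Vx; rewrite rpartials_potential//.
have Bu0 : 0 <= Mu * (size s)`!%:R / rho ^+ size s by rewrite -mulrA mulr_ge0 ?rate_ge0.
have Bh0 : 0 <= Mh * (size s)`!%:R / rho ^+ size s by rewrite -mulrA mulr_ge0 ?rate_ge0.
have c1 := conv_le q0 x kh (mpsi s) (psi_le Bu0 (fun y => uMu ss)).
have c2 : `|corr [::] s x| <= cell_measure * Mh * D * Mu * (rho * rate (size s)).
  apply: le_trans (corr_le (p := [::]) Vx ss) _.
  apply: ler_wpM2l; first by rewrite !mulr_ge0.
  rewrite add0n; case: (size s) => [|k]; last by rewrite rateS.
  by rewrite mul0r mulr_ge0// ltW.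
have uM1 y : W y -> `|u y| <= Mu.
  by move=> Wy; have := uMu (s := [::]) (x := y); rewrite /= fact0 mulr1 expr0 divr1; apply.
have c3 := conv_le q0 x (h_kernel Bh0 (fun y => hMh ss)) meta (eta_le Mu0 uM1).
apply: le_trans (ler_normD _ _) _; apply: le_trans (lerD (ler_normD _ _) (lexx _)) _.
apply: le_trans (lerD (lerD c1 c2) c3) _.
by rewrite le_eqVlt; apply/orP; left; apply/eqP; rewrite /rate; ring.
Qed.

End roumieu_bound.

End potential_derivatives.

(** * A step function and a distance to the lattice *)

Section smooth_step.
Context {R : realType}.

(** A quadratic bound on the remainder of a first-order expansion gives the
    derivative. *)
Lemma is_derive_quadratic (f : R -> R) (s d C : R) :
  (forall t, `|f t - f s - d * (t - s)| <= C * (t - s) ^+ 2) -> is_derive s 1 f d.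
Proof.
move=> fC.
have C0 : 0 <= C.
  have := fC (s + 1); rewrite (_ : s + 1 - s = 1); last by ring.
  by rewrite expr1n !mulr1; exact: le_trans.
have cvg : h^-1 *: ((f \o shift s) (h *: 1) - f s) @[h --> (0 : R)^'] --> d.
  apply/cvgrPdist_le => e e0; near=> h.
  have h0 : h != 0 by near: h; exact: nbhs_dnbhs_neq.
  have he : `|h| <= e / (C + 1).
    near: h; apply: dnbhs0_le; by rewrite divr_gt0// ltr_wpDl.
  rewrite /= scaler1 distrC.
  have -> : h^-1 *: (f (h + s) - f s) - d = h^-1 * (f (h + s) - f s - d * (h + s - s)).
    by rewrite addrK mulrBr (mulrCA _ d) mulVf// mulr1.
  rewrite normrM normfV ler_pdivrMl ?normr_gt0//.
  apply: le_trans (fC _) _; rewrite addrK -real_normK ?num_real// expr2 mulrCA.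
  apply: ler_wpM2l => //; move: he; rewrite ler_pdivlMr ?ltr_wpDl//; apply: le_trans.
  by rewrite mulrC ler_wpM2l// lerDl.
apply: DeriveDef; first by apply/cvg_ex; exists d.
exact: cvg_lim cvg.
Unshelve. all: by end_near. Qed.

Let pos (t : R) := Num.max t 0.

(* First-order expansion of the square of the positive part. *)
Let pos_quadratic (t s : R) :
  0 <= pos s ^+ 2 - pos t ^+ 2 - 2 * pos t * (s - t) <= (s - t) ^+ 2.
Proof.
have := sqr_ge0 (s - t); rewrite /pos.
case: (leP t 0) => t0; case: (leP s 0) => s0 H; apply/andP; split; try nra.
Qed.

(** A function of class C^1 that is 0 on ]-oo, 0] and 1 on [1, +oo[, piecewise
    quadratic. *)
Definition smooth_step (t : R) : R :=
  2 * pos t ^+ 2 - 4 * pos (t - 2^-1) ^+ 2 + 2 * pos (t - 1) ^+ 2.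

(** The derivative of [smooth_step]. *)
Definition smooth_step' (t : R) : R :=
  4 * pos t - 8 * pos (t - 2^-1) + 4 * pos (t - 1).

Lemma is_derive_smooth_step (t : R) : is_derive t 1 smooth_step (smooth_step' t).
Proof.
apply: (@is_derive_quadratic _ _ _ 8) => s.
have H (a : R) : 0 <= pos (s - a) ^+ 2 - pos (t - a) ^+ 2 - 2 * pos (t - a) * (s - t)
    <= (s - t) ^+ 2.
  by have := pos_quadratic (t - a) (s - a); rewrite (_ : s - a - (t - a) = s - t)//; ring.
have := H 0; have := H 2^-1; have := H 1; rewrite !subr0.
move=> /andP[? ?] /andP[? ?] /andP[? ?]; rewrite /smooth_step /smooth_step'.
by rewrite ler_norml; apply/andP; split; lra.
Qed.

Lemma smooth_step0 t : t <= 0 -> smooth_step t = 0.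
Proof.
move=> t0; rewrite /smooth_step /pos !max_r//; last 2 first.
- by lra.
- by lra.
by rewrite expr0n/= !mulr0 subrr addr0.
Qed.

Lemma smooth_step1 t : 1 <= t -> smooth_step t = 1.
Proof.
move=> t1; rewrite /smooth_step /pos !max_l; [by field|lra|lra|lra].
Qed.

Lemma smooth_step01 t : 0 <= smooth_step t <= 1.
Proof.
have := sqr_ge0 (t - 1); rewrite /smooth_step /pos => H; apply/andP; split;
  have [] := leP t 0; have [] := leP (t - 2^-1) 0; have [] := leP (t - 1) 0 => ? ? ?; nra.
Qed.

Lemma smooth_step'_le t : `|smooth_step' t| <= 2.
Proof.
rewrite /smooth_step' /pos ler_norml; apply/andP; split;
  have [] := leP t 0; have [] := leP (t - 2^-1) 0; have [] := leP (t - 1) 0 => ? ? ?; lra.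
Qed.

End smooth_step.

Section torus_distance.
Context {R : realType} {n : nat} (q : 'I_n -> R).
Hypothesis q0 : forall j, 0 < q j.
Local Notation E := 'rV[R]_n.

(** A smooth periodic function that is 0 on the lattice and positive elsewhere,
    used as a substitute for the distance to the lattice. *)
Definition torus_dist (x : E) : R := \sum_j (1 - cos (2 * pi / q j * x 0 j)).

Lemma cosD2piz (x : R) (k : int) : cos (x + 2 * pi * k%:~R) = cos x.
Proof.
have H (m : nat) y : cos (y + 2 * pi * m%:R) = cos y :> R.
  elim: m y => [|m IH] y; first by rewrite mulr0 addr0.
  have -> : y + 2 * pi * m.+1%:R = (y + 2 * pi * m%:R) + pi *+ 2 by rewrite -natr1; ring.
  by rewrite cosD2pi IH.
case: k => m; first exact: H.
by rewrite NegzE mulrNz mulrN -pmulrn -[LHS](H m.+1) subrK.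
Qed.

Lemma lattice_periodic_torus_dist : lattice_periodic q torus_dist.
Proof.
move=> x z; apply: eq_bigr => j _; congr (1 - _).
rewrite -(cosD2piz (2 * pi / q j * x 0 j) (z 0 j)) !mxE; congr cos.
by field; rewrite gt_eqF.
Qed.

Lemma torus_dist_ge j (x : E) : 1 - cos (2 * pi / q j * x 0 j) <= torus_dist x.
Proof.
rewrite /torus_dist (bigD1 j)//= lerDl; apply: sumr_ge0 => i _.
by rewrite subr_ge0 cos_le1.
Qed.

Lemma torus_dist0 : torus_dist 0 = 0.
Proof. by rewrite /torus_dist big1// => j _; rewrite mxE mulr0 cos0 subrr. Qed.

Lemma continuous_torus_dist : continuous torus_dist.
Proof.
have ccos (c : R) : continuous (fun t : R => 1 - cos (c * t)).
  move=> t; apply: cvgB; first exact: cvg_cst.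
  apply: (continuous_comp (f := fun t : R => c * t) (g := @cos R)).
    by apply: cvgM; [exact: cvg_cst|exact: cvg_id].
  exact: continuous_cos.
rewrite /torus_dist; apply: continuous_big => [|j _ x]; first exact: add_continuous.
apply: (continuous_comp (f := fun y : E => y 0 j) (g := fun t => 1 - cos (2 * pi / q j * t))).
  exact: coord_continuous.
exact: ccos.
Qed.

Lemma torus_dist_lattice x : qlattice q x -> torus_dist x = 0.
Proof.
by move=> [z _ <-]; rewrite -[qtrans q z]add0r lattice_periodic_torus_dist torus_dist0.
Qed.

Lemma torus_dist_cell (d : R) : 0 < d -> exists2 e : R, 0 < e &
  forall y, cell q (\row_j - (q j / 2)) y -> torus_dist y < e -> `|y| < d.
Proof.
move=> d0; pose c j : R := 1 - cos (2 * pi / q j * Num.min d (q j / 2)).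
have m0 j : 0 < Num.min d (q j / 2) by rewrite lt_min d0 divr_gt0.
have ang j (s : R) : 0 <= s <= q j / 2 -> 2 * pi / q j * s \in `[0, pi].
  move=> /andP[s0 s1]; rewrite in_itv/=; apply/andP; split.
    by rewrite mulr_ge0// divr_ge0 ?(ltW (q0 j))// mulr_ge0 ?pi_ge0.
  rewrite mulrAC ler_pdivrMr// mulrAC -[leRHS]mulrC; have := pi_ge0 R; nra.
have mq j : 0 <= Num.min d (q j / 2) <= q j / 2 by rewrite ltW//= ge_min lexx orbT.
have c0 j : 0 < c j.
  rewrite subr_gt0 -[X in _ < X](cos0 R) ltr_cos ?ang//.
    by rewrite mulr_gt0// divr_gt0// mulr_gt0// pi_gt0.
  by rewrite in_itv/= lexx pi_ge0.
have S0 : 0 <= \sum_j (c j)^-1 by apply: sumr_ge0 => j _; rewrite invr_ge0 ltW.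
exists (1 + \sum_j (c j)^-1)^-1; first by rewrite invr_gt0 ltr_pwDl.
move=> y cy ye; apply/row_norm_ltP => // j.
have yq : `|y 0 j| <= q j / 2.
  have := cy j; rewrite mxE => /andP[? ?]; rewrite ler_norml; apply/andP; split; lra.
have yc : 1 - cos (2 * pi / q j * y 0 j) < c j.
  apply: le_lt_trans (torus_dist_ge j y) _.
  apply: lt_le_trans ye _; rewrite -[leRHS]invrK lef_pV2 ?posrE ?invr_gt0// ?ltr_pwDl//.
  rewrite (bigD1 j)//= addrCA lerDl addr_ge0// sumr_ge0// => i _.
  by rewrite invr_ge0 ltW.
rewrite ltNge; apply/negP => dy; move: yc; apply/negP; rewrite -leNgt.
rewrite lerD2l lerN2 -cos_norm normrM gtr0_norm; last first.
  by rewrite divr_gt0// mulr_gt0// pi_gt0.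
have yq' : 0 <= `|y 0 j| <= q j / 2 by rewrite normr_ge0.
have [e|ne] := eqVneq (Num.min d (q j / 2)) `|y 0 j|; first by rewrite e.
apply: ltW; rewrite ltr_cos ?ang//.
rewrite ltr_pM2l; last by rewrite divr_gt0// mulr_gt0// pi_gt0.
by rewrite lt_neqAle ne/= ge_min dy.
Qed.

(** Points at which [torus_dist] is small are close to the lattice. *)
Lemma torus_dist_small (d : R) : 0 < d -> exists2 e : R, 0 < e &
  forall x, torus_dist x < e -> exists z, `|x + qtrans q z| < d.
Proof.
move=> /torus_dist_cell[e e0 ed]; exists e => // x xe.
have [z cz] := cell_reduce q0 (\row_j - (q j / 2)) x.
by exists z; apply: ed => //; rewrite lattice_periodic_torus_dist.
Qed.

Lemma torus_dist_eq0 x : torus_dist x <= 0 -> qlattice q x.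
Proof.
move=> x0; have [z cz] := cell_reduce q0 (\row_j - (q j / 2)) x.
suff xz : x + qtrans q z = 0.
  by exists (- z) => //; rewrite qtransN; apply/esym/eqP; rewrite -addr_eq0 xz.
apply/eqP; rewrite -normr_le0 leNgt; apply/negP => xz.
have [e e0 /(_ _ cz)] := torus_dist_cell xz.
by rewrite lattice_periodic_torus_dist (le_lt_trans x0 e0) ltxx => /(_ isT).
Qed.

Lemma closed_lattice : closed (qlattice q).
Proof.
rewrite (_ : qlattice q = torus_dist @^-1` [set t | t <= 0]).
  apply: closed_comp; first by move=> x _; exact: continuous_torus_dist.
  exact: closed_le.
by apply/seteqP; split => x /=; [move/torus_dist_lattice->|exact: torus_dist_eq0].
Qed.

End torus_distance.

(** * Cut-off functions *)

Section cutoff.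
Context {R : realType} {n : nat} (q : 'I_n -> R).
Hypothesis q0 : forall j, 0 < q j.
Local Notation E := 'rV[R]_n.

Lemma is_derive_comp1 (f g : R -> R) (x a b : R) :
  is_derive (f x) 1 g b -> is_derive x 1 f a -> is_derive x 1 (g \o f) (b * a).
Proof.
move=> dg df; have [df1 <-] := df; have [dg1 <-] := dg.
apply: DeriveDef.
  by apply/derivable1_diffP/differentiable_comp; exact/derivable1_diffP.
by rewrite -!derive1E derive1_comp.
Qed.

(** [0, 1]-valued periodic functions with bounded partial derivatives. *)
Definition cutoff_function (f : E -> R) (D : R) :=
  [/\ forall x, 0 <= f x <= 1, lattice_periodic q f,
      forall j x, derivable f x (delta_mx 0 j) &
      forall j x, `|rpartial j f x| <= D].

Lemma cutoff_function1 : cutoff_function (fun=> 1) 0.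
Proof.
split => // [x|j x]; first by rewrite ler01 lexx.
by rewrite /rpartial derive_cst normr0.
Qed.

Lemma cutoff_functionM f g (D D' : R) : cutoff_function f D -> cutoff_function g D' ->
  cutoff_function (fun x => f x * g x) (D + D').
Proof.
move=> [f01 pf df fD] [g01 pg dg gD]; split.
- move=> x; have /andP[? ?] := f01 x; have /andP[? ?] := g01 x.
  by rewrite mulr_ge0//= mulr_ile1.
- by move=> x z; rewrite pf pg.
- by move=> j x; exact: (derivableM (@df j x) (@dg j x)).
- move=> j x; rewrite /rpartial (deriveM (@df j x) (@dg j x)) addrC.
  have /andP[? ?] := f01 x; have /andP[? ?] := g01 x.
  apply: le_trans (ler_normD _ _) _; apply: lerD.
    rewrite /GRing.scale/= normrM -[leRHS]mul1r ler_pM//; last exact: fD.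
    by rewrite ger0_norm.
  rewrite /GRing.scale/= normrM -[leRHS]mul1r ler_pM//; last exact: gD.
  by rewrite ger0_norm.
Qed.

(** The cut-off functions from which all others are built: 0 where
    [torus_dist q (x - p)] is at most e / 2, and 1 where it is at least e. *)
Lemma cutoff_function_step (p : E) (e : R) : 0 < e -> exists D,
  cutoff_function (fun x => smooth_step (2 / e * torus_dist q (x - p) - 1)) D.
Proof.
move=> e0; pose w j : R := 2 * pi / q j.
have w0 j : 0 <= w j by rewrite divr_ge0 ?(ltW (q0 j))// mulr_ge0// pi_ge0.
exists (\sum_j (2 * (2 / e * w j))).
set f := (fun x => _).
have df j x : derivable f x (delta_mx 0 j) /\ `|rpartial j f x| <= 2 * (2 / e * w j).
  pose c := \sum_(i | i != j) (1 - cos (w i * (x - p) 0 i)).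
  pose G (t : R) := 2 / e * (1 - cos (w j * (x - p) 0 j + w j * t) + c) - 1.
  pose arg (t : R) := w j * (x - p) 0 j + w j * t.
  have dist_line t : torus_dist q (x + t *: delta_mx 0 j - p) = 1 - cos (arg t) + c.
    rewrite /torus_dist (bigD1 j)//=; congr (_ + _).
      by congr (1 - cos _); rewrite /arg !mxE !eqxx /w/= mulr1; ring.
    apply: eq_bigr => i ij; congr (1 - cos (_ * _)).
    by rewrite !mxE (negbTE ij) /= mulr0 addr0.
  have fE t : f (x + t *: delta_mx 0 j) = (smooth_step \o G) t.
    by rewrite /f dist_line.
  have dG : is_derive (0 : R) 1 G (2 / e * (sin (w j * (x - p) 0 j) * w j)).
    have darg : is_derive (0 : R) 1 arg (w j).
      apply: (@is_derive_quadratic _ _ _ _ 0) => t.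
      by rewrite mul0r /arg (_ : _ - _ = 0) ?normr0//; ring.
    have dC := is_derive_comp1 (is_derive_cos (arg 0)) darg.
    have dL (a : R) : is_derive a 1 (fun t : R => 2 / e * (1 - t + c) - 1) (- (2 / e)).
      apply: (@is_derive_quadratic _ _ _ _ 0) => t.
      by rewrite mul0r (_ : _ - _ = 0) ?normr0//; ring.
    apply: is_derive_eq (is_derive_comp1 (dL _) dC) _.
    by rewrite /arg mulr0 addr0; ring.
  have dSG := is_derive_comp1 (is_derive_smooth_step (G 0)) dG.
  have [d1 d2] := derive_along_line fE (ex_derive (is_derive := dSG)).
  split => //; rewrite /rpartial d2 derive1E derive_val normrM.
  apply: ler_pM => //; first exact: smooth_step'_le.
  rewrite normrM (ger0_norm (x := 2 / e)); last by rewrite divr_ge0// ltW.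
  apply: ler_wpM2l; first by rewrite divr_ge0// ltW.
  rewrite normrM (ger0_norm (w0 j)) -[leRHS]mul1r; apply: ler_wpM2r => //.
  exact: sin_max.
split.
- by move=> x; exact: smooth_step01.
- by move=> x z; rewrite /f addrAC lattice_periodic_torus_dist.
- by move=> j x; have [] := df j x.
- move=> j x; apply: le_trans (df j x).2 _; rewrite (bigD1 j)//= lerDl.
  apply: sumr_ge0 => i _; rewrite mulr_ge0// mulr_ge0// divr_ge0//; exact: ltW.
Qed.

(** The derivative vanishes where the function is maximal. *)
Lemma rpartial_max (f : E -> R) j x : (forall y, derivable f y (delta_mx 0 j)) ->
  (forall y, f y <= f x) -> rpartial j f x = 0.
Proof.
move=> df fx; have [_ l2] := derive_line f x (delta_mx 0 j) 0.
rewrite /rpartial; move: l2; rewrite scale0r addr0 => <-.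
apply: (derive_val (is_derive := @derive1_at_max R _ (-1) 1 0 _ _ _ _)).
- by lra.
- by move=> t _; apply/(derive_line f x (delta_mx 0 j) t).1; exact: df.
- by rewrite in_itv/= ltrN10 ltr01.
- by move=> t _; rewrite scale0r addr0.
Qed.

(** A cut-off function that vanishes near a compact set and its translates and
    that is equal to 1 away from them. *)
Lemma cutoff_exists (K : set E) (d : R) : compact K -> 0 < d ->
  exists chi D (O N : set E),
  [/\ cutoff_function chi D, open O,
      forall p z, K p -> O (p + qtrans q z),
      forall x, O x -> chi x = 0 &
      forall x, ~ N x -> chi x = 1] /\
  forall y, N y -> exists p z, K p /\ `|y - p + qtrans q z| < d.
Proof.
move=> cK d0; have [e e0 ed] := torus_dist_small q0 d0.
pose U p : set E := [set x | torus_dist q (x - p) < e / 2].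
have oU p : open (U p).
  rewrite (_ : U p = (fun x => torus_dist q (x - p)) @^-1` [set t | t < e / 2])//.
  apply: open_comp; last exact: open_lt.
  move=> x _; apply: (@continuous_comp E E R (fun x => x - p) (torus_dist q)).
    by apply: (@continuousB R E E idfun (cst p)); [exact: cvg_id|exact: cst_continuous].
  exact: continuous_torus_dist.
move: (cK); rewrite compact_cover => /(_ E K U (fun p _ => oU p)) [|S SK KS].
  move=> p Kp; exists p => //; rewrite /U/= subrr torus_dist0.
  by rewrite divr_gt0.
(* A finite number of the neighbourhoods U p cover K; the cut-off function is the
   product of those attached to their centres. *)
pose g p x := smooth_step (2 / e * torus_dist q (x - p) - 1).
pose chi x := \prod_(p <- finmap.enum_fset S) g p x.
have [D chiD] : exists D, cutoff_function chi D.
  rewrite /chi; elim: (finmap.enum_fset S) => [|p s [D IH]].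
    exists 0; rewrite (_ : (fun _ => _) = (fun=> 1)); first exact: cutoff_function1.
    by apply/funext => x; rewrite big_nil.
  have [D' gD'] := cutoff_function_step p e0; exists (D' + D).
  rewrite (_ : (fun _ => _) = (fun x => g p x * \prod_(i <- s) g i x)).
    exact: cutoff_functionM.
  by apply/funext => x; rewrite big_cons.
exists chi, D, (\bigcup_(p in [set` finmap.enum_fset S]) U p), [set x | exists2 p, p \in finmap.enum_fset S & torus_dist q (x - p) < e].
split; first split => //.
- by apply: bigcup_open => p _; exact: oU.
- move=> p z /KS[i iS Ui]; exists i => //.
  by rewrite /U/= addrAC lattice_periodic_torus_dist.
- move=> x [p pS Up]; rewrite /chi (big_rem p)//= /g smooth_step0 ?mul0r//.
  rewrite subr_le0 mulrAC ler_pdivrMr// mul1r mulrC -ler_pdivlMr//.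
  exact: ltW.
- move=> x Nx; rewrite /chi big_seq big1// => p pS; rewrite /g smooth_step1//.
  rewrite lerBrDr mulrAC ler_pdivlMr// -natr1 ler_pM2l//.
  by rewrite leNgt; apply/negP => xe; apply: Nx; exists p.
- move=> y [p pS /ed[z yz]]; exists p, z; split => //.
  by have := SK p pS; rewrite inE.
Qed.

End cutoff.

(** * Geometry of the periodized sets *)

Section periodic_geometry.
Context {R : realType} {n : nat} (q : 'I_n -> R).
Hypothesis q0 : forall j, 0 < q j.
Local Notation E := 'rV[R]_n.

(** The union of the translates of a set by the lattice. *)
Definition periodize (U : set E) : set E := [set x | exists z, U (x + qtrans q z)].

Lemma SperE U : Sper q U = periodize U.
Proof.
apply/seteqP; split => x [z].
  by move=> [w [Uw ->]]; exists (- z); rewrite qtransN addrAC subrr add0r.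
by move=> Uz; exists (- z), (x + qtrans q z); split => //; rewrite qtransN addrC addrK.
Qed.

Lemma periodic_set_periodize U : periodic_set q (periodize U).
Proof.
move=> x z [w Uw]; exists (w - z); rewrite qtransD qtransN.
by rewrite (_ : _ + (_ - _) = x + qtrans q w)//; apply/rowP => j; rewrite !mxE; ring.
Qed.

Lemma sub_periodize U : U `<=` periodize U.
Proof. by move=> x Ux; exists 0; rewrite qtrans0 addr0. Qed.

Lemma open_periodize U : open U -> open (periodize U).
Proof.
move=> oU; rewrite (_ : periodize U = \bigcup_z (fun x => x + qtrans q z) @^-1` U).
  apply: bigcup_open => z _; apply: open_comp => // x _.
  by apply: (@continuousD R E E idfun (cst (qtrans q z))); [exact: cvg_id|exact: cst_continuous].
by apply/seteqP; split => x [z]; [exists z|move=> _; exists z].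
Qed.

(** If x is outside of the union of the translates of K, [torus_dist q (x - k)] is
    positive for all k in K, and by compactness it stays so near x. *)
Lemma closed_periodize K : compact K -> closed (periodize K).
Proof.
move=> cK; rewrite -openC openE => x nKx; rewrite /interior.
have cont : continuous (fun p : E * E => torus_dist q (p.2 - p.1)).
  move=> p; apply: (@continuous_comp (E * E)%type E R (fun p => p.2 - p.1) (torus_dist q)).
    by apply: (@continuousB R E (E * E)%type snd fst); [exact: cvg_snd|exact: cvg_fst].
  exact: continuous_torus_dist.
have := iffLR (compact_near_coveringP K) cK E (nbhs x)
  (fun x' k => 0 < torus_dist q (x' - k)) _ _.
move=> H; have {}H : \forall x' \near x, K `<=` (fun k => 0 < torus_dist q (x' - k)).
  apply: H => k Kk.
  have xk : 0 < torus_dist q (x - k).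
    rewrite ltNge; apply/negP => /(torus_dist_eq0 q0)[z _ zx]; apply: nKx.
    by exists (- z); rewrite qtransN zx opprB addrCA subrr addr0.
  exact: (cont (k, x) _ (open_nbhs_nbhs (conj (@open_gt R 0) xk))).
apply: filterS H => y yK [z Kz]; have /= := yK _ Kz.
by rewrite opprD addNKr torus_dist_lattice ?ltxx// -qtransN; exists (- z).
Qed.

(** An open set contains a uniform neighbourhood of each of its compact subsets. *)
Lemma compact_in_open (K G : set E) : compact K -> open G -> K `<=` G ->
  exists2 d : R, 0 < d & forall k x, K k -> `|x - k| < d -> G x.
Proof.
move=> cK oG KG.
have H : \forall d \near 0^'+, K `<=` (fun k => ball k d `<=` G).
  apply: (iffLR (compact_near_coveringP K) cK R (0^'+)
    (fun d k => ball k d `<=` G)) => k Kk.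
  have /nbhs_ballP[e /= e0 eG] := open_nbhs_nbhs (conj oG (KG _ Kk)).
  exists (ball k (e / 2), [set d | d < e / 2]) => /=.
    split; first by apply/nbhsx_ballx; rewrite divr_gt0.
    by apply: nbhs_right_lt; rewrite divr_gt0.
  move=> [k' d] /= [kk' de] x k'x; apply: eG.
  rewrite (splitr e); apply: ball_triangle kk' _; apply: le_ball k'x; exact: ltW.
have [d [d0 dG]] : exists d : R, 0 < d /\ K `<=` (fun k => ball k d `<=` G).
  have /filter_ex[d [? ?]] : \forall d \near 0^'+, K `<=` (fun k => ball k d `<=` G) /\ 0 < d.
    by apply: filterI => //; exact: nbhs_right_gt.
  by exists d.
by exists d => // k x Kk xk; apply: (dG k Kk); rewrite -ball_normE /ball_/= distrC.
Qed.

Lemma cell_closure : cell q 0 `<=` closure (Qcell q).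
Proof.
move=> x cx B /nbhs_ballP[e /= e0 eB].
pose m j := Num.min (e / 2) ((q j - x 0 j) / 2).
have cxj j : 0 <= x 0 j < q j by have := cx j; rewrite mxE add0r.
have m0 j : 0 < m j.
  by have /andP[? ?] := cxj j; rewrite lt_min !divr_gt0// subr_gt0.
have mq j : m j <= (q j - x 0 j) / 2 by rewrite ge_min lexx orbT.
have me j : m j <= e / 2 by rewrite ge_min lexx.
exists (x + \row_j m j); split.
  move=> j; rewrite !mxE; have := cxj j; have := m0 j; have := mq j => ? ? /andP[? ?].
  by apply/andP; split; lra.
apply: eB; apply/ball_rowP => // j; rewrite !mxE opprD addrA subrr add0r normrN gtr0_norm//.
by apply: le_lt_trans (me j) _; lra.
Qed.

Lemma compact_closure_Qcell : compact (closure (Qcell q)).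
Proof.
apply: bounded_closed_compact; last exact: closed_closure.
pose M := \sum_j q j.
have QM : closure (Qcell q) `<=` [set x | `|x| <= M].
  have cM : closed [set x : E | `|x| <= M].
    apply: (@closed_comp E R (fun x => `|x|) [set t | t <= M]); last exact: closed_le.
    by move=> x _; exact: norm_continuous.
  rewrite [X in _ `<=` X](iffLR (closure_id _) cM); apply: closure_subset => x Qx /=.
  apply/row_norm_leP; first by apply: sumr_ge0 => j _; exact/ltW/q0.
  move=> j; have /andP[? ?] := Qx j; rewrite gtr0_norm// /M (bigD1 j)//=.
  apply: ler_wpDr; last exact: ltW.
  by apply: sumr_ge0 => i _; exact/ltW/q0.
exists M; split; first exact: num_real.
by move=> r Mr x /QM/= /le_trans; apply; exact: ltW.
Qed.

Lemma compact_sub_Qcell A : closure A `<=` Qcell q -> compact (closure A).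
Proof.
move=> AQ; apply: subclosed_compact compact_closure_Qcell _; first exact: closed_closure.
by apply: subset_trans AQ _; exact: subset_closure.
Qed.

(** A neighbourhood V of the complement of S[Omega2], a neighbourhood O of the
    boundary of S[Omega] on which a cut-off function chi vanishes, and a set N
    outside of which chi is 1, such that V - N is contained in the union of the
    translates of G. *)
Lemma potential_geometry (Omega Omega2 G : set E) :
  open Omega -> closure Omega `<=` Qcell q -> open Omega2 -> open G ->
  (forall t s, (closure (Qcell q) `\` Omega2) t -> boundary Omega s -> G (t - s)) ->
  exists (V N O : set E) (chi : E -> R) (D : R),
  [/\ open V, ~` Sper q Omega2 `<=` V, open O, cutoff_function q chi D &
      forall x y, V x -> N y -> periodize G (x - y)] /\
  [/\ forall x, O x -> chi x = 0, forall x, ~ N x -> chi x = 1 &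
      forall x, closure (Sper q Omega) x -> Sper q Omega x \/ O x].
Proof.
move=> oOm OmQ oOm2 oG Gts.
pose K2 := closure (Qcell q) `\` Omega2; pose B := boundary Omega.
have cB : compact B.
  apply: subclosed_compact (compact_sub_Qcell OmQ) _; last by move=> x [].
  by rewrite /B /boundary setDE; apply: closedI; [exact: closed_closure|apply: open_closedC; exact: open_interior].
have cK2 : compact K2.
  apply: subclosed_compact compact_closure_Qcell _; last by move=> x [].
  by rewrite /K2 setDE; apply: closedI; [exact: closed_closure|exact: open_closedC].
pose K3 := (fun p : E * E => p.1 - p.2) @` (K2 `*` B).
have cK3 : compact K3.
  apply: continuous_compact; last exact: compact_setX.
  apply: continuous_subspaceT => p.
  by apply: (@continuousB R E (E * E)%type fst snd); [exact: cvg_fst|exact: cvg_snd].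
(* The compact set K3 of the differences t - s has a neighbourhood of width d
   contained in G; half of it is given to V and half to N. *)
have [d d0 dG] : exists2 d : R, 0 < d & forall k x, K3 k -> `|x - k| < d -> G x.
  apply: compact_in_open => // _ [[t s] [K2t Bs] <-]; exact: Gts.
have d20 : 0 < d / 2 by rewrite divr_gt0.
have [chi [D [Z [N [[cchi oO BO chiO chiN] NB]]]]] := cutoff_exists q0 cB d20.
pose V : set E := \bigcup_(k in K2) periodize (ball k (d / 2)).
exists V, N, Z, chi, D; split; split => //.
- by apply: bigcup_open => k _; apply: open_periodize; exact: ball_open.
- move=> x nx; have [z cz] := cell_reduce q0 0 x.
  exists (x + qtrans q z); last by exists z; exact: ballxx.
  split; first exact: cell_closure.
  by move=> O2; apply: nx; rewrite SperE; exists z.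
- move=> x y [k K2k [z xk]] /NB[p [w [Bp yp]]].
  exists (z - w); apply: (dG (k - p)); first by exists (k, p).
  rewrite qtransD qtransN.
  rewrite (_ : _ - _ = (x + qtrans q z - k) - (y - p + qtrans q w)); last first.
    by apply/rowP => j; rewrite !mxE; ring.
  apply: le_lt_trans (ler_normB _ _) _; rewrite (splitr d); apply: ltrD => //.
  by move: xk; rewrite -ball_normE /ball_/= distrC.
- move=> x; rewrite SperE => cx.
  have : closure (periodize (closure Omega)) x.
    by apply: closure_subset cx => y [z Oy]; exists z; exact: subset_closure.
  rewrite -(iffLR (closure_id _) (closed_periodize (compact_sub_Qcell OmQ))).
  move=> [z clz]; have [Oz|nOz] := pselect (Omega (x + qtrans q z)); first by left; exists z.
  right; rewrite -(addrK (qtrans q z) x) -qtransN; apply: BO; split => //.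
  by move=> /interior_subset.
Qed.

End periodic_geometry.

(** * Complex-valued functions and Roumieu norms *)

Section complex_derivatives.
Context {R : realType} {n : nat}.
Local Notation E := 'rV[R]_n.
Local Notation C := R[i].
Implicit Types (u v : E -> C) (U : set E).

(** Real and imaginary parts of a complex-valued function. *)
Definition re u : E -> R := fun x => complex.Re (u x).
Definition im u : E -> R := fun x => complex.Im (u x).

Lemma re_cpartials s u : re (cpartials s u) = rpartials s (re u).
Proof. by elim: s => //= j s <-. Qed.

Lemma im_cpartials s u : im (cpartials s u) = rpartials s (im u).
Proof. by elim: s => //= j s <-. Qed.

Lemma re_le_normc (z : C) : `|complex.Re z| <= Normc.normc z.
Proof. by case: z => a b; rewrite /= -sqrtr_sqr ler_wsqrtr// lerDl sqr_ge0. Qed.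

Lemma im_le_normc (z : C) : `|complex.Im z| <= Normc.normc z.
Proof. by case: z => a b; rewrite /= -sqrtr_sqr ler_wsqrtr// lerDr sqr_ge0. Qed.

Lemma normc_le_reim (z : C) : Normc.normc z <= `|complex.Re z| + `|complex.Im z|.
Proof.
case: z => a b /=; rewrite -[leRHS]ger0_norm ?addr_ge0// -sqrtr_sqr ler_wsqrtr//.
rewrite sqrrD !real_normK ?num_real// addrAC lerDl mulrn_wge0// mulr_ge0//.
Qed.

(** Smoothness on an open set, with all derivatives bounded. *)
Definition smooth_bounded U (f : E -> R) := smooth_on U f /\
  forall s, exists B : R, forall x, U x -> `|rpartials s f x| <= B.

(** The same for complex-valued functions. *)
Definition csmooth_bounded U u := smooth_bounded U (re u) /\ smooth_bounded U (im u).

Lemma smooth_bounded_lin U f g (a b : R) : open U -> smooth_bounded U f -> smooth_bounded U g ->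
  smooth_bounded U (fun x => a * f x + b * g x).
Proof.
move=> oU [sf bf] [sg bg]; split; first exact: smooth_on_lin.
move=> s; have [B fB] := bf s; have [B' gB] := bg s.
exists (`|a| * B + `|b| * B') => x Ux; rewrite (rpartials_lin _ _ _ oU)//.
apply: le_trans (ler_normD _ _) _; rewrite !normrM.
by apply: lerD; apply: ler_wpM2l => //; [exact: fB|exact: gB].
Qed.

Lemma csmooth_boundedB U u v : open U -> csmooth_bounded U u -> csmooth_bounded U v ->
  csmooth_bounded U (u - v).
Proof.
have e f g : (fun x => f x - g x) = (fun x : E => 1 * f x + (-1) * g x) :> (E -> R).
  by apply/funext => x; rewrite mul1r mulN1r.
move=> oU [ru iu] [rv iv]; split.
  rewrite (_ : re (u - v) = (fun x => re u x - re v x)); last first.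
    by apply/funext => x; rewrite /re !fctE; case: (u x) (v x) => ? ? [].
  by rewrite e; exact: smooth_bounded_lin.
rewrite (_ : im (u - v) = (fun x => im u x - im v x)); last first.
  by apply/funext => x; rewrite /im !fctE; case: (u x) (v x) => ? ? [].
by rewrite e; exact: smooth_bounded_lin.
Qed.

Lemma within_continuousP U f : open U ->
  {within U, continuous f} <-> forall x, U x -> {for x, continuous (f : E -> R)}.
Proof.
move=> oU; have := continuous_open_subspace f oU; rewrite propeqE => H.
apply: (iff_trans H); split => c x; first by move=> Ux; apply: c; rewrite inE.
by rewrite inE; exact: c.
Qed.

Lemma continuous_within U f : (forall x, U x -> {for x, continuous (f : E -> R)}) ->
  {within U, continuous f}.
Proof.
move=> cf; apply: continuous_in_subspaceT => x; rewrite inE; exact: cf.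
Qed.

Lemma smooth_bounded_continuous U f s x : open U -> smooth_bounded U f -> U x ->
  {for x, continuous (rpartials s f)}.
Proof. by move=> oU [sf bf] Ux; exact: (smooth_continuous oU sf bf). Qed.

(** Where u is continuous, its continuous extension from U is u itself. *)
Lemma cl_extE U u x : closure U x -> {for x, continuous (re u)} ->
  {for x, continuous (im u)} -> cl_ext U u x = u x.
Proof.
move=> clU cr ci; have PF : ProperFilter (within U (nbhs x)).
  exact: within_nbhs_proper.
rewrite /cl_ext (_ : lim _ = re u x); last first.
  by apply/cvg_lim => //; exact: cvg_within_filter cr.
rewrite [X in Complex _ X](_ : _ = im u x); last first.
  by apply/cvg_lim => //; exact: cvg_within_filter ci.
by rewrite /re /im; case: (u x).
Qed.

Lemma cl_ext_cpartials U A s u x : open A -> csmooth_bounded A u -> A x ->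
  closure U x -> cl_ext U (cpartials s u) x = cpartials s u x.
Proof.
move=> oA [ru iu] Ax Ux; apply: cl_extE => //.
  by rewrite re_cpartials; exact: smooth_bounded_continuous Ax.
by rewrite im_cpartials; exact: smooth_bounded_continuous Ax.
Qed.

Lemma Cinf_cl_smooth U u : Cinf_cl U u -> smooth_on U (re u) /\ smooth_on U (im u).
Proof.
move=> cu; split => s j x Ux.
  have [[H _] _ _] := cu (size s).+1; have [+ _] := H s j x (ltnSn _) Ux.
  by rewrite -re_cpartials.
have [[H _] _ _] := cu (size s).+1; have [_ +] := H s j x (ltnSn _) Ux.
by rewrite -im_cpartials.
Qed.

Lemma compact_bounded_on (K : set E) (f : E -> R) : compact K ->
  {within K, continuous f} -> exists B : R, forall x, K x -> `|f x| <= B.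
Proof.
move=> cK cf; have /compact_bounded[M [_ HM]] := continuous_compact cf cK.
exists (M + 1) => x Kx; apply: (HM (M + 1)); first by rewrite ltrDl.
by exists x.
Qed.

(** All derivatives are bounded on the compact subsets of the closure. *)
Lemma Cinf_cl_bounded U K u s : Cinf_cl U u -> compact K -> K `<=` closure U ->
  exists B : R, forall x, U x -> K x ->
    `|rpartials s (re u) x| <= B /\ `|rpartials s (im u) x| <= B.
Proof.
move=> cu cK KU; have [_ _ H] := cu (size s); have [g [gr gi] gE] := H s (leqnn _).
have [B rB] := compact_bounded_on cK (continuous_subspaceW KU gr).
have [B' iB] := compact_bounded_on cK (continuous_subspaceW KU gi).
exists (`|B| + `|B'|) => x Ux Kx.
rewrite -re_cpartials -im_cpartials /re /im -(gE _ Ux); split.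
  by apply: le_trans (rB _ Kx) _; apply: le_trans (ler_norm _) _; rewrite lerDl.
by apply: le_trans (iB _ Kx) _; apply: le_trans (ler_norm _) _; rewrite lerDr.
Qed.

Local Notation mseq b := (flatten [seq nseq ((b : @mindex n) j) j | j <- enum 'I_n]).

Lemma size_mseq (b : mindex) : size (mseq b) = mdegree b.
Proof.
rewrite size_flatten /shape -map_comp sumnE big_map /mdegree big_enum/=.
by apply: eq_bigr => j _ /=; rewrite size_nseq.
Qed.

Lemma sorted_mseq (b : mindex) : sorted (fun i j : 'I_n => (i <= j)%N) (mseq b).
Proof.
have tr : transitive (fun i j : 'I_n => (i <= j)%N) by move=> x y z; exact: leq_trans.
rewrite sorted_pairwise//.
have : pairwise (fun i j : 'I_n => (i < j)%N) (enum 'I_n).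
  rewrite -sorted_pairwise; last by move=> x y z; exact: ltn_trans.
  have : sorted ltn (map val (enum 'I_n)) by rewrite val_enum_ord iota_ltn_sorted.
  by rewrite sorted_map.
elim: (enum 'I_n) => //= j l IH /andP[jl pl]; rewrite pairwise_cat IH// andbT.
apply/andP; split.
  apply/allrelP => x y /nseqP[-> _] /flattenP[t /mapP[i il ->]] /nseqP[-> _].
  by apply: ltnW; move/allP : jl => /(_ _ il).
by elim: (b j) => //= k ->; rewrite andbT; apply/allP => x /nseqP[-> _]; exact: leqnn.
Qed.

(** Sorted lists of indices correspond to multi-indices. *)
Lemma mseq_sorted (s : seq 'I_n) : sorted (fun i j : 'I_n => (i <= j)%N) s ->
  exists b : mindex, mseq b = s.
Proof.
move=> ss; exists [ffun j => count_mem j s].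
apply: (@sorted_eq _ (fun i j : 'I_n => (i <= j)%N)) => //.
- by move=> x y z; exact: leq_trans.
- by move=> x y; rewrite -eqn_leq => /eqP/val_inj.
- exact: sorted_mseq.
apply/allP => i _ /=; apply/eqP; rewrite count_flatten -map_comp sumnE big_map big_enum/=.
rewrite (bigD1 i)//= big1 => [|j ji].
  by rewrite count_nseq ffunE/= eqxx mul1n addn0.
by rewrite count_nseq/= (negbTE ji).
Qed.

Lemma roumieu_norm_bound (rho : R) U A u (M : R) (b : mindex) x : 0 < rho ->
  (roumieu_norm rho U A u <= M%:E)%E -> A x ->
  Normc.normc (cl_ext U (Dpartial b u) x) <= M * (mdegree b)`!%:R / rho ^+ mdegree b.
Proof.
move=> rho0 uM Ax; rewrite ler_pdivlMr ?exprn_gt0//.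
rewrite -ler_pdivrMr ?ltr0n ?fact_gt0// -lee_fin; apply: le_trans uM.
apply: le_trans (ereal_sup_ubound _); last by exists b.
rewrite -mulrA mulrC EFinM; apply: lee_wpmul2l.
  by rewrite lee_fin divr_ge0// exprn_ge0// ltW.
rewrite /supe le_max; apply/orP; right; apply: ereal_sup_ubound.
by exists x.
Qed.

Lemma roumieu_norm_le (rho : R) U A u (M : R) : 0 < rho -> 0 <= M ->
  (forall b x, A x ->
    Normc.normc (cl_ext U (Dpartial b u) x) <= M * (mdegree b)`!%:R / rho ^+ mdegree b) ->
  (roumieu_norm rho U A u <= M%:E)%E.
Proof.
move=> rho0 M0 H; apply: ub_ereal_sup => _ [b _ <-].
have k0 : 0 < rho ^+ mdegree b / (mdegree b)`!%:R.
  by rewrite divr_gt0 ?exprn_gt0// ltr0n fact_gt0.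
rewrite -lee_pdivlMl// -EFinM mulrC invf_div mulrA.
rewrite /supe ge_max lee_fin; apply/andP; split.
  by rewrite divr_ge0 ?exprn_ge0 ?(ltW rho0)// mulr_ge0.
by apply: ub_ereal_sup => _ [x Ax <-]; rewrite lee_fin; exact: H.
Qed.

Lemma roumieu_norm_ge0 (rho : R) U A u : 0 < rho -> (0 <= roumieu_norm rho U A u)%E.
Proof.
move=> rho0; apply: le_trans (ereal_sup_ubound _); last by exists [ffun=> 0%N].
apply: mule_ge0; first by rewrite lee_fin divr_ge0// exprn_ge0// ltW.
by rewrite /supe le_max lexx.
Qed.

(** On the points of an open set where the function is smooth, the Roumieu norm
    bounds the derivatives along sorted lists of indices. *)
Lemma roumieu_norm_rpartials (rho : R) U A u (M : R) s x : 0 < rho -> open U ->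
  csmooth_bounded U u -> (roumieu_norm rho U A u <= M%:E)%E ->
  sorted (fun i j : 'I_n => (i <= j)%N) s -> U x -> A x ->
  `|rpartials s (re u) x| <= M * (size s)`!%:R / rho ^+ size s /\
  `|rpartials s (im u) x| <= M * (size s)`!%:R / rho ^+ size s.
Proof.
move=> rho0 oU su uM /mseq_sorted[b bs] Ux Ax.
have := roumieu_norm_bound b rho0 uM Ax; rewrite -size_mseq bs.
rewrite /Dpartial bs (cl_ext_cpartials s oU su Ux (subset_closure Ux)) => H.
rewrite -re_cpartials -im_cpartials; split; apply: le_trans H.
  exact: re_le_normc.
exact: im_le_normc.
Qed.

End complex_derivatives.

Section transfer.
Context {R : realType} {n : nat} (q : 'I_n -> R).
Local Notation E := 'rV[R]_n.

Lemma open_translate (U : set E) c : open U -> open [set y | U (y + c)].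
Proof.
move=> oU; rewrite (_ : mkset _ = (fun y => y + c) @^-1` U)//.
apply: open_comp => // x _.
by apply: (@continuousD R E E idfun (cst c)); [exact: cvg_id|exact: cst_continuous].
Qed.

(** Let g be equal, on each translate of U, to the translate of f: the
    derivatives of g on the union of the translates are those of f. *)
Lemma rpartials_transfer U (f g : E -> R) s x z : open U ->
  (forall y w, U (y + qtrans q w) -> g y = f (y + qtrans q w)) ->
  U (x + qtrans q z) -> rpartials s g x = rpartials s f (x + qtrans q z).
Proof.
move=> oU gf Uz; rewrite -rpartials_translate.
have oUz := @open_translate U (qtrans q z) oU.
by apply: (rpartials_eq_on s oUz) Uz => y; exact: gf.
Qed.

Lemma smooth_bounded_transfer U (f g : E -> R) : open U ->
  (forall y w, U (y + qtrans q w) -> g y = f (y + qtrans q w)) ->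
  smooth_bounded U f -> smooth_bounded (periodize q U) g.
Proof.
move=> oU gf [sf bf]; split => [s j x [z Uz]|s].
  have oUz := @open_translate U (qtrans q z) oU.
  apply: (smooth_on_eq oUz (f := fun y => f (y + qtrans q z))) => // [y Uy|].
    by rewrite (gf _ _ Uy).
  exact: smooth_on_translate.
have [B fB] := bf s; exists B => x [z Uz].
by rewrite (rpartials_transfer s oU gf Uz); exact: fB.
Qed.

End transfer.

(** * Potentials of real kernels and densities *)

Section integrals_null_sets.
Context {R : realType} {n : nat}.
Local Notation T := (n.-tuple (measurableTypeR R)).
Local Notation mu := (@lebesgue_tuple R n).

(** Functions that agree off a null set are integrable together and have the same
    integral. *)
Lemma ae_eq_Rintegral (F F' : T -> R) (N : set T) :
  measurable_fun setT F -> measurable N -> mu N = 0%E ->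
  (forall t, ~ N t -> F t = F' t) -> mu.-integrable setT (EFin \o F') ->
  mu.-integrable setT (EFin \o F) /\ \int[mu]_t F t = \int[mu]_t F' t.
Proof.
move=> mF mN N0 FF' intF'.
have mF' : measurable_fun setT (EFin \o F') by have /integrableP[] := intF'.
have mEF : measurable_fun setT (EFin \o F) by apply/measurable_EFinP.
have ae : ae_eq mu setT (EFin \o F') (EFin \o F).
  exists N; split => // t /= nt; apply: contrapT => Nt; apply: nt => _.
  by rewrite FF'.
split; last by rewrite /Rintegral; congr fine; apply/esym; exact: ae_eq_integral.
apply/integrableP; split => //; have /integrableP[_] := intF'.
congr (_ < _)%E; apply: ae_eq_integral => //; try exact: measurableT_comp.
by exists N; split => // t /= nt; apply: contrapT => Nt; apply: nt => _; rewrite FF'.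
Qed.

End integrals_null_sets.

Section real_potential.
Context {R : realType} {n : nat} (q : 'I_n -> R).
Hypotheses (n0 : (0 < n)%N) (q0 : forall j, 0 < q j).
Local Notation E := 'rV[R]_n.
Local Notation rot := (@row_of_tuple R n).
Local Notation mu := (@lebesgue_tuple R n).
Local Notation cell_measure := (fine (mu (rot @^-1` cell q 0))).
Local Notation sorted_ord := (sorted (fun i j : 'I_n => (i <= j)%N)).

(** The kernel set to 0 on the lattice, where its values are arbitrary, so that
    it becomes periodic at all points. *)
Definition regularize (f : E -> R) : E -> R := f \_ (~` qlattice q).

Lemma qlattice_translate x z : qlattice q (x + qtrans q z) <-> qlattice q x.
Proof.
split=> [[w _ wx]|[w _ <-]]; last by exists (w + z) => //; rewrite qtransD.
by exists (w - z) => //; rewrite qtransD qtransN wx addrK.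
Qed.

Lemma lattice_periodic_regularize (f : E -> R) :
  (forall x z, ~ qlattice q x -> f (x + qtrans q z) = f x) ->
  lattice_periodic q (regularize f).
Proof.
move=> pf x z; rewrite /regularize !patchE.
have [Lx|nLx] := pselect (qlattice q x).
  rewrite !ifF//; apply/negbTE; rewrite notin_setE/=; first by apply.
  by apply; apply/qlattice_translate.
by rewrite !ifT ?inE//= ?pf// qlattice_translate.
Qed.

Lemma row_measurable_regularize (f : E -> R) :
  (forall x, ~ qlattice q x -> {for x, continuous f}) -> row_measurable (regularize f).
Proof.
move=> cf; apply: row_measurable_restrict => //.
by apply: closed_openC; exact: closed_lattice.
Qed.

Lemma row_measurable_off_lattice (f : E -> R) :
  (forall x, ~ qlattice q x -> {for x, continuous f}) -> row_measurable f.
Proof.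
move=> cf; rewrite (_ : f = fun x => regularize f x + (f x - regularize f x)).
  apply: row_measurableD; first exact: row_measurable_regularize.
  apply: (row_measurable_lattice (q := q)) => x Lx.
  by rewrite /regularize patchE ifT ?subrr// inE.
by apply/funext => x; rewrite addrC subrK.
Qed.

Variables (rho : R) (W V N O G : set E) (chi : E -> R) (D : R).
Hypotheses (rho0 : 0 < rho) (oW : open W) (oV : open V) (oG : open G) (oO : open O).
Hypothesis pW : periodic_set q W.
Hypothesis VNG : forall x y, V x -> N y -> periodize q G (x - y).
Hypothesis WO : forall x, [\/ W x, O x | exists2 B : set E, open B & B x /\ B `<=` ~` W].
Hypothesis cchi : cutoff_function q chi D.
Hypothesis chiO : forall x, O x -> chi x = 0.
Hypothesis chiN : forall x, ~ N x -> chi x = 1.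

Let oG' : open (periodize q G) := open_periodize oG.
Let pG' : periodic_set q (periodize q G) := periodic_set_periodize (U := G).

Let dchiN j x : ~ N x -> rpartial j chi x = 0.
Proof.
move=> Nx; have [chi01 _ dchi _] := cchi; apply: rpartial_max => [y|y]; first exact: dchi.
by rewrite (chiN Nx); have /andP[] := chi01 y.
Qed.

Let D0 : 0 <= D.
Proof.
by have [_ _ _ chiD] := cchi; apply: le_trans (chiD (Ordinal n0) 0).
Qed.

(** The integration domain of the potential. *)
Local Notation Dom := (Qcell q `&` W).

(** Admissible real kernels, with the integral A of the modulus on a cell and a
    Roumieu bound M on the translates of G. *)
Definition potential_kernel (f : E -> R) (A M : R) :=
  [/\ row_measurable f, periodic_kernel q (regularize f) A,
      smooth_bounded (periodize q G) (regularize f) &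
      forall s x, sorted_ord s -> periodize q G x ->
        `|rpartials s (regularize f) x| <= M * (size s)`!%:R / rho ^+ size s].

(** Admissible real densities: on the integration domain v agrees with a periodic
    smooth function on W with a Roumieu bound M. *)
Definition potential_density (v : E -> R) (M : R) := exists u : E -> R,
  [/\ forall x, Dom x -> u x = v x, forall y w, W y -> u (y + qtrans q w) = u y,
      smooth_bounded W u &
      forall s x, sorted_ord s -> W x ->
        `|rpartials s u x| <= M * (size s)`!%:R / rho ^+ size s].

Lemma open_Qcell : open (Qcell q).
Proof.
rewrite openE => x Qx; have FF : Filter (nbhs (x : E)) by exact: nbhs_filter.
apply: (@filter_forall E 'I_n (fun j => [set y : E | 0 < y 0 j < q j]) (nbhs x) FF) => j.
have oj : open [set t : R | 0 < t < q j].
  rewrite (_ : mkset _ = `]0, q j[%classic); first exact: interval_open.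
  by apply/seteqP; split => t /=; rewrite in_itv.
exact: (coord_continuous (i := 0) (j := j) (open_nbhs_nbhs (conj oj (Qx j)))).
Qed.

Let measurable_Dom : measurable (rot @^-1` Dom).
Proof. by apply: open_measurable_row; apply: openI => //; exact: open_Qcell. Qed.

(** The potential is a periodic convolution over the cell. *)
Lemma real_potential_conv f A M v (u : E -> R) x : potential_kernel f A M ->
  (forall y, Dom y -> u y = v y) -> (forall y w, W y -> u (y + qtrans q w) = u y) ->
  smooth_bounded W u ->
  mu.-integrable (rot @^-1` Dom) (fun t => (f (x - rot t) * v (rot t))%:E) /\
  \int[mu]_(t in rot @^-1` Dom) (f (x - rot t) * v (rot t)) =
    conv q (regularize f) (u \_ W) x.
Proof.
move=> [mf kf sf fM] uv pu [su bu].
have muW : row_measurable (u \_ W).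
  exact: (row_measurable_restrict_rpartials oW su bu [::]).
have [B B0 uB] := restrict_rpartials_bounded bu [::].
(* L consists of the hyperplanes y_j = 0 and y_j = x_j - q_j m.  Off L, the
   half-open cell agrees with the open one and x - y is not in the lattice. *)
pose L := [set y : E | exists j k, y 0 j = (if k is k'.+1 then
  if @unpickle int k' is Some m then x 0 j - q j * m%:~R else 0 else 0)].
have [mL L0] := countable_hyperplanes_measure0 (fun (j : 'I_n) k => if k is k'.+1 then
  if @unpickle int k' is Some m then x 0 j - q j * m%:~R else 0 else 0).
have Lx y : qlattice q (x - y) -> L y.
  move=> [z _ zxy]; exists (Ordinal n0), (pickle (z 0 (Ordinal n0))).+1.
  by rewrite pickleK; move/rowP : zxy => /(_ (Ordinal n0)); rewrite !mxE => ->; ring.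
have cellQ y : ~ L y -> cell q 0 y -> Qcell q y.
  move=> nL cy j; have := cy j; rewrite mxE add0r => /andP[y0 ->]; rewrite andbT.
  by rewrite lt_neqAle y0 andbT; apply/eqP => yj; apply: nL; exists j, 0%N.
have Qcel y : Qcell q y -> cell q 0 y.
  by move=> Qy j; have /andP[/ltW ? ?] := Qy j; rewrite mxE add0r; apply/andP.
pose F1 := (fun t => f (x - rot t) * v (rot t)) \_ (rot @^-1` Dom).
pose F2 := (fun t => regularize f (x - rot t) * (u \_ W) (rot t)) \_ (rot @^-1` cell q 0).
have mF1 : measurable_fun setT F1.
  rewrite (_ : F1 = (fun t => f (x - rot t) * (u \_ W) (rot t)) \_ (rot @^-1` Dom)).
    apply/(measurable_restrict _ measurable_Dom) => //; apply: measurable_funTS.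
    exact: (row_measurableM (row_measurable_reflect x mf) muW).
  apply/funext => t; rewrite /F1 !patchE; case: ifPn => //; rewrite inE => Dt.
  by rewrite ifT ?uv// inE; case: Dt.
have [intc _] := conv_integrable q0 x kf muW uB.
have intF2 : mu.-integrable setT (EFin \o F2).
  have := (integrable_mkcond _ (@measurable_cell0 R n q)).1 intc.
  by congr (mu.-integrable _ _); apply/funext => t; rewrite /F2 /= !patchE; case: ifP.
have F12 t : ~ (rot @^-1` L) t -> F1 t = F2 t.
  move=> nLt; rewrite /F1 /F2 !patchE.
  have freg : regularize f (x - rot t) = f (x - rot t).
    by rewrite /regularize patchE ifT// inE => /Lx.
  have [Dt|nDt] := pselect (Dom (rot t)).
    have [Qt Wt] := Dt; rewrite !ifT ?inE//=; last exact: Qcel.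
    by rewrite freg uv.
  rewrite ifF; last by apply/negbTE; rewrite notin_setE.
  case: ifPn => //; rewrite inE => ct; rewrite ifF ?mulr0//.
  by apply/negbTE; rewrite notin_setE => Wt; apply: nDt; split => //; exact: cellQ.
have [i1 i2] := ae_eq_Rintegral mF1 mL L0 F12 intF2.
split.
  apply/(integrable_mkcond _ measurable_Dom).
  by congr (mu.-integrable _ _): i1; apply/funext => t; rewrite /F1 /= !patchE; case: ifP.
by rewrite Rintegral_mkcond i2 /conv -Rintegral_mkcond.
Qed.

Lemma real_potential f (A M : R) v (Mu : R) : potential_kernel f A M ->
  potential_density v Mu -> 0 <= M -> 0 <= Mu ->
  let P x := \int[mu]_(t in rot @^-1` Dom) (f (x - rot t) * v (rot t)) in
  [/\ forall x, mu.-integrable (rot @^-1` Dom) (fun t => (f (x - rot t) * v (rot t))%:E),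
      lattice_periodic q P, smooth_bounded V P &
      forall s x, sorted_ord s -> V x -> `|rpartials s P x| <=
        (A + cell_measure * M * (D * rho + 1)) * Mu * (size s)`!%:R / rho ^+ size s].
Proof.
move=> kf [u [uv pu su uM]] M0 Mu0 P.
have PE : P = conv q (regularize f) (rpartials [::] u \_ W).
  by apply/funext => x; have [] := real_potential_conv x kf uv pu su.
have [chi01 pchi dchi chiD] := cchi.
have [mf kfA [sf bf] fM] := kf; have [su1 bu1] := su.
split.
- by move=> x; have [] := real_potential_conv x kf uv pu su.
- move=> x z; rewrite PE; apply: eq_Rintegral => t _; congr (_ * _).
  by have [_ pf _] := kfA; rewrite addrAC pf.
- split; first rewrite PE.
    exact: (potential_smooth q0 oW oV oG' oO pW pG' VNG WO chi01 pchi dchi chiD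
      chiO chiN dchiN kfA sf bf pu su1 bu1).
  move=> s; rewrite PE; exact: (potential_bounded q0 oW oV oG' oO pW pG' VNG WO chi01
    pchi dchi chiD chiO chiN dchiN kfA sf bf pu su1 bu1).
- move=> s x ss Vx; rewrite PE; exact: (potential_le q0 oW oV oG' oO pW pG' VNG WO chi01
    pchi dchi chiD chiO chiN dchiN kfA sf bf pu su1 bu1 rho0 M0 Mu0 fM uM D0 ss Vx).
Qed.

End real_potential.

(** * The potential as a bilinear map *)

Section complex_integral.
Context {R : realType} {n : nat}.
Local Notation T := (n.-tuple (measurableTypeR R)).
Local Notation E := 'rV[R]_n.
Local Notation C := R[i].
Local Notation rot := (@row_of_tuple R n).
Local Notation mu := (@lebesgue_tuple R n).

(** Integrability of the real and imaginary parts. *)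
Definition cintegrable (A : set E) (f : E -> C) :=
  mu.-integrable (rot @^-1` A) (fun t => (re f (rot t))%:E) /\
  mu.-integrable (rot @^-1` A) (fun t => (im f (rot t))%:E).

Lemma Rintegral_lin3 (D : set T) (a b : R) (F1 F2 F3 : T -> R) : measurable D ->
  mu.-integrable D (EFin \o F1) -> mu.-integrable D (EFin \o F2) ->
  mu.-integrable D (EFin \o F3) ->
  \int[mu]_(t in D) (a * F1 t + b * F2 t + F3 t) =
  a * \int[mu]_(t in D) F1 t + b * \int[mu]_(t in D) F2 t + \int[mu]_(t in D) F3 t.
Proof.
move=> mD i1 i2 i3.
have i1' : mu.-integrable D (EFin \o (fun t => a * F1 t)) by exact: (integrableZl mD a i1).
have i2' : mu.-integrable D (EFin \o (fun t => b * F2 t)) by exact: (integrableZl mD b i2).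
rewrite RintegralD//; last exact: (integrableD mD i1' i2').
by rewrite RintegralD// !RintegralZl.
Qed.

Lemma cintegral_lin (A : set E) (a : C) (f g : E -> C) : row_measurable_set A ->
  cintegrable A f -> cintegrable A g ->
  cintegral A (fun y => a * f y + g y) = a * cintegral A f + cintegral A g.
Proof.
move=> mA [rf if_] [rg ig]; case: a => a b.
have reE : \int[mu]_(t in rot @^-1` A) complex.Re (Complex a b * f (rot t) + g (rot t)) =
    a * \int[mu]_(t in rot @^-1` A) re f (rot t) +
    (- b) * \int[mu]_(t in rot @^-1` A) im f (rot t) + \int[mu]_(t in rot @^-1` A) re g (rot t).
  rewrite -Rintegral_lin3//; apply: eq_Rintegral => t _.
  by rewrite /re /im; case: (f _) (g _) => ? ? [? ?] /=; ring.
have imE : \int[mu]_(t in rot @^-1` A) complex.Im (Complex a b * f (rot t) + g (rot t)) =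
    a * \int[mu]_(t in rot @^-1` A) im f (rot t) +
    b * \int[mu]_(t in rot @^-1` A) re f (rot t) + \int[mu]_(t in rot @^-1` A) im g (rot t).
  rewrite -Rintegral_lin3//; apply: eq_Rintegral => t _.
  by rewrite /re /im; case: (f _) (g _) => ? ? [? ?] /=; ring.
rewrite /cintegral reE imE; apply/eqP; rewrite eq_complex /=; apply/andP; split; apply/eqP.
  by rewrite mulNr.
by [].
Qed.

End complex_integral.

Section potential_map.
Context {R : realType} {n : nat} (q : 'I_n -> R).
Hypotheses (n0 : (0 < n)%N) (q0 : forall j, 0 < q j).
Local Notation E := 'rV[R]_n.
Local Notation C := R[i].
Local Notation rot := (@row_of_tuple R n).
Local Notation mu := (@lebesgue_tuple R n).
Local Notation cell_measure := (fine (mu (rot @^-1` cell q 0))).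
Local Notation sorted_ord := (sorted (fun i j : 'I_n => (i <= j)%N)).

Variables (rho : R) (W V N O G Omega2 : set E) (chi : E -> R) (D : R).
Hypotheses (rho0 : 0 < rho) (oW : open W) (oV : open V) (oG : open G) (oO : open O).
Hypotheses (oOmega2 : open Omega2) (Omega2V : ~` Sper q Omega2 `<=` V).
Hypothesis pW : periodic_set q W.
Hypothesis VNG : forall x y, V x -> N y -> periodize q G (x - y).
Hypothesis WO : forall x, [\/ W x, O x | exists2 B : set E, open B & B x /\ B `<=` ~` W].
Hypothesis cchi : cutoff_function q chi D.
Hypothesis chiO : forall x, O x -> chi x = 0.
Hypothesis chiN : forall x, ~ N x -> chi x = 1.
Local Notation Dom := (Qcell q `&` W).

(** Smooth periodic functions on V whose derivatives satisfy Roumieu bounds. *)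
Definition roumieu_bounded (M : R) (P : E -> C) :=
  [/\ lattice_periodic q P, csmooth_bounded V P &
      forall s x, sorted_ord s -> V x ->
        `|rpartials s (re P) x| <= M * (size s)`!%:R / rho ^+ size s /\
        `|rpartials s (im P) x| <= M * (size s)`!%:R / rho ^+ size s].

Lemma smooth_boundedD f g : smooth_bounded V f -> smooth_bounded V g ->
  smooth_bounded V (fun x => f x + g x).
Proof.
move=> sf sg; rewrite (_ : (fun x => _) = (fun x => 1 * f x + 1 * g x)).
  exact: smooth_bounded_lin.
by apply/funext => x; rewrite !mul1r.
Qed.

Lemma rpartialsD f g s x : smooth_bounded V f -> smooth_bounded V g -> V x ->
  rpartials s (fun x => f x + g x) x = rpartials s f x + rpartials s g x.
Proof.
move=> [sf _] [sg _] Vx; rewrite (_ : (fun x => _) = (fun x => 1 * f x + 1 * g x)).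
  by rewrite (rpartials_lin _ _ _ oV)// !mul1r.
by apply/funext => y; rewrite !mul1r.
Qed.

Lemma roumieu_boundedD M M' P P' : roumieu_bounded M P -> roumieu_bounded M' P' ->
  roumieu_bounded (M + M') (fun x => P x + P' x).
Proof.
move=> [pP [rP iP] bP] [pP' [rP' iP'] bP'].
have reE : re (fun x => P x + P' x) = (fun x => re P x + re P' x).
  by apply/funext => x; rewrite /re; case: (P x) (P' x) => ? ? [].
have imE : im (fun x => P x + P' x) = (fun x => im P x + im P' x).
  by apply/funext => x; rewrite /im; case: (P x) (P' x) => ? ? [].
split; first by move=> x z; rewrite pP pP'.
  by split; rewrite ?reE ?imE; exact: smooth_boundedD.
move=> s x ss Vx; rewrite reE imE !rpartialsD//.
have [r1 i1] := bP s x ss Vx; have [r2 i2] := bP' s x ss Vx.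
by rewrite !mulrDl; split; apply: le_trans (ler_normD _ _) _; exact: lerD.
Qed.

Let U := Sper_minus q Omega2.

Let oU : open U.
Proof. by apply: closed_openC; exact: closed_closure. Qed.

Let clUV : closure U `<=` V.
Proof.
apply: subset_trans Omega2V; have cS : closed (~` Sper q Omega2).
  by apply: open_closedC; rewrite SperE; exact: open_periodize.
rewrite [X in _ `<=` X](iffLR (closure_id _) cS); apply: closure_subset.
by move=> x nx Sx; apply: nx; exact: subset_closure.
Qed.

(** Since V is a neighbourhood of the closure of S[Omega2]^-, the continuous
    extensions of the derivatives are the derivatives themselves.  The factor 2
    comes from the real and imaginary parts. *)
Lemma roumieu_bounded_mem M P : 0 <= M -> roumieu_bounded M P ->
  fsp_mem (roumieu_q q rho Omega2) P /\
  (fsp_norm (roumieu_q q rho Omega2) P <= (2 * M)%:E)%E.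
Proof.
move=> M0 [pP sP bP]; have [sr si] := sP.
have UV : U `<=` V by apply: subset_trans clUV; exact: subset_closure.
have cont s : ccontinuous (closure U) (cpartials s P).
  split; apply: continuous_within => x /clUV Vx.
    by have := smooth_bounded_continuous (s := s) oV sr Vx; rewrite -re_cpartials.
  by have := smooth_bounded_continuous (s := s) oV si Vx; rewrite -im_cpartials.
have bound b x : closure U x ->
    Normc.normc (cl_ext U (Dpartial b P) x) <= 2 * M * (mdegree b)`!%:R / rho ^+ mdegree b.
  move=> Ux; rewrite /Dpartial (cl_ext_cpartials _ oV sP (clUV Ux) Ux).
  have [r i] := bP _ x (sorted_mseq b) (clUV Ux).
  rewrite -!mulrA mulr2n mulrDl mul1r.
  apply: le_trans (normc_le_reim _) _; apply: lerD.
    have := r; rewrite -re_cpartials size_mseq -mulrA; exact.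
  have := i; rewrite -im_cpartials size_mseq -mulrA; exact.
have normM : (roumieu_q_norm q rho Omega2 P <= (2 * M)%:E)%E.
  by apply: roumieu_norm_le => //; [exact: mulr_ge0|move=> b x [_ Ux]; exact: bound].
split => //; split; last by apply: le_lt_trans normM _; rewrite ltry.
split.
- move=> m; split.
  + split => [s j x _ Ux|s _].
      have Vx := UV _ Ux; split.
        by have := sr.1 s j x Vx; rewrite -re_cpartials.
      by have := si.1 s j x Vx; rewrite -im_cpartials.
    by have [c1 c2] := cont s; split; apply: continuous_subspaceW (@subset_closure _ U) _.
  + exact: (cont [::]).
  + by move=> s _; exists (cpartials s P); first exact: cont.
- by move=> x z _; exact: pP.
- by move=> b; exists (2 * M * (mdegree b)`!%:R / rho ^+ mdegree b) => x Ux; exact: bound.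
Qed.

(** The potential as a bilinear map of the kernel and of the density. *)
Definition potential (h phi : E -> C) : E -> C :=
  fun x => cintegral Dom (fun y => h (x - y) * phi y).

(** Admissible complex kernels. *)
Definition ckernel (h : E -> C) (A M : R) :=
  potential_kernel q rho G (re h) A M /\ potential_kernel q rho G (im h) A M.

(** Admissible complex densities. *)
Definition cdensity (phi : E -> C) (M : R) :=
  potential_density q rho W (re phi) M /\ potential_density q rho W (im phi) M.

Lemma complex_potential h phi (A M Mu : R) : ckernel h A M -> cdensity phi Mu ->
  0 <= M -> 0 <= Mu ->
  (forall x, cintegrable Dom (fun y => h (x - y) * phi y)) /\
  roumieu_bounded (2 * ((A + cell_measure * M * (D * rho + 1)) * Mu)) (potential h phi).
Proof.
move=> [hr hi] [pr pi_] M0 Mu0.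
have mD : row_measurable_set Dom.
  by apply: open_measurable_row; apply: openI => //; exact: open_Qcell.
pose P f v x := \int[mu]_(t in rot @^-1` Dom) (f (x - rot t) * v (rot t)).
have rp f v (kf : potential_kernel q rho G f A M) (dv : potential_density q rho W v Mu) :=
  real_potential n0 q0 rho0 oW oV oG oO pW VNG WO cchi chiO chiN kf dv M0 Mu0.
have [irr prr srr brr] := rp _ _ hr pr.
have [iii pii sii bii] := rp _ _ hi pi_.
have [iri pri sri bri] := rp _ _ hr pi_.
have [iir pir sir bir] := rp _ _ hi pr.
have reE : re (potential h phi) = (fun x => 1 * P (re h) (re phi) x + (-1) * P (im h) (im phi) x).
  apply/funext => y; rewrite mul1r mulN1r /P -RintegralB//; [|exact: irr|exact: iii].
  by apply: eq_Rintegral => t _; rewrite /re /im; case: (h _) (phi _) => ? ? [].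
have imE : im (potential h phi) = (fun x => 1 * P (re h) (im phi) x + 1 * P (im h) (re phi) x).
  apply/funext => x; rewrite !mul1r /P -RintegralD//; [|exact: iri|exact: iir].
  by apply: eq_Rintegral => t _; rewrite /re /im; case: (h _) (phi _) => ? ? [? ?] /=; rewrite addrC.
split.
  move=> x; split.
    have := integrableB mD (irr x) (iii x).
    congr (mu.-integrable _ _); apply/funext => t /=; rewrite -EFinB /re /im.
    by case: (h _) (phi _) => ? ? [].
  have := integrableD mD (iri x) (iir x).
  congr (mu.-integrable _ _); apply/funext => t /=; rewrite -EFinD /re /im.
  by case: (h _) (phi _) => ? ? [? ?] /=; rewrite addrC.
split.
- move=> x z; apply/eqP; rewrite eq_complex; apply/andP; split; apply/eqP.
    by rewrite -!/(re _ _) reE /P/= prr pii.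
  by rewrite -!/(im _ _) imE /P/= pri pir.
- by split; rewrite ?reE ?imE; exact: smooth_bounded_lin.
- move=> s x ss Vx; rewrite reE imE.
  rewrite (rpartials_lin _ _ _ oV srr.1 sii.1 Vx) (rpartials_lin _ _ _ oV sri.1 sir.1 Vx).
  have two (K a b : R) : 2 * K * a / b = K * a / b + K * a / b by ring.
  rewrite !mul1r mulN1r two.
  split; apply: le_trans (ler_normD _ _) _; rewrite ?normrN; apply: lerD.
  + exact: brr.
  + exact: bii.
  + exact: bri.
  + exact: bir.
Qed.

(* PX and PY are qualitative properties of the elements of X and Y.  They are
   stable under differences, while membership in X or Y is not needed for the
   differences h - h0 and phi - phi0. *)
Variables (X Y : @fspace R n) (PX PY : set (E -> C)) (Ck : R).
Hypothesis Ck0 : 0 <= Ck.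
Hypothesis XP : forall h, fsp_mem X h -> PX h.
Hypothesis X_lty : forall h, fsp_mem X h -> (fsp_norm X h < +oo)%E.
Hypothesis X_ge0 : forall h, (0 <= fsp_norm X h)%E.
Hypothesis PXB : forall h h', PX h -> PX h' -> PX (h - h').
Hypothesis Xkernel : forall h a, PX h -> 0 <= a -> (fsp_norm X h <= a%:E)%E ->
  ckernel h (Ck * a) a.
Hypothesis YP : forall phi, fsp_mem Y phi -> PY phi.
Hypothesis Y_lty : forall phi, fsp_mem Y phi -> (fsp_norm Y phi < +oo)%E.
Hypothesis Y_ge0 : forall phi, (0 <= fsp_norm Y phi)%E.
Hypothesis PYB : forall phi phi', PY phi -> PY phi' -> PY (phi - phi').
Hypothesis Ydensity : forall phi b, PY phi -> 0 <= b -> (fsp_norm Y phi <= b%:E)%E ->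
  cdensity phi b.

Let Z := roumieu_q q rho Omega2.
Let L := 2 * (Ck + cell_measure * (D * rho + 1)).

Let D0 : 0 <= D.
Proof. by have [_ _ _ chiD] := cchi; apply: le_trans (chiD (Ordinal n0) 0). Qed.

Let L0 : 0 <= L.
Proof.
apply: mulr_ge0 => //; apply: addr_ge0 => //; apply: mulr_ge0; first by rewrite fine_ge0.
by apply: addr_ge0 => //; apply: mulr_ge0 => //; exact: ltW.
Qed.

Let mDom : row_measurable_set Dom.
Proof. by apply: open_measurable_row; apply: openI => //; exact: open_Qcell. Qed.

Let bounded_potential h phi a b : PX h -> PY phi -> 0 <= a -> 0 <= b ->
  (fsp_norm X h <= a%:E)%E -> (fsp_norm Y phi <= b%:E)%E ->
  (forall x, cintegrable Dom (fun y => h (x - y) * phi y)) /\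
  roumieu_bounded (L * (a * b)) (potential h phi).
Proof.
move=> Ph Pphi a0 b0 ha pb.
have [i r] := complex_potential (Xkernel Ph a0 ha) (Ydensity Pphi b0 pb) a0 b0.
split => //; rewrite (_ : L * _ = 2 * ((Ck * a + cell_measure * a * (D * rho + 1)) * b))//.
by rewrite /L; ring.
Qed.

Let norm_real (F : @fspace R n) h : (forall h, 0 <= fsp_norm F h)%E -> (fsp_norm F h < +oo)%E ->
  exists2 a : R, 0 <= a & (fsp_norm F h <= a%:E)%E.
Proof.
move=> F0 hy; exists (fine (fsp_norm F h)); first by rewrite fine_ge0.
by rewrite fineK// ge0_fin_numE.
Qed.

Let int_mem h phi x : fsp_mem X h -> fsp_mem Y phi ->
  cintegrable Dom (fun y => h (x - y) * phi y).
Proof.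
move=> Xh Yphi; have [a a0 ha] := norm_real X_ge0 (X_lty Xh).
have [b b0 pb] := norm_real Y_ge0 (Y_lty Yphi).
by have [] := bounded_potential (XP Xh) (YP Yphi) a0 b0 ha pb.
Qed.

Lemma potential_bilinear_continuous :
  [/\ maps_into X Y Z potential, bilinear_map X Y Z potential &
      continuous_map2 X Y Z potential].
Proof.
split.
- move=> h phi Xh Yphi; have [a a0 ha] := norm_real X_ge0 (X_lty Xh).
  have [b b0 pb] := norm_real Y_ge0 (Y_lty Yphi).
  have [_ r] := bounded_potential (XP Xh) (YP Yphi) a0 b0 ha pb.
  by have [] := roumieu_bounded_mem (mulr_ge0 L0 (mulr_ge0 a0 b0)) r.
- split=> [c h1 h2 phi x X1 X2 Yphi _|c h phi1 phi2 x Xh Y1 Y2 _].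
    rewrite /potential -cintegral_lin//; [|exact: int_mem|exact: int_mem].
    by congr cintegral; apply/funext => y; ring.
  rewrite /potential -cintegral_lin//; [|exact: int_mem|exact: int_mem].
  by congr cintegral; apply/funext => y; ring.
move=> h0 phi0 Xh0 Yphi0 e e0.
have [a a0 ha] := norm_real X_ge0 (X_lty Xh0).
have [b b0 pb] := norm_real Y_ge0 (Y_lty Yphi0).
(* With d <= 1 a common bound for the norms of h - h0 and phi - phi0, the three
   terms below have norms at most 2 L d d, 2 L d b and 2 L a d. *)
pose K := 2 * L * (1 + a + b) + 1.
have K0 : 0 < K.
  by rewrite ltr_wpDl//; do ?[apply: mulr_ge0 => //]; rewrite !addr_ge0.
exists (Num.min 1 (e / K)); first by rewrite lt_min ltr01 divr_gt0.
move=> h phi Xh Yphi; set d := Num.min 1 (e / K) => hd.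
have d0 : 0 < d by rewrite lt_min ltr01 divr_gt0.
have dh : (fsp_norm X (h - h0)%R <= d%:E)%E.
  by apply: le_trans (ltW hd); rewrite leeDl.
have dphi : (fsp_norm Y (phi - phi0)%R <= d%:E)%E.
  by apply: le_trans (ltW hd); rewrite leeDr.
have Pdh := PXB (XP Xh) (XP Xh0); have Pdphi := PYB (YP Yphi) (YP Yphi0).
have [i1 r1] := bounded_potential Pdh Pdphi (ltW d0) (ltW d0) dh dphi.
have [i2 r2] := bounded_potential Pdh (YP Yphi0) (ltW d0) b0 dh pb.
have [i3 r3] := bounded_potential (XP Xh0) Pdphi a0 (ltW d0) ha dphi.
(* Bilinearity holds at the level of integrable functions. *)
have -> : potential h phi - potential h0 phi0 =
    (fun x => potential (h - h0) (phi - phi0) x + potential (h - h0) phi0 x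
      + potential h0 (phi - phi0) x).
  apply/funext => x; rewrite !fctE; apply/eqP; rewrite subr_eq; apply/eqP.
  have i0 := int_mem x Xh0 Yphi0.
  have add f g : cintegrable Dom f -> cintegrable Dom g ->
      cintegral Dom f + cintegral Dom g = cintegral Dom (fun y => f y + g y) /\
      cintegrable Dom (fun y => f y + g y).
    move=> cf cg; split.
      rewrite -[cintegral Dom f]mul1r -cintegral_lin//.
      by congr cintegral; apply/funext => y; rewrite mul1r.
    have [f1 f2] := cf; have [g1 g2] := cg; split.
      have := integrableD mDom f1 g1; congr (mu.-integrable _ _).
      by apply/funext => t /=; rewrite -EFinD /re; case: (f _) (g _) => ? ? [].
    have := integrableD mDom f2 g2; congr (mu.-integrable _ _).
    by apply/funext => t /=; rewrite -EFinD /im; case: (f _) (g _) => ? ? [].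
  rewrite /potential; have [-> i12] := add _ _ (i1 x) (i2 x).
  have [-> i123] := add _ _ i12 (i3 x); have [-> _] := add _ _ i123 i0.
  by congr cintegral; apply/funext => y; rewrite !fctE; ring.
have rb := roumieu_boundedD (roumieu_boundedD r1 r2) r3.
have M0 : 0 <= L * (d * d) + L * (d * b) + L * (a * d).
  by rewrite !addr_ge0// mulr_ge0// mulr_ge0// ltW.
have [_ nZ] := roumieu_bounded_mem M0 rb.
apply: le_lt_trans nZ _; rewrite lte_fin.
have d1 : d <= 1 by rewrite ge_min lexx.
apply: (@le_lt_trans _ _ (2 * L * (1 + a + b) * d)).
  rewrite (_ : 2 * (_ + _ + _) = 2 * L * (d + b + a) * d); last by ring.
  apply: ler_wpM2r; first exact: ltW.
  by apply: ler_wpM2l; [exact: mulr_ge0|lra].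
have : d <= e / K by rewrite ge_min lexx orbT.
rewrite ler_pdivlMr// mulrC => /(lt_le_trans _); apply.
by rewrite ltr_pM2r// /K ltrDl.
Qed.

End potential_map.

(** * Kernels and densities in the function spaces *)

Section function_spaces.
Context {R : realType} {n : nat} (q : 'I_n -> R).
Hypotheses (n0 : (0 < n)%N) (q0 : forall j, 0 < q j).
Local Notation E := 'rV[R]_n.
Local Notation C := R[i].
Local Notation rot := (@row_of_tuple R n).
Local Notation mu := (@lebesgue_tuple R n).

Lemma Cinf_cl_csmooth_bounded (U : set E) (u : E -> C) : compact (closure U) ->
  Cinf_cl U u -> csmooth_bounded U u.
Proof.
move=> cU cu; have [sr si] := Cinf_cl_smooth cu.
have b s := Cinf_cl_bounded s cu cU (@subset_refl _ _).
split; split => // s; have [B uB] := b s; exists B => x Ux.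
  by have [] := uB x Ux (subset_closure Ux).
by have [] := uB x Ux (subset_closure Ux).
Qed.

Lemma roumieu_lty (rho : R) U (u : E -> C) : fsp_mem (roumieu rho U) u ->
  (fsp_norm (roumieu rho U) u < +oo)%E.
Proof. by case. Qed.

Section kernels.
Variables (lam rho : R) (G : set E).
Hypotheses (rho0 : 0 < rho) (lamn : 0 <= lam < n%:R) (oG : open G).
Hypothesis cG : compact (closure G).
Hypothesis Glat : closure G `&` qlattice q = set0.

(** The qualitative properties of the elements of [Hq]. *)
Definition regular_kernel : set (E -> C) := [set h |
  [/\ forall x, ~ qlattice q x -> {for x, continuous (re h)} /\ {for x, continuous (im h)},
      qperiodic q (~` qlattice q) h & csmooth_bounded G h]].

Lemma A0_norm_ge0 (l : R) (h : E -> C) : (0 <= A0_norm q l h)%E.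
Proof. by rewrite /A0_norm /supe le_max lexx. Qed.

Lemma A1_norm_ge0 (l : R) (h : E -> C) : (0 <= fsp_norm (A1 q l) h)%E.
Proof. by apply: adde_ge0; [|apply: sume_ge0 => j _]; exact: A0_norm_ge0. Qed.

Lemma Hq_norm_ge0 h : (0 <= fsp_norm (Hq q lam rho G) h)%E.
Proof. by apply: adde_ge0; [exact: A1_norm_ge0|exact: roumieu_norm_ge0]. Qed.

Lemma Hq_norm_lty h : fsp_mem (Hq q lam rho G) h -> (fsp_norm (Hq q lam rho G) h < +oo)%E.
Proof.
move=> [[_ [_ h0] hj] [_ hG]]; apply: lte_add_pinfty => //.
apply: lte_add_pinfty => //; apply: lte_sum_pinfty => j _.
by have [] := hj j.
Qed.

Lemma Hq_regular h : fsp_mem (Hq q lam rho G) h -> regular_kernel h.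
Proof.
move=> [[[[_ ch] ph] _ _] [hG _]].
have oL : open (~` qlattice q) by apply: closed_openC; exact: closed_lattice.
have [cr ci] := ch [::] isT.
split => //; last exact: Cinf_cl_csmooth_bounded.
by move=> x Lx; split; [exact: ((within_continuousP _ oL).1 cr)|
  exact: ((within_continuousP _ oL).1 ci)].
Qed.

Lemma regular_kernelB h h' : regular_kernel h -> regular_kernel h' ->
  regular_kernel (h - h').
Proof.
move=> [ch ph sh] [ch' ph' sh']; split.
- move=> x Lx; have [c1 c2] := ch x Lx; have [c1' c2'] := ch' x Lx.
  rewrite (_ : re (h - h') = re h - re h'); last first.
    by apply/funext => y; rewrite /re !fctE; case: (h y) (h' y) => ? ? [].
  rewrite (_ : im (h - h') = im h - im h'); last first.
    by apply/funext => y; rewrite /im !fctE; case: (h y) (h' y) => ? ? [].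
  by split; exact: continuousB.
- by move=> x z Lx; rewrite !fctE ph// ph'.
- exact: csmooth_boundedB.
Qed.

(** The norm of [Hq] controls both bounds required of a kernel: the integral of
    its modulus on a cell and the Roumieu bound on the translates of G. *)
Lemma regular_kernel_potential : exists2 Ck : R, 0 <= Ck &
  forall h a, regular_kernel h -> 0 <= a -> (fsp_norm (Hq q lam rho G) h <= a%:E)%E ->
  ckernel q rho G h (Ck * a) a.
Proof.
have [Ck Ck0 HCk] := singular_kernel_integral q0 lamn; exists Ck => //.
move=> h a [ch ph sh] a0 ha.
have hA0 : (A0_norm q lam h <= a%:E)%E.
  apply: le_trans ha; rewrite /= -addeA leeDl// adde_ge0//; last exact: roumieu_norm_ge0.
  by apply: sume_ge0 => j _; exact: A0_norm_ge0.
have hG : (roumieu_norm rho G (closure G) h <= a%:E)%E.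
  by apply: le_trans ha; rewrite /= leeDr//; exact: A1_norm_ge0.
have nG x : G x -> ~ qlattice q x.
  move=> Gx Lx; have : (closure G `&` qlattice q) x by split => //; exact: subset_closure.
  by rewrite Glat.
(* For f the real or the imaginary part of h. *)
have key (f : E -> R) : (forall x, ~ qlattice q x -> {for x, continuous f}) ->
    (forall x z, ~ qlattice q x -> f (x + qtrans q z) = f x) ->
    (forall x, `|f x| <= Normc.normc (h x)) -> smooth_bounded G f ->
    (forall s x, sorted (fun i j : 'I_n => (i <= j)%N) s -> G x ->
      `|rpartials s f x| <= a * (size s)`!%:R / rho ^+ size s) ->
    potential_kernel q rho G f (Ck * a) a.
  move=> cf pf fh sf fb.
  have mr : row_measurable (regularize q f) by exact: row_measurable_regularize.
  have pr : lattice_periodic q (regularize q f) by exact: lattice_periodic_regularize.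
  have tr y w : G (y + qtrans q w) -> regularize q f y = f (y + qtrans q w).
    move=> Gy; have Ly : ~ qlattice q y by move/(qlattice_translate q y w)/(nG _ Gy).
    by rewrite /regularize patchE ifT ?inE// pf.
  split.
  - exact: (row_measurable_off_lattice q0).
  - split => //.
    rewrite (@ge0_integral_fundamental_domain _ _ q (cell q 0) (cell q (\row_j (- (q j / 2))))
      (fun y => `|regularize q f y|%:E)).
    + apply: HCk => // x Qx x0; rewrite /regularize patchE; case: ifPn => Lx; last first.
        by rewrite normr0 mul0r.
      apply: le_trans (ler_wpM2r (powR_ge0 _ _) (fh x)) _.
      rewrite -lee_fin; apply: le_trans hA0; rewrite /A0_norm /supe le_max; apply/orP; right.
      by apply: ereal_sup_ubound; exists x => //; split => //; apply/eqP.
    + exact: fundamental_domain_cell.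
    + exact: fundamental_domain_cell.
    + by apply/measurable_EFinP; exact: row_measurable_norm.
    + by move=> x; rewrite lee_fin.
    + by move=> x z; rewrite pr.
  - exact: smooth_bounded_transfer tr sf.
  - by move=> s x ss [z Gz]; rewrite (rpartials_transfer s oG tr Gz); exact: fb.
have Gb s x : sorted (fun i j : 'I_n => (i <= j)%N) s -> G x ->
    `|rpartials s (re h) x| <= a * (size s)`!%:R / rho ^+ size s /\
    `|rpartials s (im h) x| <= a * (size s)`!%:R / rho ^+ size s.
  by move=> ss Gx; apply: (roumieu_norm_rpartials rho0 oG sh hG ss Gx); exact: subset_closure.
have [sr si] := sh; split; apply: key => //.
- by move=> x /ch[].
- by move=> x z Lx; rewrite /re ph.
- by move=> x; exact: re_le_normc.
- by move=> s x ss Gx; have [] := Gb s x ss Gx.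
- by move=> x /ch[].
- by move=> x z Lx; rewrite /im ph.
- by move=> x; exact: im_le_normc.
- by move=> s x ss Gx; have [] := Gb s x ss Gx.
Qed.

End kernels.

Lemma Qcell_cell : Qcell q `<=` cell q 0.
Proof.
by move=> y Qy j; have /andP[/ltW ? ?] := Qy j; rewrite mxE add0r; apply/andP.
Qed.

Section interior_densities.
Variables (rho : R) (Omega : set E).
Hypotheses (rho0 : 0 < rho) (oOm : open Omega) (OmQ : closure Omega `<=` Qcell q).

(** The periodic extension of a density on Omega. *)
Lemma periodic_extension (f : E -> C) : exists g : E -> C,
  (forall y w, Omega (y + qtrans q w) -> g y = f (y + qtrans q w)) /\
  lattice_periodic q g.
Proof.
have [z zP] := choice (cell_reduce q0 0).
exists (fun x => f (x + qtrans q (z x))); split => [y w Oy|y w].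
  congr (f (y + qtrans q _)); apply: cell_unique (zP y) _ => //.
  by apply: Qcell_cell; apply: OmQ; exact: subset_closure.
congr f; rewrite -addrA -qtransD; congr (y + qtrans q _).
apply: (cell_unique q0 (a := 0) (x := y)) (zP y).
by rewrite qtransD addrA; exact: zP.
Qed.

Lemma Qcell_Sper : Qcell q `&` Sper q Omega = Omega.
Proof.
rewrite SperE; apply/seteqP; split => x.
  move=> [Qx [z Oz]]; rewrite -(addr0 x) -(qtrans0 q).
  rewrite (_ : 0 = z :> 'rV[int]_n)//; apply: (cell_unique q0 (a := 0) (x := x)).
    by rewrite qtrans0 addr0; exact: Qcell_cell.
  by apply: Qcell_cell; apply: OmQ; exact: subset_closure.
move=> Ox; split; last exact: sub_periodize.
by apply: OmQ; exact: subset_closure.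
Qed.

Lemma interior_density phi b : csmooth_bounded Omega phi -> 0 <= b ->
  (fsp_norm (roumieu rho Omega) phi <= b%:E)%E -> cdensity q rho (Sper q Omega) phi b.
Proof.
move=> sphi b0 nphi; have [g [gphi pg]] := periodic_extension phi.
have bd s x : sorted (fun i j : 'I_n => (i <= j)%N) s -> Omega x ->
    `|rpartials s (re phi) x| <= b * (size s)`!%:R / rho ^+ size s /\
    `|rpartials s (im phi) x| <= b * (size s)`!%:R / rho ^+ size s.
  by move=> ss Ox; apply: (roumieu_norm_rpartials rho0 oOm sphi nphi ss Ox); exact: subset_closure.
have [sr si] := sphi.
have gr y w : Omega (y + qtrans q w) -> re g y = re phi (y + qtrans q w).
  by move=> Oy; rewrite /re (gphi _ _ Oy).
have gi y w : Omega (y + qtrans q w) -> im g y = im phi (y + qtrans q w).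
  by move=> Oy; rewrite /im (gphi _ _ Oy).
have gD x : (Qcell q `&` Sper q Omega) x -> g x = phi x.
  by rewrite Qcell_Sper => Ox; rewrite (gphi x 0) ?qtrans0 ?addr0.
split; [exists (re g)|exists (im g)]; split.
- by move=> x Dx; rewrite /re gD.
- by move=> y w _; rewrite /re pg.
- by rewrite SperE; exact: smooth_bounded_transfer gr sr.
- move=> s x ss; rewrite SperE => -[z Oz]; rewrite (rpartials_transfer s oOm gr Oz).
  by have [] := bd s _ ss Oz.
- by move=> x Dx; rewrite /im gD.
- by move=> y w _; rewrite /im pg.
- by rewrite SperE; exact: smooth_bounded_transfer gi si.
- move=> s x ss; rewrite SperE => -[z Oz]; rewrite (rpartials_transfer s oOm gi Oz).
  by have [] := bd s _ ss Oz.
Qed.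

End interior_densities.

Section exterior_densities.
Variables (rho : R) (Omega : set E).
Hypotheses (rho0 : 0 < rho) (oOm : open Omega) (OmQ : closure Omega `<=` Qcell q).
Local Notation W := (Sper_minus q Omega).

Lemma open_Sper_minus : open W.
Proof. by apply: closed_openC; exact: closed_closure. Qed.

Lemma periodic_set_Sper_minus : periodic_set q W.
Proof.
move=> x z nx clx; apply: nx => B Bx.
have cont : {for (x + qtrans q z), continuous (fun y : E => y - qtrans q z)}.
  by apply: (@continuousB R E E idfun (cst (qtrans q z))); [exact: cvg_id|exact: cst_continuous].
have Bz : nbhs (x + qtrans q z) ((fun y => y - qtrans q z) @^-1` B).
  by apply: cont; rewrite /= addrK.
have [y [Sy By]] := clx _ Bz; exists (y - qtrans q z); split => //.
move: Sy; rewrite !SperE -qtransN => Sy.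
exact: periodic_set_periodize.
Qed.

Lemma Qcell_Sper_minus : Qcell q `\` closure Omega = Qcell q `&` W.
Proof.
apply/seteqP; split => x [Qx nx]; split => // clx; apply: nx.
  move=> B Bx; have QBx : nbhs x (B `&` Qcell q).
    by apply: filterI => //; apply: open_nbhs_nbhs; split => //; exact: open_Qcell.
  have [y [Sy [By Qy]]] := clx _ QBx; exists y; split => //.
  by rewrite -(Qcell_Sper OmQ).
apply: closure_subset clx => y Oy; rewrite SperE; exact: sub_periodize.
Qed.

(** The qualitative properties of the elements of [roumieu_q]. *)
Definition regular_density : set (E -> C) := [set phi |
  (forall x z, W x -> phi (x + qtrans q z) = phi x) /\ csmooth_bounded W phi].

Lemma regular_densityB phi phi' : regular_density phi -> regular_density phi' ->
  regular_density (phi - phi').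
Proof.
move=> [p1 s1] [p2 s2]; split; last exact: (csmooth_boundedB open_Sper_minus).
by move=> x z Wx; rewrite !fctE p1// p2.
Qed.

(** The derivatives are bounded on the compact set of the points of the closed
    cell that lie in the closure of W, hence on W by periodicity. *)
Lemma roumieu_q_regular phi : fsp_mem (roumieu_q q rho Omega) phi -> regular_density phi.
Proof.
move=> [[cphi pphi _] _].
have pW x z : W x -> phi (x + qtrans q z) = phi x.
  by move=> Wx; apply: pphi; exact: subset_closure.
split => //; have [sr si] := Cinf_cl_smooth cphi.
have cK : compact (closure (Qcell q) `&` closure W).
  apply: subclosed_compact (compact_closure_Qcell q0) _; last by move=> x [].
  by apply: closedI; exact: closed_closure.
have pr y w : W y -> re phi (y + qtrans q w) = re phi y by move=> Wy; rewrite /re pW.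
have pi_ y w : W y -> im phi (y + qtrans q w) = im phi y by move=> Wy; rewrite /im pW.
have b s : exists B : R, forall x, W x ->
    `|rpartials s (re phi) x| <= B /\ `|rpartials s (im phi) x| <= B.
  have [|B HB] := Cinf_cl_bounded s cphi cK; first by move=> x [].
  exists B => x Wx; have [z cz] := cell_reduce q0 0 x.
  rewrite -(rpartials_periodic_on s z open_Sper_minus periodic_set_Sper_minus pr Wx).
  rewrite -(rpartials_periodic_on s z open_Sper_minus periodic_set_Sper_minus pi_ Wx).
  have Wz : W (x + qtrans q z) by exact: periodic_set_Sper_minus.
  by apply: HB => //; split; [exact: cell_closure|exact: subset_closure].
by split; split => // s; have [B HB] := b s; exists B => x /HB[].
Qed.

Lemma exterior_density phi b : regular_density phi -> 0 <= b ->
  (fsp_norm (roumieu_q q rho Omega) phi <= b%:E)%E -> cdensity q rho W phi b.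
Proof.
move=> [pW sphi] b0 nphi; have oW := open_Sper_minus; have pWs := periodic_set_Sper_minus.
have pr y w : W y -> re phi (y + qtrans q w) = re phi y by move=> Wy; rewrite /re pW.
have pi_ y w : W y -> im phi (y + qtrans q w) = im phi y by move=> Wy; rewrite /im pW.
have bd s x : sorted (fun i j : 'I_n => (i <= j)%N) s -> W x ->
    `|rpartials s (re phi) x| <= b * (size s)`!%:R / rho ^+ size s /\
    `|rpartials s (im phi) x| <= b * (size s)`!%:R / rho ^+ size s.
  move=> ss Wx; have [z cz] := cell_reduce q0 0 x.
  rewrite -(rpartials_periodic_on s z oW pWs pr Wx) -(rpartials_periodic_on s z oW pWs pi_ Wx).
  have Wz : W (x + qtrans q z) by exact: pWs.
  apply: (roumieu_norm_rpartials rho0 oW sphi nphi ss Wz).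
  split; last exact: subset_closure.
  split; first exact: cell_closure.
  move=> Oz; apply: Wz; apply: subset_closure; rewrite SperE; exact: sub_periodize.
have [sr si] := sphi.
split; [exists (re phi)|exists (im phi)]; split => //.
  by move=> s x ss Wx; have [] := bd s x ss Wx.
by move=> s x ss Wx; have [] := bd s x ss Wx.
Qed.

End exterior_densities.

End function_spaces.

Theorem theorem3p40 (R : realType) (n : nat) (hn : (2 <= n)%N)
  (q : 'I_n -> R) (hq : forall j, 0 < q j)
  (rho lam : R) (hrho : 0 < rho) (hlam0 : 0 < lam) (hlam1 : lam < n%:R - 1)
  (Omega Omega2 G : set 'rV[R]_n)
  (hOmega_bounded : bounded_set Omega) (hOmega_lip : lipschitz_open Omega)
  (hOmegaQ : closure Omega `<=` Qcell q)
  (hOmega2 : open Omega2)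
  (hOmega12 : closure Omega `<=` Omega2) (hOmega2Q : closure Omega2 `<=` Qcell q)
  (hG : open G) (hGc : compact (closure G))
  (hGlat : closure G `&` qlattice q = set0)
  (hGnbh : Omega !=set0 ->
     [set t - s | t in closure (Qcell q) `\` Omega2 & s in boundary Omega]
       `<=` G)
  (hG0 : Omega = set0 -> G = set0) :
  (Omega !=set0 ->
     let X := Hq q lam rho G in
     let Y := roumieu rho Omega in
     let Z := roumieu_q q rho Omega2 in
     [/\ maps_into X Y Z (Pplus Omega),
         bilinear_map X Y Z (Pplus Omega) &
         continuous_map2 X Y Z (Pplus Omega)]) /\
  (let X := Hq q lam rho G in
   let Y := roumieu_q q rho Omega in
   let Z := roumieu_q q rho Omega2 in
   [/\ maps_into X Y Z (Pminus q Omega),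
       bilinear_map X Y Z (Pminus q Omega) &
       continuous_map2 X Y Z (Pminus q Omega)]).
Proof.
have n0 : (0 < n)%N by apply: leq_trans hn.
have oOm : open Omega by case: hOmega_lip.
have lamn : 0 <= lam < n%:R by apply/andP; split; lra.
have Gts t s : (closure (Qcell q) `\` Omega2) t -> boundary Omega s -> G (t - s).
  move=> Ht Hs; have Om0 : Omega !=set0.
    by have [+ _] := Hs; move=> /(_ setT filterT)[y [Oy _]]; exists y.
  by apply: (hGnbh Om0); exists t => //; exists s.
have [V [N [Z [chi [D [[oV O2V oZ cchi VNG] [chiZ chiN clZ]]]]]]] :=
  potential_geometry hq oOm hOmegaQ hOmega2 hG Gts.
have [Ck Ck0 HCk] := regular_kernel_potential hq hrho lamn hG hGlat.
have oS : open (Sper q Omega) by rewrite SperE; exact: open_periodize.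
split => [_|] /=.
- have pS : periodic_set q (Sper q Omega) by rewrite SperE; exact: periodic_set_periodize.
  have WO x : [\/ Sper q Omega x, Z x |
      exists2 B : set 'rV[R]_n, open B & B x /\ B `<=` ~` Sper q Omega].
    have [/clZ[Sx|Zx]|ncl] := pselect (closure (Sper q Omega) x).
    + exact: Or31.
    + exact: Or32.
    + apply: Or33; exists (~` closure (Sper q Omega)).
        by apply: closed_openC; exact: closed_closure.
      by split => // y ny Sy; apply: ny; exact: subset_closure.
  have := potential_bilinear_continuous n0 hq hrho oS oV hG oZ hOmega2 O2V pS VNG WO
    cchi chiZ chiN Ck0 (@Hq_regular _ _ q hq lam rho G hGc) (@Hq_norm_lty _ _ q lam rho G)
    (Hq_norm_ge0 q lam G hrho) (@regular_kernelB _ _ q G hG) HCk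
    (X := Hq q lam rho G) (Y := roumieu rho Omega) (PY := csmooth_bounded Omega).
  have -> : potential q (Sper q Omega) = Pplus Omega by rewrite /potential Qcell_Sper.
  apply.
  + move=> phi [cphi _]; apply: Cinf_cl_csmooth_bounded cphi.
    exact: compact_sub_Qcell hOmegaQ.
  + exact: roumieu_lty.
  + by move=> phi; exact: roumieu_norm_ge0.
  + by move=> phi phi'; exact: csmooth_boundedB.
  + by move=> phi b; exact: interior_density.
- have oW := @open_Sper_minus _ _ q Omega.
  have WO x : [\/ Sper_minus q Omega x, Z x |
      exists2 B : set 'rV[R]_n, open B & B x /\ B `<=` ~` Sper_minus q Omega].
    have [/clZ[Sx|Zx]|ncl] := pselect (closure (Sper q Omega) x).
    + by apply: Or33; exists (Sper q Omega) => //; split => // y Sy; apply; exact: subset_closure.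
    + exact: Or32.
    + exact: Or31.
  have := potential_bilinear_continuous n0 hq hrho oW oV hG oZ hOmega2 O2V
    (@periodic_set_Sper_minus _ _ q Omega) VNG WO
    cchi chiZ chiN Ck0 (@Hq_regular _ _ q hq lam rho G hGc) (@Hq_norm_lty _ _ q lam rho G)
    (Hq_norm_ge0 q lam G hrho) (@regular_kernelB _ _ q G hG) HCk
    (X := Hq q lam rho G) (Y := roumieu_q q rho Omega) (PY := regular_density q Omega).
  have -> : potential q (Sper_minus q Omega) = Pminus q Omega.
    by rewrite /potential -Qcell_Sper_minus.
  apply.
  + exact: roumieu_q_regular.
  + by move=> phi [].
  + by move=> phi; exact: roumieu_norm_ge0.
  + exact: regular_densityB.
  + by move=> phi b; exact: exterior_density.
Qed.
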